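(* Let $p$ be a prime, let $\alpha \geq 1$, and let $F = \sum_{n \geq 0} a(n) x^n \in \mathbb{Z}_p[[x]] \setminus \{0\}$ be the Furstenberg series associated with a polynomial $P \in \mathbb{Z}_p[x, y]$. Let $h := \deg_x(P \bmod p)$ and $d := \deg_y(P \bmod p)$, and assume $h = \deg_x P$ and $d = \deg_y P$. Then the size (number of states) of the minimal $p$-automaton generating $(a(n) \bmod p^\alpha)_{n \geq 0}$ is at most $$(1 + o(1)) \, p^{\frac{1}{6} \alpha (\alpha + 1) ((2 h d - 1) \alpha + h d + 1)}$$ as any one of $p$, $\alpha$, $h$, or $d$ tends to infinity and the others remain constant.
   Context: $\mathbb{Z}_p$ denotes the $p$-adic integers. Furstenberg series: let $P \in \mathbb{Z}_p[x, y]$ with $P(0, 0) = 0$ and $\frac{\partial P}{\partial y}(0, 0) \not\equiv 0 \bmod p$. The Furstenberg series associated with $P$ is the unique $F \in \mathbb{Z}_p[[x]]$ satisfying $F(0) = 0$ and $P(x, F) = 0$. (These conditions on $P$ are part of the assumption that $P$ has an associated Furstenberg series.) Automata: a $p$-automaton is a deterministic finite automaton with output and input alphabet $\{0, 1, \dots, p-1\}$; it generates the sequence whose $n$th term is its output when fed the base-$p$ representation of $n$, least significant digit first. The minimal $p$-automaton generating a sequence is the smallest such automaton whose output is not affected by leading $0$s. Its number of states equals the number of elements of the $p$-kernel $\ker_p(b(n)_{n \geq 0}) = \{b(p^e n + r)_{n \geq 0} : e \geq 0,\ 0 \leq r \leq p^e - 1\}$ of the generated sequence $b(n)_{n\ge0}$.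 Asymptotic convention: the bound is uniform in $P$. That is, let $K(p, \alpha, h, d)$ be the maximum of the automaton size over all $P$ satisfying the hypotheses with the given $p, \alpha, h, d$, and let $N = \frac{1}{6} \alpha (\alpha + 1) ((2 h d - 1) \alpha + h d + 1)$. The claim is that $\limsup K(p, \alpha, h, d)/p^N \leq 1$ as one of the four parameters tends to infinity (through its admissible values) while the other three are fixed. *)

(* Defs.v *)
From HB Require Import structures.
From mathcomp Require Import all_boot all_order all_algebra.
From mathcomp Require Import boolp reals.
From mathcomp Require Import zify ring.

Set Implicit Arguments.
Unset Strict Implicit.
Unset Printing Implicit Defensive.

Import Order.TTheory GRing.Theory Num.Theory.

Local Open Scope ring_scope.

(* Elements of the inverse limit of the rings Z/p^k: [residue u k] is the
   representative of u modulo p^k in {0, ..., p^k - 1}. The compatibility condition alone forces residue u k < p^k. *)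
Record padic (p : nat) (p_pr : prime p) := Padic {
  residue : nat -> nat;
  residue_compat : forall k, residue k = (residue k.+1 %% p ^ k)%N }.

HB.instance Definition _ p (p_pr : prime p) := gen_eqMixin (padic p_pr).
HB.instance Definition _ p (p_pr : prime p) := gen_choiceMixin (padic p_pr).

Section PadicRing.
Variables (p : nat) (p_pr : prime p).
Local Notation Zp := (padic p_pr).
Implicit Types u v w : Zp.

Lemma padicP u v : residue u =1 residue v -> u = v.
Proof.
case: u v => [u hu] [v hv] /= /funext e; rewrite e in hu *.
by congr Padic; exact: Prop_irrelevance.
Qed.

Lemma residue_mod u k : (residue u k %% p ^ k)%N = residue u k.
Proof. by rewrite residue_compat modn_mod. Qed.

Lemma modn_exp_exp m k : (m %% p ^ k.+1 %% p ^ k)%N = (m %% p ^ k)%N.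
Proof. by rewrite modn_dvdm // dvdn_exp2l. Qed.

Lemma expp_gt0 k : (0 < p ^ k)%N.
Proof. by rewrite expn_gt0 prime_gt0. Qed.

Fact nat_compat m k : (m %% p ^ k = m %% p ^ k.+1 %% p ^ k)%N.
Proof. by rewrite modn_exp_exp. Qed.

Definition padic_nat m : Zp := Padic p_pr (nat_compat m).

Fact add_compat u v k :
  ((residue u k + residue v k) %% p ^ k =
   (residue u k.+1 + residue v k.+1) %% p ^ k.+1 %% p ^ k)%N.
Proof. by rewrite modn_exp_exp (residue_compat u) (residue_compat v) modnDm. Qed.

Definition padic_add u v : Zp := Padic p_pr (add_compat u v).

Fact mul_compat u v k :
  ((residue u k * residue v k) %% p ^ k =
   (residue u k.+1 * residue v k.+1) %% p ^ k.+1 %% p ^ k)%N.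
Proof. by rewrite modn_exp_exp (residue_compat u) (residue_compat v) modnMm. Qed.

Definition padic_mul u v : Zp := Padic p_pr (mul_compat u v).

Fact opp_compat u k :
  ((p ^ k - residue u k) %% p ^ k =
   (p ^ k.+1 - residue u k.+1) %% p ^ k.+1 %% p ^ k)%N.
Proof.
rewrite modn_exp_exp; apply/eqP.
have lk j : (residue u j <= p ^ j)%N.
  by rewrite -residue_mod ltnW // ltn_mod expp_gt0.
rewrite -(eqn_modDr (residue u k.+1)) subnK // {1}[residue u k]residue_compat.
rewrite -modnDmr subnK ?(ltnW (ltn_pmod _ (expp_gt0 k))) // modnn.
by rewrite expnS modnMl.
Qed.

Definition padic_opp u : Zp := Padic p_pr (opp_compat u).

Fact padic_addA : associative padic_add.
Proof. by move=> u v w; apply: padicP => k /=; rewrite modnDml modnDmr addnA. Qed.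

Fact padic_addC : commutative padic_add.
Proof. by move=> u v; apply: padicP => k /=; rewrite addnC. Qed.

Fact padic_add0 : left_id (padic_nat 0) padic_add.
Proof. by move=> u; apply: padicP => k /=; rewrite mod0n residue_mod. Qed.

Fact padic_addN : left_inverse (padic_nat 0) padic_opp padic_add.
Proof.
move=> u; apply: padicP => k /=; rewrite modnDml subnK ?modnn ?mod0n //.
by rewrite -residue_mod ltnW // ltn_mod expp_gt0.
Qed.

HB.instance Definition _ :=
  GRing.isZmodule.Build Zp padic_addA padic_addC padic_add0 padic_addN.

Fact padic_mulA : associative padic_mul.
Proof. by move=> u v w; apply: padicP => k /=; rewrite modnMml modnMmr mulnA. Qed.

Fact padic_mulC : commutative padic_mul.
Proof. by move=> u v; apply: padicP => k /=; rewrite mulnC. Qed.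

Fact padic_mul1 : left_id (padic_nat 1) padic_mul.
Proof. by move=> u; apply: padicP => k /=; rewrite modnMml mul1n residue_mod. Qed.

Fact padic_mulDl : left_distributive padic_mul +%R.
Proof.
by move=> u v w; apply: padicP => k /=; rewrite modnMml modnDm mulnDl.
Qed.

Fact padic_oner_neq0 : padic_nat 1 != 0 :> Zp.
Proof.
apply/eqP => /(congr1 (fun u => residue u 1)) /=.
by rewrite mod0n modn_small // expn1 prime_gt1.
Qed.

HB.instance Definition _ := GRing.Zmodule_isComNzRing.Build Zp
  padic_mulA padic_mulC padic_mul1 padic_mulDl padic_oner_neq0.

Definition mod_p u : 'F_p := (residue u 1)%:R.

End PadicRing.

Record fps (R : Type) := Fps { fps_coef :> nat -> R }.

HB.instance Definition _ R := gen_eqMixin (fps R).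
HB.instance Definition _ R := gen_choiceMixin (fps R).

Section FpsRing.
Variable R : comNzRingType.
Implicit Types f g h : fps R.

Lemma fpsP f g : f =1 g -> f = g.
Proof. by case: f g => [f] [g] /= /funext ->. Qed.

Definition fps_const (c : R) : fps R := Fps (fun n => if n == 0%N then c else 0).
Definition fps_X : fps R := Fps (fun n => (n == 1%N)%:R).
Definition fps_add f g : fps R := Fps (fun n => f n + g n).
Definition fps_opp f : fps R := Fps (fun n => - f n).
Definition fps_mul f g : fps R := Fps (fun n => \sum_(i < n.+1) f i * g (n - i)%N).

Fact fps_addA : associative fps_add.
Proof. by move=> f g h; apply: fpsP => n /=; rewrite addrA. Qed.
Fact fps_addC : commutative fps_add.
Proof. by move=> f g; apply: fpsP => n /=; rewrite addrC. Qed.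
Fact fps_add0 : left_id (fps_const 0) fps_add.
Proof. by move=> f; apply: fpsP => n /=; rewrite if_same add0r. Qed.
Fact fps_addN : left_inverse (fps_const 0) fps_opp fps_add.
Proof. by move=> f; apply: fpsP => n /=; rewrite if_same addNr. Qed.

HB.instance Definition _ :=
  GRing.isZmodule.Build (fps R) fps_addA fps_addC fps_add0 fps_addN.

Definition fps_trunc N f : {poly R} := \poly_(i < N) f i.

Lemma coef_fps_trunc N f n : (n < N)%N -> (fps_trunc N f)`_n = f n.
Proof. by move=> ltnN; rewrite coef_poly ltnN. Qed.

Lemma coef_fps_mul N f g n :
  (n < N)%N -> fps_mul f g n = (fps_trunc N f * fps_trunc N g)`_n.
Proof.
move=> ltnN; rewrite coefM; apply: eq_bigr => i _.
by rewrite !coef_fps_trunc //; have := ltn_ord i; lia.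
Qed.

Fact fps_mulC : commutative fps_mul.
Proof.
by move=> f g; apply: fpsP => n; rewrite !(@coef_fps_mul n.+1) // mulrC.
Qed.

Fact fps_mulA : associative fps_mul.
Proof.
move=> f g h; apply: fpsP => n.
transitivity (fps_trunc n.+1 f * (fps_trunc n.+1 g * fps_trunc n.+1 h))`_n.
  rewrite coefM; apply: eq_bigr => i _.
  by rewrite -coef_fps_mul ?coef_fps_trunc // ltnS leq_subr.
rewrite mulrA coefM; apply: eq_bigr => i _.
by rewrite -coef_fps_mul ?coef_fps_trunc // ltnS leq_subr.
Qed.

Fact fps_mul1 : left_id (fps_const 1) fps_mul.
Proof.
move=> f; apply: fpsP => n /=; rewrite big_ord_recl /= mul1r subn0.
by rewrite big1 ?addr0 // => i _; rewrite mul0r.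
Qed.

Fact fps_mulDl : left_distributive fps_mul +%R.
Proof.
move=> f g h; apply: fpsP => n /=; rewrite -big_split /=.
by apply: eq_bigr => i _; rewrite mulrDl.
Qed.

Fact fps_oner_neq0 : fps_const 1 != 0.
Proof.
by apply/eqP => /(congr1 (fun f : fps R => f 0%N)) /= /eqP; rewrite oner_eq0.
Qed.

HB.instance Definition _ := GRing.Zmodule_isComNzRing.Build (fps R)
  fps_mulA fps_mulC fps_mul1 fps_mulDl fps_oner_neq0.

End FpsRing.

(* As in [polyXY], a polynomial in x and y is an element of {poly {poly R}}
   whose outer variable is x and whose inner variable is y. *)
Definition degX (R : nzRingType) (P : {poly {poly R}}) : nat := (size P).-1.
Definition degY (R : nzRingType) (P : {poly {poly R}}) : nat := (sizeY P).-1.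

Definition derivY (R : nzRingType) (P : {poly {poly R}}) : {poly {poly R}} :=
  map_poly (fun q : {poly R} => q^`()) P.

Definition eval_fps (R : comNzRingType) (P : {poly {poly R}}) (F : fps R) : fps R :=
  (map_poly (map_poly (@fps_const R)) P).[fps_X R, F].

Section Furstenberg.
Variables (p : nat) (p_pr : prime p).

Definition bipoly_mod_p (P : {poly {poly padic p_pr}}) : {poly {poly 'F_p}} :=
  map_poly (map_poly (@mod_p p p_pr)) P.

Definition furstenberg_series (P : {poly {poly padic p_pr}}) (F : fps (padic p_pr)) :=
  [/\ P.[0, 0] = 0,
      mod_p (derivY P).[0, 0] != 0,
      F 0%N = 0
    & eval_fps P F = 0].

End Furstenberg.

Record dfao (p : nat) (A : Type) := Dfao {
  state : finType;
  init : state;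
  step : state -> 'I_p -> state;
  out : state -> A }.

Section Automata.
Variables (p : nat) (A : Type).
Implicit Types (M : dfao p A) (w : seq 'I_p) (b : nat -> A).

Definition output M w : A := out (foldl (@step p A M) (init M) w).

(* Words are read least significant digit first, so leading zeros of an
   integer are at the end of the word. *)
Definition digits_value w : nat := foldr (fun (c : 'I_p) m => c + p * m)%N 0%N w.

Definition base_rep w (n : nat) : Prop :=
  digits_value w = n /\ last 1%N [seq nat_of_ord c | c <- w] != 0%N.

Definition generates M b : Prop :=
  forall w n, base_rep w n -> output M w = b n.

Definition ignores_leading_zeros M : Prop :=
  forall w (z : 'I_p), val z = 0%N -> output M (rcons w z) = output M w.

Definition minimal_automaton M b : Prop :=
  [/\ generates M b, ignores_leading_zeros M
    & forall M', generates M' b -> ignores_leading_zeros M' ->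
        (#|state M| <= #|state M'|)%N].

End Automata.

Section Bound.
Local Open Scope nat_scope.

Definition numer_exponent (alpha h d : nat) : nat :=
  alpha * (alpha + 1) * ((2 * h * d - 1) * alpha + h * d + 1).

Definition bound_exponent (alpha h d : nat) : nat := numer_exponent alpha h d %/ 6.

Let dvd6 a : 6 %| a * (a + 1) * (a + 2).
Proof.
have -> : a * (a + 1) * (a + 2) = (a + 2) ^_ 3.
  by rewrite !ffactnS ffactn0 addn2 addn1 /=; ring.
by rewrite -bin_ffact dvdn_mull.
Qed.

(* The truncated subtraction and the Euclidean quotient in [bound_exponent] are
   exact: a Furstenberg series of a polynomial of degree 0 in x or in y is 0
   or does not exist. *)
Lemma bound_exponentE alpha h d : 0 < h -> 0 < d ->
  6 * bound_exponent alpha h d = numer_exponent alpha h d.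
Proof.
move=> h_gt0 d_gt0; rewrite /bound_exponent mulnC divnK // /numer_exponent.
have [k hdk] : exists k, h * d = k.+1.
  by exists (h * d).-1; rewrite prednK // muln_gt0 h_gt0.
rewrite -(mulnA 2) hdk; have -> : 2 * k.+1 - 1 = 2 * k + 1 by lia.
case: alpha => [|a]; first by rewrite !mul0n.
have -> : a.+1 * (a.+1 + 1) * ((2 * k + 1) * a.+1 + k.+1 + 1) =
   k.+1 * (a.+1 * (a.+1 + 1) * (a.+1 + 2)) + k * (a * (a + 1) * (a + 2)).
  by ring.
by apply: dvdn_add; apply/dvdn_mull/dvd6.
Qed.

End Bound.

Definition automaton_bound (R : realType) (C : R) (p : nat) (p_pr : prime p)
    (alpha h d : nat) : Prop :=
  forall (P : {poly {poly padic p_pr}}) (F : fps (padic p_pr)),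
    furstenberg_series P F -> F != 0 ->
    degX (bipoly_mod_p P) = h -> degY (bipoly_mod_p P) = d ->
    degX P = h -> degY P = d ->
    exists2 M : dfao p nat,
      minimal_automaton M (fun n => residue (F n) alpha) &
      #|state M|%:R <= C * p%:R ^+ bound_exponent alpha h d.

(* Main.v *)
Require Import Defs.
From HB Require Import structures.
From mathcomp Require Import all_boot all_order all_algebra.
From mathcomp Require Import finfield qfpoly polyXY.
From mathcomp Require Import boolp reals.
From mathcomp Require Import zify ring.

(* Put A = Z/p^alpha and K = p^(alpha-1), so that P(x, y)^(pK) = P(x^p, y^p)^K over A.
   By Furstenberg, F is the coefficient of y^-1 in y P_y / P expanded where |y| > |F|,
   and taking the subsequence n -> pn + r of the coefficient of y^-1 in S / P^K amounts
   to replacing S by the Cartier section Lambda_(r, p-1)(S P^((p-1)K)). Writing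
   S / P^K = sum_(j < alpha) p^j S_j / P^(j+1), the sections keep every S_j in a box of
   (j+1)^2 h d - j(j+1)/2 monomials: the Newton box of P^(j+1) with one row and one column
   removed, minus the corner a + b < j, which P(0, 0) = 0 makes avoidable. The coefficients
   of S_j can be taken in {0, ..., p-1} because a multiple of p is carried to level j+1,
   p^(j+1) S / P^(j+1) = p^(j+1) S P / P^(j+2). This gives p^N states.

   The only other states are those reached by reading zeros only; there the column of
   highest x-degree is not removed. Their first and last columns and their last row evolve
   autonomously, as the numerators of univariate rational functions with denominator a
   power of q = P(0, y), the leading coefficient of P in x, or that in y. This evolution
   depends only on q^((p-1)K), which does not change when q is replaced by a monic
   polynomial proportional to q mod p; then q^K divides y^(p^(c+L)) - y^(p^c) in A[y], where
   L is the product of the distinct degrees of the irreducible factors of q mod p. Hence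
   the three borders are eventually periodic, with period the product of the three numbers
   L, each of which satisfies L^12 <= C 2^(deg q). Differences of states with equal borders
   lie in boxes with at least h + d - 1 fewer monomials at every level, so these states
   contribute o(p^N). *)

Set Implicit Arguments.
Unset Strict Implicit.
Unset Printing Implicit Defensive.

Import Order.TTheory GRing.Theory Num.Theory.

Local Open Scope ring_scope.

(** * Congruences modulo an integer and p-th powers *)

Definition eqmodr (R : nzRingType) (m : nat) (a b : R) : Prop :=
  exists c, a = b + c *+ m.

Section Congruences.
Variables (R : comNzRingType) (p : nat).
Hypothesis p_pr : prime p.
Implicit Types a b c u v : R.

Lemma eqmodr_refl m a : eqmodr m a a.
Proof. by exists 0; rewrite mul0rn addr0. Qed.

Lemma eqmodr_trans m a b c : eqmodr m a b -> eqmodr m b c -> eqmodr m a c.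
Proof. by case=> u -> [v ->]; exists (v + u); rewrite mulrnDl addrA. Qed.

Lemma eqmodrD m a b u v : eqmodr m a b -> eqmodr m u v -> eqmodr m (a + u) (b + v).
Proof. by case=> x -> [y ->]; exists (x + y); rewrite mulrnDl addrACA. Qed.

Lemma eqmodrM m a b u v : eqmodr m a b -> eqmodr m u v -> eqmodr m (a * u) (b * v).
Proof.
case=> x -> [y ->]; exists (b * y + x * v + x * (y *+ m)).
by rewrite mulrDl !mulrDr !mulrnDl !(mulrnAr, mulrnAl) !addrA.
Qed.

Lemma exprD_prime_mod u v : eqmodr p ((u + v) ^+ p) (u ^+ p + v ^+ p).
Proof.
have p_gt0 := prime_gt0 p_pr.
rewrite exprDn -(prednK p_gt0) big_ord_recl big_ord_recr /=.
rewrite !subn0 !subnn !expr0 !mulr1 mul1r bin0 mulr1n.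
rewrite /bump leq0n add1n prednK // binn mulr1n addrA addrAC.
exists (\sum_(i < p.-1) (u ^+ (p - i.+1) * v ^+ i.+1) *+ ('C(p, i.+1) %/ p)).
congr (_ + _); rewrite -sumrMnl; apply: eq_bigr => i _.
rewrite /= add1n -mulrnA divnK //.
apply: prime_dvd_bin => //=; have := ltn_ord i; lia.
Qed.

(** In the binomial expansion the linear term gains a factor p from its coefficient, and a term of
    degree j >= 2 already carries p^((i+1)j) with (i+1)j >= i+2. *)
Lemma exprD_prime_lift u v i : exists w, (u + v *+ p ^ i.+1) ^+ p = u ^+ p + w *+ p ^ i.+2.
Proof.
have p_gt1 := prime_gt1 p_pr.
rewrite exprDn (bigD1 ord0) //= subn0 expr0 mulr1 bin0 mulr1n.
suff [w ->] : exists w, \sum_(j < p.+1 | j != ord0)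
   (u ^+ (p - j) * (v *+ p ^ i.+1) ^+ j) *+ 'C(p, j) = w *+ p ^ i.+2 by exists w.
elim/big_ind: _ => [|x y [w1 ->] [w2 ->]|[j j_lt] /= j_neq0].
- by exists 0; rewrite mul0rn.
- by exists (w1 + w2); rewrite mulrnDl.
have {j_neq0} j_gt0 : (0 < j)%N by rewrite lt0n; apply: contra j_neq0 => /eqP j0; apply/eqP/val_inj.
rewrite exprMn_n mulrnAr -mulrnA -expnM.
suff /dvdnP[q ->] : (p ^ i.+2 %| p ^ (i.+1 * j) * 'C(p, j))%N.
  by exists (u ^+ (p - j) * v ^+ j *+ q); rewrite mulrnA.
have [j1|j_neq1] := eqVneq j 1%N.
  by rewrite j1 muln1 bin1 -expnSr.
by apply/dvdn_mulr/dvdn_exp2l; nia.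
Qed.

(** For i = alpha - 1, in a ring where p^alpha = 0, the K-th power of an element depends only on its
    class modulo p. The exact Frobenius identities below come from this. *)
Lemma eqmodr_expp a b i : eqmodr p a b -> eqmodr (p ^ i.+1) (a ^+ (p ^ i)) (b ^+ (p ^ i)).
Proof.
move=> ab; elim: i => [|i [c IH]]; first by rewrite !expn0 expn1.
by rewrite [(p ^ i.+1)%N]expnSr !exprM IH; have [w ->] := exprD_prime_lift (b ^+ (p ^ i)) c i; exists w.
Qed.

Lemma natr_expp_mod k : eqmodr p (k%:R ^+ p : R) k%:R.
Proof.
have kp : (k <= k ^ p)%N.
  by case: k => // k; rewrite -{1}[k.+1]expn1; apply: leq_pexp2l => //; exact: prime_gt0.
have := fermat_little k p_pr => /eqP; rewrite eqn_mod_dvd //.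
move=> /dvdnP[q eq_q]; exists q%:R.
by rewrite -mulrnA -eq_q -natrX -natrD subnKC.
Qed.

End Congruences.

(** * Extremal coefficients, sections and Frobenius lifts of univariate polynomials *)

Section TopCoefficient.
Variable R : comNzRingType.
Implicit Types f g : {poly R}.

(** Here m and n only bound the degrees, so the rule holds over rings with zero divisors and for
    vanishing top coefficients. The right and top borders of numerators are computed with it. *)
Lemma coefM_top m n f g : (size f <= m.+1)%N -> (size g <= n.+1)%N ->
  (f * g)`_(m + n) = f`_m * g`_n.
Proof.
move=> sf sg; rewrite coefM.
have m_lt : (m < (m + n).+1)%N by rewrite ltnS leq_addr.
rewrite (bigD1 (Ordinal m_lt)) //= addKn big1 ?addr0 // => i.
rewrite -val_eqE /= => i_neq; have [i_lt|i_ge] := ltnP i m.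
  by rewrite [g`__]nth_default ?mulr0 //; apply: leq_trans sg _; move: i_lt; clear; lia.
by rewrite [f`__]nth_default ?mul0r //; apply: leq_trans sf _; lia.
Qed.

Lemma size_exp_le n f k : (size f <= n.+1)%N -> (size (f ^+ k) <= (k * n).+1)%N.
Proof. by move=> sf; apply: leq_trans (size_poly_exp_leq _ _) _; rewrite ltnS mulnC leq_mul2l; lia. Qed.

Lemma coefX_top n f k : (size f <= n.+1)%N -> (f ^+ k)`_(k * n) = f`_n ^+ k.
Proof.
move=> sf; elim: k => [|k IH]; first by rewrite mul0n !expr0 coef1.
by rewrite exprS mulSn coefM_top ?IH -?exprS //; exact: size_exp_le.
Qed.

Lemma coef0X f k : (f ^+ k)`_0 = f`_0 ^+ k.
Proof. by elim: k => [|k IH]; rewrite ?expr0 ?coef1 // !exprS coef0M IH. Qed.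

End TopCoefficient.

Section Cartier.
Variable R : comNzRingType.
Implicit Types f g : {poly R}.

(** For r < m, the section operator that keeps the exponents congruent to r modulo m; as soon as m >
    0, the bound [size f] loses no coefficient. *)
Definition cartier (m r : nat) f : {poly R} := \poly_(i < size f) f`_(m * i + r).

Lemma coef_cartier m r f i : (0 < m)%N -> (cartier m r f)`_i = f`_(m * i + r).
Proof.
move=> m_gt0; rewrite coef_poly; case: ltnP => // sf.
by rewrite nth_default // (leq_trans sf) //; nia.
Qed.

Lemma cartierD m r f g : (0 < m)%N ->
  cartier m r (f + g) = cartier m r f + cartier m r g.
Proof. by move=> m0; apply/polyP => i; rewrite !(coefD, coef_cartier). Qed.

Lemma cartier0 m r : cartier m r 0 = 0.
Proof. by apply/polyP => i; rewrite coef_poly size_poly0 ltn0 coef0. Qed.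

Lemma cartierM m r f g : (r < m)%N ->
  cartier m r (f * (g \Po 'X^m)) = cartier m r f * g.
Proof.
move=> rm; have m0 : (0 < m)%N by apply: leq_trans rm.
elim/poly_ind: g => [|g c IH]; first by rewrite comp_poly0 !mulr0 cartier0.
rewrite comp_polyD comp_polyM comp_polyC comp_polyX !mulrDr cartierD // !mulrA -IH.
congr (_ + _); apply/polyP => i; last first.
  by rewrite !(coefMC, coef_cartier).
rewrite coefMX !coef_cartier // coefMXn.
case: i => [|i] /=; first by rewrite muln0 add0n rm.
by rewrite ifF; [congr (_`__); nia | nia].
Qed.

Lemma cartier_cartier m n r f : (0 < m)%N -> (0 < n)%N ->
  cartier m 0 (cartier n r f) = cartier (n * m) r f.
Proof.
move=> m0 n0; apply/polyP => i; rewrite !coef_cartier ?muln_gt0 ?n0 //.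
by rewrite addn0 mulnA.
Qed.

(** Multiplication by X turns the section at residue m - 1 into the one at residue 0, so that
    periodicity at residue 0 covers both residues met on the borders. *)
Lemma cartier0_mulX m f : (0 < m)%N ->
  cartier m 0 ('X * f) = 'X * cartier m m.-1 f.
Proof.
move=> m0; apply/polyP => i; rewrite coef_cartier // !coefXM addn0.
case: i => [|i] /=; first by rewrite muln0.
by rewrite coef_cartier // ifF; [congr (_`__); nia | nia].
Qed.

End Cartier.

Section FrobeniusLift.
Variables (R : comNzRingType) (p : nat) (theta : {rmorphism R -> R}).
Hypothesis p_pr : prime p.
Hypothesis theta_frob : forall a : R, eqmodr p (a ^+ p) (theta a).

(** If [theta] lifts the p-th power map on R, this lifts it on R[X]. It is applied with [theta] the
    identity of Z/p^alpha, then with [theta] the substitution y -> y^p, which gives P(x^p, y^p). *)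
Definition frobenius_poly (f : {poly R}) : {poly R} := map_poly theta f \Po 'X^p.

HB.instance Definition _ :=
  GRing.RMorphism.copy frobenius_poly (comp_poly 'X^p \o map_poly theta).

Lemma frobenius_poly_frob (f : {poly R}) : eqmodr p (f ^+ p) (frobenius_poly f).
Proof.
elim/poly_ind: f => [|f c IH].
  rewrite rmorph0 expr0n; have := prime_gt0 p_pr; case: p => // k _ /=; exact: eqmodr_refl.
apply: eqmodr_trans (exprD_prime_mod p_pr _ _) _.
rewrite rmorphD; apply: eqmodrD.
  rewrite exprMn rmorphM; apply: eqmodrM => //.
  by rewrite /= /frobenius_poly map_polyX comp_polyX; exact: eqmodr_refl.
rewrite /= /frobenius_poly map_polyC comp_polyC -polyC_exp.
by have [e ->] := theta_frob c; exists e%:P; rewrite polyCD polyCMn.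
Qed.

End FrobeniusLift.

(** * Polynomials over a finite field F and divisors of X^(|F|^N) - X *)

Section FiniteFieldPolynomials.
Import Pdiv.Field Pdiv.RingMonic Pdiv.CommonRing.
Variable F : finFieldType.

(** F[X]/(f) is a field with |F|^(deg f) elements, so the class of X equals its own power of that
    exponent. *)
Lemma monic_irreducible_dvdp_Xexp_card (f : {poly F}) :
  irreducible_poly f -> f \is monic -> f %| 'X^(#|F| ^ (size f).-1) - 'X.
Proof.
move=> f_irr f_mon; pose mi : monic_irreducible_poly f := (f_irr, f_mon).
have := expf_card (in_qpoly f 'X : {poly %/ f with mi}).
rewrite card_qfpoly => /eqP; rewrite -subr_eq0 => /eqP /(congr1 val).
have -> : (in_qpoly f 'X : {poly %/ f with mi}) ^+ (#|F| ^ (size f).-1) -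
   (in_qpoly f 'X : {poly %/ f with mi}) = in_qpoly f ('X^(#|F| ^ (size f).-1) - 'X).
  by rewrite rmorphB rmorphXn.
rewrite /= (mk_monicE mi) => h.
by rewrite dvdpE /rdvdp h.
Qed.

Lemma dvdp_Xexp_card_mul (f : {poly F}) v N :
  f %| 'X^(#|F| ^ v) - 'X -> (v %| N)%N -> f %| 'X^(#|F| ^ N) - 'X.
Proof.
move=> f_dvd /dvdnP[k ->]; elim: k => [|k IH]; first by rewrite mul0n expn0 expr1 subrr dvdp0.
have -> : 'X^(#|F| ^ (k.+1 * v)) - 'X =
    ('X^(#|F| ^ (k * v)) ^+ (#|F| ^ v) - 'X ^+ (#|F| ^ v)) + ('X^(#|F| ^ v) - 'X) :> {poly F}.
  by rewrite -exprM -expnD addrA subrK mulSn addnC.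
by rewrite dvdp_add // subrXX dvdp_mulr.
Qed.

(** The list holds the degrees of the irreducible factors of q, with multiplicity. Such a factor
    divides X^(|F|^N) - X once its degree divides N, and the exponent deg q makes room for the
    multiplicities. *)
Lemma irreducible_degrees (q : {poly F}) : q != 0 ->
  exists l : seq nat, [/\ all (leq 1) l, (\sum_(v <- l) v <= (size q).-1)%N &
    forall N, {in l, forall v, v %| N}%N ->
      q %| ('X^(#|F| ^ N) - 'X) ^+ (size q).-1].
Proof.
have [n] := ubnP (size q); elim: n q => // n IH q; rewrite ltnS => sq q_neq0.
have [q_le1|q_gt1] := leqP (size q) 1%N.
  exists [::]; split; rewrite ?big_nil // => N _.
  have /eqP : size q = 1%N by apply/eqP; rewrite eqn_leq q_le1 lt0n size_poly_eq0.
  by rewrite size_poly_eq1 => /eqp_dvdl->; rewrite dvd1p.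
case: (pselect (irreducible_poly q)) => [q_irr|].
  exists [:: (size q).-1]; split; rewrite ?big_seq1 //= ?andbT; first by rewrite -subn1 subn_gt0.
  move=> N /(_ _ (mem_head _ _)) dvdN; apply: dvdp_exp; first by rewrite -subn1 subn_gt0.
  apply: dvdp_Xexp_card_mul dvdN.
  have lc_neq0 : (lead_coef q)^-1 != 0 by rewrite invr_eq0 lead_coef_eq0.
  have eq_q := eqp_scale q lc_neq0.
  have s_eq := size_scale q lc_neq0.
  rewrite -(eqp_dvdl _ eq_q) -s_eq; apply: monic_irreducible_dvdp_Xexp_card.
    split; first by rewrite s_eq.
    move=> r sr; rewrite (eqp_dvdr _ eq_q) => /(q_irr.2 _ sr) /eqp_trans; apply.
    by rewrite eqp_sym.
  by rewrite monicE lead_coefZ mulVf // lead_coef_eq0.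
move=> not_irr; have [r [sr r_dvd r_neq]] : exists r : {poly F}, [/\ size r != 1%N, r %| q & ~~ (r %= q)].
  apply: contrapT => no_r; apply: not_irr; split=> // r sr r_dvd.
  by apply/negPn/negP => r_neq; apply: no_r; exists r.
have [s eq_q] := dvdpP _ _ r_dvd.
have s_neq0 : s != 0 by apply: contraNneq q_neq0 => s0; rewrite eq_q s0 mul0r.
have r_neq0 : r != 0 by apply: contraNneq q_neq0 => r0; rewrite eq_q r0 mulr0.
have size_q : size q = (size s + size r).-1 by rewrite eq_q size_mul.
have r_gt1 : (1 < size r)%N.
  by rewrite ltn_neqAle eq_sym sr lt0n size_poly_eq0.
have s_gt1 : (1 < size s)%N.
  rewrite ltn_neqAle lt0n size_poly_eq0 s_neq0 andbT eq_sym.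
  apply: contra r_neq => s1; rewrite eq_q -[X in X %= _]mul1r eqp_mul2r //.
  by rewrite eqp_sym -size_poly_eq1.
have size_q1 : ((size q).-1 = (size s).-1 + (size r).-1)%N by lia.
have r_lt : (size r < n)%N by lia.
have s_lt : (size s < n)%N by lia.
have [lr [lr_pos lr_sum lr_dvd]] := IH r r_lt r_neq0.
have [ls [ls_pos ls_sum ls_dvd]] := IH s s_lt s_neq0.
exists (ls ++ lr); split; first by rewrite all_cat ls_pos.
  by rewrite big_cat size_q1 leq_add.
move=> N dvdN.
rewrite size_q1 exprD eq_q dvdp_mul //; first by apply: ls_dvd => v v_in; apply: dvdN; rewrite mem_cat v_in.
by apply: lr_dvd => v v_in; apply: dvdN; rewrite mem_cat v_in orbT.
Qed.

Lemma frobenius_period (q : {poly F}) : q != 0 ->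
  exists l : seq nat, [/\ uniq l, all (leq 1) l, (\sum_(v <- l) v <= (size q).-1)%N &
      q %| ('X^(#|F| ^ \prod_(v <- l) v) - 'X) ^+ (size q).-1].
Proof.
move=> /irreducible_degrees[l [l_pos l_sum l_dvd]]; exists (undup l); split.
- exact: undup_uniq.
- by apply/allP => v; rewrite mem_undup => /(allP l_pos).
- apply: leq_trans l_sum; elim: l {l_pos l_dvd} => //= v l IH.
  case: ifP => _; rewrite ?big_cons; last by rewrite leq_add2l.
  by apply: leq_trans IH _; rewrite leq_addl.
- apply: l_dvd => v v_in; rewrite (big_rem v) ?mem_undup //=; exact: dvdn_mulr.
Qed.

End FiniteFieldPolynomials.

(** * Growth of a product of distinct integers with bounded sum *)

Section DistinctParts.
Local Open Scope nat_scope.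

(** With 2^k <= v <= 2^(k+1) it suffices that 12(k+1) <= 2^k, which holds from k = 7 on; hence the
    threshold 128. *)
Lemma expn12_le v : 128 <= v -> v ^ 12 <= 2 ^ v.
Proof.
move=> v_ge; have v_gt0 : 0 < v by apply: leq_trans v_ge.
have k_ge : 7 <= trunc_log 2 v by exact: trunc_log_max.
have lo : 2 ^ trunc_log 2 v <= v by exact: trunc_logP.
have hi : v <= 2 ^ (trunc_log 2 v).+1 by rewrite ltnW // trunc_log_ltn.
move: (trunc_log 2 v) => k in k_ge lo hi *.
have le_k : k.+1 * 12 <= 2 ^ k.
  elim: k k_ge {lo hi} => // k IH; rewrite leq_eqVlt => /orP[/eqP <- //|k_ge].
  by have := IH k_ge; rewrite [2 ^ k.+1]expnS; lia.
apply: (@leq_trans ((2 ^ k.+1) ^ 12)); first by rewrite leq_exp2r.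
by rewrite -expnM leq_exp2l // (leq_trans le_k).
Qed.

(* Parts below 128 contribute a bounded factor because they are distinct; a part
   [v >= 128] satisfies [v ^ 12 <= 2 ^ v]. *)
Lemma prod_distinct_le : exists C, forall l : seq nat, uniq l ->
  (\prod_(v <- l) v) ^ 12 <= C * 2 ^ (\sum_(v <- l) v).
Proof.
have [M [M_gt0 M_ge]] : exists M, 0 < M /\ forall v, v < 128 -> v ^ 12 <= M.
  by exists (128 ^ 12); split=> [|v /ltnW]; rewrite ?expn_gt0 ?leq_exp2r.
have bound l : (\prod_(v <- l) v) ^ 12 <=
    M ^ count (ltn^~ 128) l * 2 ^ (\sum_(v <- l) v).
  elim: l => [|v l IH]; first by rewrite !big_nil.
  rewrite !big_cons expnMn expnD /=.
  have [v_lt|v_ge] := ltnP v 128.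
    rewrite expnD expn1 mulnACA; apply: leq_mul IH.
    by rewrite (leq_trans (M_ge _ v_lt)) // leq_pmulr // expn_gt0.
  by rewrite add0n mulnCA; apply: leq_mul IH; exact: expn12_le.
exists (M ^ 128) => l l_uniq; apply: leq_trans (bound l) _.
rewrite leq_mul2r leq_pexp2l ?orbT //.
rewrite -size_filter -[X in _ <= X](size_iota 0); apply: uniq_leq_size.
  exact: filter_uniq.
by move=> v; rewrite mem_filter mem_iota => /andP[].
Qed.

End DistinctParts.

(* An abstract Z/p^al: [red] is its reduction modulo p. *)
Record residue_ring (p al : nat) := ResidueRing {
  residue_carrier :> comNzRingType;
  red : {rmorphism residue_carrier -> 'F_p};
  residue_prime : prime p;
  residue_al_gt0 : (0 < al)%N;
  residue_natP : forall a : residue_carrier, exists k : nat, a = k%:R;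
  residue_nat_eq0 : forall k : nat, (k%:R == 0 :> residue_carrier) = (p ^ al %| k)%N }.

(** * The ring Z/p^alpha and its reduction modulo p *)

Section ResidueRing.
Variables (p al : nat) (A : residue_ring p al).
Implicit Types (a b : A) (f g : {poly A}).

Let p_pr : prime p := residue_prime A.

Lemma natr_Fp_eq0 k : (k%:R == 0 :> 'F_p) = (p %| k)%N.
Proof. by rewrite (dvdn_pcharf (pchar_Fp p_pr)). Qed.

Lemma red_eq0P a : red A a = 0 <-> exists b, a = b *+ p.
Proof.
split=> [|[b ->]]; last by rewrite rmorphMn /= -mulr_natr pchar_Fp_0 // mulr0.
have [k ->] := residue_natP a; rewrite rmorph_nat => /eqP.
by rewrite natr_Fp_eq0 => /dvdnP[q ->]; exists q%:R; rewrite natrM mulr_natr.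
Qed.

Lemma mulrn_expp a : a *+ p ^ al = 0.
Proof.
have /eqP e : (p ^ al)%:R == 0 :> A by rewrite residue_nat_eq0.
by rewrite -mulr_natr e mulr0.
Qed.

Lemma red_eq0_of_mulrn a j : (j < al)%N -> a *+ p ^ j = 0 -> red A a = 0.
Proof.
have [k ->] := residue_natP a => j_lt /eqP.
rewrite -mulrnA residue_nat_eq0 rmorph_nat => dvd_k; apply/eqP.
rewrite natr_Fp_eq0 -(@dvdn_pmul2r (p ^ j)) ?expn_gt0 ?prime_gt0 // -expnS.
by apply: dvdn_trans dvd_k; exact: dvdn_exp2l.
Qed.

(** Division by p is chosen as a function with value 0 at 0, so that [map_poly] can apply it to all
    coefficients. *)
Lemma divp_exists : exists dv : A -> A, dv 0 = 0 /\ forall a, red A a = 0 -> a = dv a *+ p.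
Proof.
have /choice[dv dvP] : forall a, exists b, red A a = 0 -> a = b *+ p.
  move=> a; have [/red_eq0P[b ->]|na] := pselect (red A a = 0); first by exists b.
  by exists 0.
exists (fun a => if a == 0 then 0 else dv a); rewrite eqxx; split=> // a.
by case: eqP => [-> | _]; [rewrite mul0rn | exact: dvP].
Qed.

Lemma poly_mulrn_expp f : f *+ p ^ al = 0.
Proof. by apply/polyP => i; rewrite coefMn mulrn_expp coef0. Qed.

Lemma poly_red_eq0P f : map_poly (red A) f = 0 <-> exists g, f = g *+ p.
Proof.
split=> [f0|[g ->]]; last first.
  apply/polyP => i; rewrite coef0 coef_map coefMn; apply/red_eq0P; by exists g`_i.
have [dv [dv0 dvP]] := divp_exists.
exists (map_poly dv f); apply/polyP => i; rewrite coefMn coef_map_id0 //.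
by apply: dvP; rewrite -coef_map f0 coef0.
Qed.

Lemma poly_eqmodrP f g : eqmodr p f g <-> map_poly (red A) f = map_poly (red A) g.
Proof.
split=> [[c ->]|fg].
  rewrite rmorphD [X in _ + X](_ : _ = 0) ?addr0 //; apply/poly_red_eq0P; by exists c.
have /poly_red_eq0P[c fgc] : map_poly (red A) (f - g) = 0 by rewrite rmorphB /= fg subrr.
by exists c; rewrite -fgc addrC subrK.
Qed.

Lemma poly_red_eq0_of_mulrn f j : (j < al)%N -> f *+ p ^ j = 0 -> map_poly (red A) f = 0.
Proof.
move=> j_lt f0; apply/polyP => i; rewrite coef_map coef0.
by apply: red_eq0_of_mulrn j_lt _; rewrite -coefMn f0 coef0.
Qed.

Lemma poly_expp_eq f g : eqmodr p f g -> f ^+ (p ^ al.-1) = g ^+ (p ^ al.-1).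
Proof.
move=> /(eqmodr_expp p_pr al.-1); rewrite (prednK (residue_al_gt0 A)) => -[c ->].
by rewrite poly_mulrn_expp addr0.
Qed.

Lemma residue_frob a : eqmodr p (a ^+ p) a.
Proof. by have [k ->] := residue_natP a; exact: natr_expp_mod. Qed.

Definition lift_Fp (c : 'F_p) : A := (nat_of_ord c)%:R.

Lemma lift_FpK : cancel lift_Fp (red A).
Proof. by move=> c; rewrite /lift_Fp rmorph_nat natr_Zp. Qed.

Lemma lift_polyK (f : {poly 'F_p}) : map_poly (red A) (map_poly lift_Fp f) = f.
Proof.
by apply/polyP => i; rewrite coef_map coef_map_id0 //= lift_FpK.
Qed.

End ResidueRing.

(** i C(p^c, i) is a multiple of p^c, while i has p-adic valuation at most c - al. *)
Lemma dvdn_bin_expp p c al i : prime p -> (al <= c)%N -> (0 < i < p ^ (c - al).+1)%N ->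
  (p ^ al %| 'C(p ^ c, i))%N.
Proof.
move=> p_pr al_le /andP[i_gt0 i_lt]; have p_gt1 := prime_gt1 p_pr.
have [i_gt|i_le] := ltnP (p ^ c) i; first by rewrite bin_small.
have C_gt0 : (0 < 'C(p ^ c, i))%N by rewrite bin_gt0.
have log_i : (logn p i <= c - al)%N.
  rewrite -ltnS -(@ltn_exp2l p) //; apply: leq_ltn_trans i_lt.
  by apply: dvdn_leq; rewrite // pfactor_dvdn.
have : (p ^ c %| i * 'C(p ^ c, i))%N.
  by rewrite -[in X in (_ %| X)%N](prednK i_gt0) -mul_bin_diag dvdn_mulr.
rewrite !pfactor_dvdn ?muln_gt0 ?i_gt0 // lognM //; lia.
Qed.

(** * Eventual periodicity of sections of univariate rational functions *)

Section Progression.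
Local Open Scope nat_scope.
Variables (w B T u k : nat).
Hypotheses (B_gt0 : 0 < B) (T_gt0 : 0 < T) (w_gt : B + T < w * B) (u_lt : u < w * B).

Let progE m l : l < m ->
  (m * k == u + (B * (m.-1 - l) + (B + T) * l)) = (m * k + B == u + (B * m + T * l)).
Proof.
move=> lm; have e : B * (m.-1 - l) + B * l + B = B * m.
  have lm1 : l <= m.-1 by lia.
  by rewrite -mulnDr subnK // addnC -mulnS prednK //; lia.
by rewrite mulnDl; apply/eqP/eqP => h; lia.
Qed.

(** With k = B + x the left equation reads w B x + B = u + T l and the right one w (B + T) x + B = u
    + T l', so that l' = l + w x; the hypotheses force 0 <= x <= T and keep both indices in range.
    In use w B = p^e and w (B + T) = p^(e+L), which yields the period L. *)
Lemma progression_iff :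
  [exists l : 'I_(w * B), w * B * k == u + (B * ((w * B).-1 - l) + (B + T) * l)] =
  [exists l : 'I_(w * (B + T)),
     w * (B + T) * k == u + (B * ((w * (B + T)).-1 - l) + (B + T) * l)].
Proof.
have w_gt0 : 0 < w by case: w w_gt.
apply/existsP/existsP => -[[l l_lt] /=]; rewrite progE // => /eqP eq_l.
  have k_ge : B <= k.
    rewrite leqNgt; apply/negP => k_lt.
    have : w * B * k.+1 <= w * B * B by rewrite leq_mul2l k_lt orbT.
    by rewrite mulnS [B * (w * B)]mulnC in eq_l *; lia.
  have [x k_eq] : exists x, k = B + x by exists (k - B); lia.
  rewrite k_eq mulnDr [B * (w * B)]mulnC in eq_l.
  have x_le : x <= T.
    rewrite leqNgt; apply/negP => x_gt.
    have : w * B * T.+1 <= w * B * x by rewrite leq_mul2l x_gt orbT.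
    have : T * l <= T * (w * B) by rewrite leq_mul2l ltnW ?orbT.
    by rewrite mulnS [T * (w * B)]mulnC; lia.
  have l'_lt : l + w * x < w * (B + T).
    have : w * x <= w * T by rewrite leq_mul2l x_le orbT.
    by rewrite mulnDr; lia.
  exists (Ordinal l'_lt); rewrite /= progE // k_eq; apply/eqP.
  rewrite !mulnDr !mulnDl [T * (w * x)]mulnCA; lia.
have B_le : w * B <= w * (B + T) by rewrite leq_mul2l leq_addr orbT.
have k_ge : B <= k.
  rewrite leqNgt; apply/negP => k_lt.
  have : w * (B + T) * k.+1 <= w * (B + T) * B by rewrite leq_mul2l k_lt orbT.
  by rewrite mulnS [B * (w * (B + T))]mulnC in eq_l *; lia.
have [x k_eq] : exists x, k = B + x by exists (k - B); lia.
have eq_x : w * B * x + w * T * x + B = u + T * l.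
  by move: eq_l; rewrite k_eq [_ * (B + x)]mulnDr [B * (w * (B + T))]mulnC -mulnDl -mulnDr; lia.
have x_le : x <= T.
  rewrite leqNgt; apply/negP => x_gt.
  have : w * (B + T) * T.+1 <= w * (B + T) * x by rewrite leq_mul2l x_gt orbT.
  have : T * l <= T * (w * (B + T)) by rewrite leq_mul2l ltnW ?orbT.
  by rewrite mulnS [T * (w * (B + T))]mulnC mulnDr !mulnDl in eq_x *; lia.
have l_ge : w * x <= l.
  have [x0|x_gt0] := posnP x; first by rewrite x0 muln0.
  rewrite -(leq_pmul2l T_gt0) mulnCA mulnA.
  have : w * B * 1 <= w * B * x by rewrite leq_mul2l x_gt0 orbT.
  by lia.
have eq_T : T * (l - w * x) + u = w * B * x + B.
  have : T * (w * x) <= T * l by rewrite leq_mul2l l_ge orbT.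
  by rewrite mulnBr [T * (w * x)]mulnCA mulnA; lia.
have l'_lt : l - w * x < w * B.
  rewrite -(ltn_pmul2l T_gt0).
  have := x_le; rewrite leq_eqVlt => /orP[/eqP x_eq|x_lt].
    have : T * l.+1 <= T * (w * (B + T)) by rewrite leq_mul2l l_lt orbT.
    rewrite x_eq in eq_x eq_T *; rewrite mulnS [T * (w * (B + T))]mulnC mulnDr mulnDl [T * (w * B)]mulnC.
    by lia.
  have : w * B * x.+1 <= w * B * T by rewrite leq_mul2l x_lt orbT.
  by rewrite [T * (w * B)]mulnC mulnS; lia.
exists (Ordinal l'_lt); rewrite /= progE // k_eq; apply/eqP.
by rewrite mulnDr [B * (w * B)]mulnC; lia.
Qed.

End Progression.

Lemma comp_poly_exp (R : comNzRingType) (f g : {poly R}) n : (f ^+ n) \Po g = (f \Po g) ^+ n.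
Proof. exact: rmorphXn. Qed.

Section UnivariatePeriod.
Variables (p al : nat) (A : residue_ring p al).
Local Notation K := (p ^ al.-1)%N.
Implicit Types (q s f g : {poly A}).

Let p_pr : prime p := residue_prime A.
Let p_gt0 : (0 < p)%N := prime_gt0 p_pr.
Let p_gt1 : (1 < p)%N := prime_gt1 p_pr.

(** Since q^(pK) = q^K(X^p), taking a section of s / q^K amounts to this operation on the numerator
    s. *)
Definition border_step (r : nat) q s := cartier p r (s * q ^+ (p.-1 * K)).

Lemma poly_expp_frob q : q ^+ (p * K) = q ^+ K \Po 'X^p.
Proof.
rewrite exprM comp_poly_exp; apply: poly_expp_eq.
have := @frobenius_poly_frob A p idfun p_pr (@residue_frob p al A) q.
by rewrite /frobenius_poly map_poly_id.
Qed.

Lemma poly_expp_frob_iter q e : q ^+ (p ^ e * K) = q ^+ K \Po 'X^(p ^ e).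
Proof.
elim: e => [|e IH]; first by rewrite expn0 mul1n expr1 comp_polyXr.
rewrite expnS mulnAC.
rewrite exprM poly_expp_frob -comp_poly_exp -exprM mulnC IH.
by rewrite -comp_polyA ['X^_ \Po _]comp_poly_exp comp_polyX -exprM.
Qed.

Lemma iter_border_step e q s :
  iter e (border_step 0 q) s = cartier (p ^ e) 0 (s * q ^+ ((p ^ e).-1 * K)).
Proof.
have pe_gt0 i : (0 < p ^ i)%N by rewrite expn_gt0 p_gt0.
elim: e => [|e IH].
  rewrite expn0 mul0n expr0 mulr1 /=; apply/polyP => i.
  by rewrite coef_cartier // mul1n addn0.
rewrite iterS IH /border_step -cartierM // cartier_cartier // -expnSr -mulrA.
congr (cartier _ _ (_ * _)).
have -> : q ^+ (p.-1 * K) \Po 'X^(p ^ e) = q ^+ (p ^ e * K * p.-1).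
  by rewrite mulnC exprM comp_poly_exp -poly_expp_frob_iter -exprM.
rewrite -exprD mulnAC -mulnDl; congr (_ ^+ (_ * _)%N).
by rewrite expnS; have := pe_gt0 e; nia.
Qed.

Lemma iter_border_step_pred e q s :
  'X * iter e (border_step p.-1 q) s = iter e (border_step 0 q) ('X * s).
Proof.
by elim: e => //= e <-; rewrite /border_step -mulrA cartier0_mulX.
Qed.

(** Only q^(p-1) modulo p matters, because K-th powers do not see multiples of p. A nonzero scalar
    of F_p has (p-1)-st power 1, so q can be replaced by a lift of its monic associate. *)
Lemma exists_monic_lift q : map_poly (red A) q != 0 ->
  exists q1, [/\ q1 \is monic, size q1 = size (map_poly (red A) q),
    map_poly (red A) q1 != 0 & q ^+ (p.-1 * K) = q1 ^+ (p.-1 * K)].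
Proof.
set qb := map_poly _ q => qb_neq0; have lc_neq0 : lead_coef qb != 0 by rewrite lead_coef_eq0.
pose q1b := (lead_coef qb)^-1 *: qb.
have q1b_monic : q1b \is monic by rewrite monicE lead_coefZ mulVf.
have lift1 : lift_Fp A 1 = 1 by [].
have lift_lc : lift_Fp A (lead_coef q1b) = 1 by rewrite (monicP q1b_monic).
exists (map_poly (lift_Fp A) q1b); split.
- by rewrite monicE lead_coef_map_id0 ?lift_lc ?oner_neq0.
- by rewrite size_map_poly_id0 ?lift_lc ?oner_neq0 // size_scale // invr_eq0.
- by rewrite lift_polyK monic_neq0.
- rewrite !exprM; apply/poly_expp_eq/poly_eqmodrP; rewrite !rmorphXn /= lift_polyK -/qb.
  have -> : qb = lead_coef qb *: q1b by rewrite /q1b scalerA mulfV // scale1r.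
  rewrite exprZn [lead_coef _ ^+ _](_ : _ = 1) ?scale1r //.
  apply: (mulfI lc_neq0); rewrite -exprS prednK // mulr1.
  by have := expf_card (lead_coef qb); rewrite card_Fp.
Qed.

(** In the binomial expansion the terms with 0 < i < N have coefficients divisible by p^alpha, and
    those with i >= N are multiples of d^N. *)
Lemma dvd_expp_sub (v d : {poly A}) N c : (al <= c)%N -> (N <= p ^ (c - al).+1)%N ->
  exists g, (v + d) ^+ (p ^ c) - v ^+ (p ^ c) = d ^+ N * g.
Proof.
move=> al_le N_le; rewrite exprDn (bigD1 ord0) //= subn0 expr0 mulr1 bin0 mulr1n.
rewrite addrAC subrr add0r.
elim/big_ind: _ => [|x y [gx ->] [gy ->]|[i i_lt] /= i_neq0].
- by exists 0; rewrite mulr0.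
- by exists (gx + gy); rewrite mulrDr.
have {i_neq0} i_gt0 : (0 < i)%N.
  by rewrite lt0n; apply: contra i_neq0 => /eqP i0; apply/eqP/val_inj.
have [i_ltN|N_le_i] := ltnP i N; last first.
  exists (v ^+ (p ^ c - i) * d ^+ (i - N) *+ 'C(p ^ c, i)).
  by rewrite mulrnAr mulrCA -exprD subnKC.
exists 0; rewrite mulr0.
have /dvdnP[k ->] : (p ^ al %| 'C(p ^ c, i))%N.
  by apply: dvdn_bin_expp => //; rewrite i_gt0 (leq_trans i_ltN).
by rewrite mulrnA poly_mulrn_expp.
Qed.

(** Put d = X^(p^L) - X. Modulo p, q divides d^(deg q), hence q^K divides d^N with N = K deg q. Now
    X^(p^(c+L)) - X^(p^c) = (X + d)^(p^c) - X^(p^c) is a multiple of d^N, since c = n + 2 alpha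
    gives N <= p^(c-alpha+1). *)
Lemma exists_sparse_multiple q n : q \is monic -> (size q <= n.+1)%N ->
  exists l : seq nat, [/\ uniq l, all (leq 1) l, (\sum_(v <- l) v <= n)%N &
    exists g, q ^+ K * g =
      'X^(p ^ (n + 2 * al + \prod_(v <- l) v)) - 'X^(p ^ (n + 2 * al))].
Proof.
move=> q_monic sq; have al_gt0 := residue_al_gt0 A.
have lc1 : red A (lead_coef q) != 0 by rewrite (monicP q_monic) rmorph1 oner_neq0.
have qb_neq0 : map_poly (red A) q != 0 by rewrite map_poly_eq0_id0 // monic_neq0.
have [l [l_uniq l_pos l_sum l_dvd]] := frobenius_period qb_neq0.
rewrite size_map_poly_id0 // in l_sum l_dvd.
have sq1 : ((size q).-1 <= n)%N by case: (size q) sq.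
exists l; split=> //; first exact: leq_trans sq1.
set L := (\prod_(v <- l) v)%N in l_dvd *; set c := (n + 2 * al)%N.
have [rb eq_rb] := dvdpP _ _ l_dvd; rewrite card_Fp // in eq_rb.
have /poly_expp_eq : eqmodr p (('X^(p ^ L) - 'X) ^+ (size q).-1)
    (q * map_poly (lift_Fp A) rb).
  apply/poly_eqmodrP; rewrite rmorphM /= lift_polyK mulrC -eq_rb.
  by rewrite rmorphXn rmorphB /= map_polyXn map_polyX.
rewrite -exprM exprMn; set N := (_ * K)%N => eq_dN.
have al_le : (al <= c)%N by rewrite /c; lia.
have N_le : (N <= p ^ (c - al).+1)%N.
  apply: (@leq_trans (p ^ n * p ^ al.-1)).
    by rewrite leq_mul2r (leq_trans sq1) ?orbT // ltnW // ltn_expl.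
  by rewrite -expnD leq_exp2l // /c; lia.
have [g] := dvd_expp_sub 'X ('X^(p ^ L) - 'X) al_le N_le.
rewrite eq_dN ['X + _]addrC subrK -exprM -expnD addnC -mulrA => eq_g.
by exists (map_poly (lift_Fp A) rb ^+ K * g).
Qed.

Lemma sparse_monic i j : (i < j)%N -> ('X^j - 'X^i : {poly A}) \is monic.
Proof.
move=> ij; rewrite monicE lead_coefDl ?lead_coefXn //.
by rewrite size_polyN !size_polyXn.
Qed.

(* Multiplication by [g] turns the denominator [q ^+ K] into a sparse one, for
   which the coefficients can be written down. *)
Lemma mul_cartier_sparse q g s m i j : q \is monic -> (0 < m)%N ->
  q ^+ K * g = 'X^j - 'X^i -> q ^+ (m * K) = q ^+ K \Po 'X^m ->
  g * cartier m 0 (s * q ^+ (m.-1 * K)) =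
  cartier m 0 (g * s * \sum_(l < m) 'X^(i * (m.-1 - l) + j * l)).
Proof.
move=> q_monic m_gt0 eq_g eq_frob.
have key : q ^+ (m.-1 * K) * (g \Po 'X^m) = g * \sum_(l < m) 'X^(i * (m.-1 - l) + j * l).
  have qK_reg : GRing.lreg (q ^+ K) by apply/monic_lreg/monic_exp.
  (* Multiplied by q^K, both sides become X^(jm) - X^(im), the right one by the geometric sum. *)
  apply: qK_reg; rewrite mulrA [RHS]mulrA eq_g -exprD -mulSn prednK // eq_frob -comp_polyM eq_g.
  rewrite comp_polyB !comp_poly_exp !comp_polyX -!exprM ![(m * _)%N]mulnC !exprM.
  rewrite -opprB subrXX -mulNr opprB; congr (_ * _); apply: eq_bigr => l _.
  by rewrite -!exprM -exprD.
by rewrite [LHS]mulrC -cartierM // -mulrA key mulrA [s * g]mulrC.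
Qed.

Lemma coef_mul_sparse f m i j k :
  (f * \sum_(l < m) 'X^(i * (m.-1 - l) + j * l))`_k =
  \sum_(u < size f) f`_u * (\sum_(l < m) (k == u + (i * (m.-1 - l) + j * l))%N)%:R.
Proof.
rewrite -{1}[f]coefK poly_def mulr_suml coef_sum; apply: eq_bigr => u _.
rewrite -scalerAl coefZ mulr_sumr coef_sum natr_sum; congr (_ * _).
by apply: eq_bigr => l _; rewrite -exprD coefXn.
Qed.

Lemma sum_eq_progression m i j k u : (i < j)%N ->
  (\sum_(l < m) (k == u + (i * (m.-1 - l) + j * l))%N =
   [exists l : 'I_m, k == u + (i * (m.-1 - l) + j * l)])%N.
Proof.
move=> ij; case: existsP => [[l k_eq]|no_l].
  rewrite (bigD1 l) //= k_eq big1 ?addn0 // => l' l'_neq; apply/eqP.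
  rewrite eqb0; apply: contra l'_neq => /eqP; rewrite (eqP k_eq) => eq_l.
  have := ltn_ord l; have := ltn_ord l' => l'_lt l_lt.
  apply/eqP/val_inj => /=; nia.
rewrite big1 // => l _; apply/eqP; rewrite eqb0; apply/negP => k_eq.
by apply: no_l; exists l.
Qed.

(** Multiplied by the regular element g, the e-th iterate is the p^e-section of g s times a
    geometric sum, whose coefficients record membership in an arithmetic progression;
    [progression_iff] identifies them for e and e + L. The bound nK + 2 on [size s] leaves room for
    one factor X. *)
Lemma border_step0_periodic q n : map_poly (red A) q != 0 -> (size q <= n.+1)%N ->
  exists l : seq nat, [/\ uniq l, all (leq 1) l, (\sum_(v <- l) v <= n)%N &
    forall s e, (size s <= n * K + 2)%N -> (n + 2 * al + \prod_(v <- l) v + 2 <= e)%N ->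
    iter (e + \prod_(v <- l) v) (border_step 0 q) s = iter e (border_step 0 q) s].
Proof.
move=> q_neq0 sq; have [q1 [q1_monic sq1 q1_neq0 eq_q1]] := exists_monic_lift q_neq0.
have sq1_le : (size q1 <= n.+1)%N by rewrite sq1 (leq_trans (size_poly _ _)).
have [l [l_uniq l_pos l_sum [g eq_g]]] := exists_sparse_multiple q1_monic sq1_le.
exists l; split=> // s e ss e_ge.
have L_gt0 : (0 < \prod_(v <- l) v)%N.
  by rewrite big_seq; apply: prodn_cond_gt0 => v /(allP l_pos).
move: (\prod_(v <- l) v)%N => L in eq_g e_ge L_gt0 *.
have eq_iter i : iter i (border_step 0 q) s = iter i (border_step 0 q1) s.
  by apply: eq_iter => t; rewrite /border_step eq_q1.
rewrite !eq_iter !iter_border_step; clear eq_iter.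
set c := (n + 2 * al)%N in eq_g e_ge *.
have pow_gt0 i : (0 < p ^ i)%N by rewrite expn_gt0 p_gt0.
have exp_lt : (p ^ c < p ^ (c + L))%N by rewrite ltn_exp2l // -[X in (X < _)%N]addn0 ltn_add2l.
have D_monic := sparse_monic exp_lt.
have sz_qKg : (size (g : {poly A}) <= (p ^ (c + L)).+1)%N.
  have g_neq0 : g != 0.
    by apply: contraTneq D_monic => g0; rewrite -eq_g g0 mulr0 monicE lead_coef0 eq_sym oner_neq0.
  have := size_monicM (monic_exp K q1_monic) g_neq0.
  rewrite eq_g size_polyDl ?size_polyN ?size_polyXn // => eq_sz.
  have := size_poly_gt0 (q1 ^+ K); rewrite monic_neq0 ?monic_exp // => /eqP.
  by lia.
have g_reg : GRing.lreg g.
  have := monic_lreg D_monic; rewrite -eq_g; exact: GRing.lregMl.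
apply: g_reg; rewrite !(mul_cartier_sparse s q1_monic _ eq_g) //; try exact: poly_expp_frob_iter.
apply/polyP => k; rewrite !coef_cartier // !addn0 !coef_mul_sparse.
apply: eq_bigr => u _; congr (_ * _%:R); rewrite !sum_eq_progression //.
have sz_t : (size (g * s)%R <= p ^ (c + L) + n * K + 2)%N.
  apply: leq_trans (size_polyMleq _ _) _; lia.
(* As nK <= p^c, the size of g s is at most 4 p^(c+L) <= p^(c+L+2) <= p^e. *)
have u_lt : (u < p ^ e)%N.
  apply: leq_trans (ltn_ord u) (leq_trans sz_t _).
  have K_le : (n * K <= p ^ c)%N.
    apply: (@leq_trans (p ^ n * p ^ al.-1)); first by rewrite leq_mul2r ltnW ?orbT // ltn_expl.
    by rewrite -expnD leq_exp2l // /c; lia.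
  have pL_ge : (p ^ (c + L).+2 <= p ^ e)%N by rewrite leq_exp2l //; lia.
  have p2 : (2 <= p ^ (c + L))%N by apply: leq_trans p_gt1 _; rewrite -[X in (X <= _)%N]expn1 leq_exp2l //; lia.
  apply: leq_trans pL_ge; rewrite 2!expnS mulnA.
  have p4 : (4 <= p * p)%N by rewrite (@leq_mul 2 2).
  by have := leq_mul p4 (leqnn (p ^ (c + L))); move: exp_lt K_le p2; clear; lia.
have := @progression_iff (p ^ (e - c)) (p ^ c) (p ^ (c + L) - p ^ c) u k.
rewrite subnKC ?(ltnW exp_lt) // -!expnD subnK; last by lia.
rewrite [(e - c + (c + L))%N](_ : _ = e + L)%N; last by lia.
move=> -> //; first by rewrite subn_gt0.
by rewrite ltn_exp2l //; lia.
Qed.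

Lemma border_step_periodic q n : map_poly (red A) q != 0 -> (size q <= n.+1)%N ->
  exists l : seq nat, [/\ uniq l, all (leq 1) l, (\sum_(v <- l) v <= n)%N &
    forall r s e, r = 0%N \/ r = p.-1 -> (size s <= n * K + 1)%N ->
    (n + 2 * al + \prod_(v <- l) v + 2 <= e)%N ->
    iter (e + \prod_(v <- l) v) (border_step r q) s = iter e (border_step r q) s].
Proof.
move=> q_neq0 sq; have [l [l_uniq l_pos l_sum l_per]] := border_step0_periodic q_neq0 sq.
exists l; split=> // r s e [->|->] ss e_ge; first by rewrite l_per // (leq_trans ss) // leq_add2l.
have X_reg : GRing.lreg ('X : {poly A}) by apply/monic_lreg/monicX.
apply: X_reg; rewrite !iter_border_step_pred l_per //.
by rewrite mulrC; apply: leq_trans (size_polyMleq _ _) _; rewrite size_polyX; lia.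
Qed.

End UnivariatePeriod.

(** * Power series: coefficients, inversion and Frobenius substitution *)

Section FpsTheory.
Variable R : comNzRingType.
Implicit Types f g : fps R.

Lemma coef_fpsD f g n : (f + g) n = f n + g n. Proof. by []. Qed.
Lemma coef_fpsN f n : (- f) n = - f n. Proof. by []. Qed.
Lemma coef_fps0 n : (0 : fps R) n = 0. Proof. by rewrite /= if_same. Qed.
Lemma coef_fps1 n : (1 : fps R) n = (n == 0%N)%:R. Proof. by case: n. Qed.
Lemma coef_fpsM f g n : (f * g) n = \sum_(i < n.+1) f i * g (n - i)%N. Proof. by []. Qed.

Lemma coef_fps_sum I (r : seq I) (P : pred I) (f : I -> fps R) n :
  (\sum_(i <- r | P i) f i) n = \sum_(i <- r | P i) f i n.
Proof. by elim/big_rec2: _ => [|i x y _ <-]; rewrite ?coef_fps0. Qed.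

Lemma coef_fps_const (c : R) n : fps_const c n = c *+ (n == 0%N). Proof. by case: n. Qed.

Lemma coef_fps_constM c f n : (fps_const c * f) n = c * f n.
Proof.
rewrite coef_fpsM big_ord_recl /= subn0 big1 ?addr0 // => i _.
by rewrite mul0r.
Qed.

Fact fps_const_is_zmod_morphism : zmod_morphism (@fps_const R).
Proof. by move=> a b; apply: fpsP => -[|n] //=; rewrite subrr. Qed.

Fact fps_const_is_monoid_morphism : monoid_morphism (@fps_const R).
Proof.
split=> [|a b]; first by [].
by apply: fpsP => n; rewrite coef_fps_constM !coef_fps_const mulrnAr.
Qed.

HB.instance Definition _ := GRing.isZmodMorphism.Build R (fps R) (@fps_const R)
  fps_const_is_zmod_morphism.
HB.instance Definition _ := GRing.isMonoidMorphism.Build R (fps R) (@fps_const R)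
  fps_const_is_monoid_morphism.

Lemma coef_fps_mulX f n : (@fps_X R * f) n = if n is m.+1 then f m else 0.
Proof.
rewrite coef_fpsM; case: n => [|n]; first by rewrite big_ord1 mul0r.
rewrite !big_ord_recl /= mul0r add0r mul1r subn1 big1 ?addr0 // => i _.
by rewrite mul0r.
Qed.

Lemma coef_fps_mulXn f k n : (@fps_X R ^+ k * f) n = if (n < k)%N then 0 else f (n - k)%N.
Proof.
elim: k n => [|k IH] n; first by rewrite expr0 mul1r ltn0 subn0.
by rewrite exprS -mulrA coef_fps_mulX; case: n => [|n] //; exact: IH.
Qed.

Lemma coef_fps_Xn k n : (@fps_X R ^+ k) n = (n == k)%:R.
Proof.
rewrite -[_ ^+ _]mulr1 coef_fps_mulXn coef_fps1; case: ltnP => [nk|kn].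
  by rewrite ltn_eqF.
by rewrite subn_eq0 eqn_leq kn andbT.
Qed.

Lemma fps_ord_exp f k n : f 0%N = 0 -> (n < k)%N -> (f ^+ k) n = 0.
Proof.
move=> f0; elim: k n => // k IH n nk; rewrite exprS coef_fpsM big1 // => -[[|i] /= i_lt] _.
  by rewrite f0 mul0r.
by rewrite IH ?mulr0 //; lia.
Qed.

(** Geometric series in u = 1 - c f: as u has no constant term, only the powers u^k with k <= n
    reach the coefficient n. *)
Lemma fps_inv_exists f c : f 0%N * c = 1 -> exists g : fps R, f * g = 1.
Proof.
move=> fc; pose u : fps R := 1 - fps_const c * f.
have u0 : u 0%N = 0.
  by rewrite coef_fpsD coef_fpsN coef_fps_constM coef_fps1 mulrC fc subrr.
pose g : fps R := Fps (fun n => \sum_(k < n.+1) (u ^+ k) n).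
have g_eq N n : (n < N)%N -> g n = \sum_(k < N) (u ^+ k) n.
  move=> nN; rewrite -(subnKC nN) big_split_ord /= [X in _ + X]big1 ?addr0 // => i _.
  by rewrite fps_ord_exp // addSn ltnS leq_addr.
exists (fps_const c * g); rewrite mulrCA mulrA.
have -> : fps_const c * f = 1 - u by rewrite subKr.
apply: fpsP => n; rewrite mulrBl mul1r coef_fpsD coef_fpsN.
have -> : (u * g) n = \sum_(k < n.+1) (u ^+ k.+1) n.
  rewrite coef_fpsM (eq_bigr (fun i : 'I_n.+1 => \sum_(k < n.+1) u i * (u ^+ k) (n - i)%N)).
    by rewrite exchange_big; apply: eq_bigr => k _; rewrite exprS coef_fpsM.
  by move=> i _; rewrite (@g_eq n.+1) ?mulr_sumr // ltnS leq_subr.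
rewrite /= big_ord_recl [X in _ - X]big_ord_recr /= [X in _ - (_ + X)]fps_ord_exp //.
by rewrite addr0 addrK.
Qed.

End FpsTheory.

Section FpsFrobenius.
Variables (R : comNzRingType) (p : nat) (theta : {rmorphism R -> R}).
Hypothesis p_gt0 : (0 < p)%N.
Implicit Types f g : fps R.

(* The unused proof lets the morphism instances below be inferred. *)
Definition fps_frob of (0 < p)%N := fun f : fps R => Fps (fun n => if (p %| n)%N then theta (f (n %/ p)%N) else 0).
Local Notation frob := (fps_frob p_gt0).

Lemma sum_dvdn (G : nat -> R) n :
  \sum_(i < (p * n).+1 | (p %| i)%N) G (i %/ p)%N = \sum_(i < n.+1) G i.
Proof.
rewrite (reindex_onto (fun i : 'I_n.+1 => inord (p * i) : 'I_(p * n).+1)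
   (fun j => inord (j %/ p)%N)) /=; last first.
  move=> i /dvdnP[k eq_i]; apply: val_inj => /=; have := ltn_ord i.
  rewrite eq_i mulnK // ltnS [(k * p)%N]mulnC leq_pmul2l // => kn.
  by rewrite (@inordK n k) ?ltnS // (@inordK (p * n)) ?ltnS ?leq_pmul2l.
apply: eq_big => [i|i _]; have := ltn_ord i; rewrite ltnS => i_le.
  by rewrite inordK ?ltnS ?leq_pmul2l // dvdn_mulr // mulKn // inord_val eqxx.
by rewrite inordK ?ltnS ?leq_pmul2l // mulKn.
Qed.

Fact fps_frob_is_zmod_morphism : zmod_morphism frob.
Proof.
by move=> f g; apply: fpsP => n /=; case: ifP => _; rewrite ?subrr ?rmorphB.
Qed.

Fact fps_frob_is_monoid_morphism : monoid_morphism frob.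
Proof.
split=> [|f g]; apply: fpsP => n.
  rewrite coef_fps1 /=; case: n => [|n]; first by rewrite dvdn0 div0n rmorph1.
  case: ifP => // /dvdnP[[|k] // ->]; by rewrite mulnK //= rmorph0 muln_eq0 (gtn_eqF p_gt0).
rewrite coef_fpsM -[LHS]/(if (p %| n)%N then theta ((f * g) (n %/ p)%N) else 0).
case: ifP => [/dvdnP[m ->]|p_ndvd]; last first.
  rewrite big1 // => i _ /=; case: ifP => [pi|_]; last by rewrite mul0r.
  case: ifP => [pni|_]; last by rewrite mulr0.
  by rewrite -(subnKC (_ : i <= n)%N) ?dvdn_add ?p_ndvd // in p_ndvd; have := ltn_ord i.
rewrite mulnK // coef_fpsM rmorph_sum [(m * p)%N]mulnC -(sum_dvdn (fun i => theta (f i * g (m - i)%N))) big_mkcond.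
apply: eq_bigr => i _ /=; case: ifP => [/dvdnP[k ->]|_]; last by rewrite mul0r.
by rewrite mulnK // [(k * p)%N]mulnC -mulnBr dvdn_mulr // mulKn // rmorphM.
Qed.

HB.instance Definition _ := GRing.isZmodMorphism.Build (fps R) (fps R) frob
  fps_frob_is_zmod_morphism.
HB.instance Definition _ := GRing.isMonoidMorphism.Build (fps R) (fps R) frob
  fps_frob_is_monoid_morphism.

Lemma fps_frobX : frob (fps_X R) = fps_X R ^+ p.
Proof.
apply: fpsP => n; rewrite coef_fps_Xn /=; case: ifP => [/dvdnP[k ->]|p_ndvd].
  by rewrite mulnK // rmorph_nat -[X in _ = (_ == X)%:R]mul1n eqn_pmul2r.
by case: eqP p_ndvd => // ->; rewrite dvdnn.
Qed.

Lemma fps_frob_const c : frob (fps_const c) = fps_const (theta c).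
Proof.
apply: fpsP => -[|n] /=; first by rewrite dvdn0 div0n.
by case: ifP => // /dvdnP[[|k] // ->]; rewrite mulnK // rmorph0.
Qed.

End FpsFrobenius.

(** * The substitution x -> XY, y -> Y and bivariate sections *)

Section Shear.
Variable A : comNzRingType.
Local Notation E := (fps (fps A)).
Implicit Types (f g : fps A) (V : {poly (fps A)}).

(* Elements of [fps (fps A)] are series in the outer variable Y over A[[X]];
   [fps_diag f] is f(XY) and [shear V] is V(XY, Y). *)
Definition fps_diag f : E := Fps (fun m => Fps (fun n => if m == n then f n else 0)).

Fact fps_diag_is_zmod_morphism : zmod_morphism fps_diag.
Proof.
by move=> f g; do 2!apply: fpsP => ? /=; case: ifP => _; rewrite ?subrr.
Qed.

Lemma coef_fps2M (f g : E) m n :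
  (f * g) m n = \sum_(j < m.+1) \sum_(k < n.+1) f j k * g (m - j)%N (n - k)%N.
Proof. by rewrite coef_fpsM coef_fps_sum; apply: eq_bigr => j _; rewrite coef_fpsM. Qed.

Fact fps_diag_is_monoid_morphism : monoid_morphism fps_diag.
Proof.
split=> [|f g].
  apply: fpsP => m; apply: fpsP => n; rewrite !coef_fps1 /=.
  by case: m n => [|m] [|n] //=; rewrite ?if_same //; case: ifP.
apply: fpsP => m; apply: fpsP => n; rewrite coef_fps2M /= exchange_big /=.
have inner (k : 'I_n.+1) : \sum_(j < m.+1) (if j == k :> nat then f k else 0) *
   (if (m - j == n - k)%N then g (n - k)%N else 0) =
   if m == n then f k * g (n - k)%N else 0.
  have k_le : (k <= n)%N by rewrite -ltnS.
  have [k_le_m|m_lt] := leqP k m.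
    have k_lt : (k < m.+1)%N by [].
    rewrite (bigD1 (Ordinal k_lt)) //= eqxx big1 ?addr0 => [|j j_neq].
      rewrite (_ : (m - k == n - k)%N = (m == n)); last by rewrite -(eqn_add2r k) !subnK.
      by case: ifP => //; rewrite mulr0.
    by rewrite ifF ?mul0r //; apply: contraNF j_neq => /eqP jk; apply/eqP/val_inj.
  rewrite big1 => [|j _]; first by rewrite ifF //; apply/eqP; lia.
  by rewrite ifF ?mul0r //; apply/eqP; have := ltn_ord j; lia.
rewrite (eq_bigr _ (fun k _ => inner k)); case: ifP => _; last by rewrite big1.
by [].
Qed.

HB.instance Definition _ := GRing.isZmodMorphism.Build (fps A) E fps_diag
  fps_diag_is_zmod_morphism.
HB.instance Definition _ := GRing.isMonoidMorphism.Build (fps A) E fps_diag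
  fps_diag_is_monoid_morphism.

Local Notation Y := (fps_X (fps A)).

Definition shear V : E := (map_poly fps_diag V).[Y].

Lemma shearD V W : shear (V + W) = shear V + shear W.
Proof. by rewrite /shear rmorphD hornerD. Qed.
Lemma shearM V W : shear (V * W) = shear V * shear W.
Proof. by rewrite /shear rmorphM hornerM. Qed.
Lemma shearX : shear 'X = Y.
Proof. by rewrite /shear map_polyX hornerX. Qed.
Lemma shearC f : shear f%:P = fps_diag f.
Proof. by rewrite /shear map_polyC hornerC. Qed.
Lemma shear_exp V n : shear (V ^+ n) = shear V ^+ n.
Proof. by rewrite /shear rmorphXn horner_exp. Qed.

Lemma coef_shear V m n : shear V m n = if (n <= m)%N then V`_(m - n) n else 0.
Proof.
rewrite /shear horner_coef !coef_fps_sum.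
rewrite (eq_bigr (fun i : 'I__ => if (i + n == m)%N then V`_i n else 0)); last first.
  move=> i _; rewrite coef_map mulrC coef_fps_mulXn.
  have [m_lt|i_le] := ltnP m i.
    by rewrite coef_fps0 ifF //; apply/eqP; lia.
  rewrite /= -(eqn_add2l i) subnKC //.
  by rewrite eq_sym.
have [n_le|m_lt] := leqP n m; last first.
  by rewrite big1 // => i _; rewrite ifF //; apply/eqP; lia.
have [sz|lt_sz] := leqP (size (map_poly fps_diag V)) (m - n).
  rewrite big1 => [|i _]; last by rewrite ifF //; apply/eqP; have := ltn_ord i; lia.
  have : (map_poly fps_diag V)`_(m - n) = 0 by rewrite nth_default.
  by rewrite coef_map => /(congr1 (fun f : E => f n n)); rewrite coef_fps0 coef_fps0 /= eqxx => ->.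
rewrite (bigD1 (Ordinal lt_sz)) //= subnK // eqxx big1 ?addr0 // => i i_neq.
rewrite ifF //; apply: contraNF i_neq => /eqP im; apply/eqP/val_inj => /=; lia.
Qed.

End Shear.

Lemma bipoly_ind (R : nzRingType) (Pr : {poly {poly R}} -> Prop) :
  Pr 0 -> (forall S T, Pr S -> Pr T -> Pr (S + T)) ->
  (forall c a b, Pr ((c%:P * 'X^b)%:P * 'X^a)) -> forall S, Pr S.
Proof.
move=> Pr0 PrD Prm S; rewrite -[S]coefK poly_def; elim/big_ind: _ => // a _.
rewrite -mul_polyC -[S`_a]coefK poly_def rmorph_sum /= mulr_suml.
by elim/big_ind: _ => // b _; rewrite -mul_polyC; exact: Prm.
Qed.

Lemma coef_bimonomial (R : nzRingType) (c : R) a b n m :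
  ((c%:P * 'X^b)%:P * 'X^a)`_n`_m = c *+ ((n == a) && (m == b)).
Proof.
rewrite coefCM coefXn; case: (n == a); last by rewrite mulr0 coef0.
by rewrite mulr1 coefCM coefXn mulr_natr.
Qed.

Section BivariateCartier.
Variables (R : comNzRingType) (p : nat).
Implicit Types S T : {poly {poly R}}.

Definition cartier2 r s S := map_poly (cartier p s) (cartier p r S).

Lemma coef_cartier2 r s S a b : (0 < p)%N ->
  (cartier2 r s S)`_a`_b = S`_(p * a + r)`_(p * b + s).
Proof. by move=> p0; rewrite coef_map_id0 ?cartier0 // !coef_cartier. Qed.

Lemma cartier2D r s S T : (0 < p)%N -> cartier2 r s (S + T) = cartier2 r s S + cartier2 r s T.
Proof. by move=> p0; apply/polyP => a; apply/polyP => b; rewrite !(coefD, coef_cartier2). Qed.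

Definition frobenius2 S : {poly {poly R}} := map_poly (comp_poly 'X^p) S \Po 'X^p.

Lemma frobenius2D S T : frobenius2 (S + T) = frobenius2 S + frobenius2 T.
Proof. by rewrite /frobenius2 rmorphD comp_polyD. Qed.

Lemma frobenius2_exp S n : frobenius2 (S ^+ n) = frobenius2 S ^+ n.
Proof. by rewrite /frobenius2 rmorphXn comp_poly_exp. Qed.

Lemma cartier2M r s S T : (r < p)%N -> (s < p)%N ->
  cartier2 r s (S * frobenius2 T) = cartier2 r s S * T.
Proof.
move=> rp sp; have p0 : (0 < p)%N by apply: leq_trans rp.
apply/polyP => a; apply/polyP => b.
rewrite /cartier2 /frobenius2 cartierM // coef_map_id0 ?cartier0 // coef_cartier //.
rewrite [in LHS]coefM [in RHS]coefM !coef_sum; apply: eq_bigr => i _.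
rewrite [in RHS]coef_map_id0 ?cartier0 // [in LHS]coef_map_id0 ?comp_poly0 //.
by rewrite -cartierM // coef_cartier.
Qed.

End BivariateCartier.

Section PolyOverFps.
Variable A : comNzRingType.
Implicit Types S T : {poly {poly A}}.

(** S as a polynomial in y over A[[x]], with the roles of the two variables exchanged, so that F can
    be a root of it. *)
Definition polyY_fps S : {poly (fps A)} :=
  (map_poly (map_poly (@fps_const A)) S).[(fps_X A)%:P].

Lemma polyY_fpsD S T : polyY_fps (S + T) = polyY_fps S + polyY_fps T.
Proof. by rewrite /polyY_fps rmorphD hornerD. Qed.
Lemma polyY_fpsM S T : polyY_fps (S * T) = polyY_fps S * polyY_fps T.
Proof. by rewrite /polyY_fps rmorphM hornerM. Qed.
Lemma polyY_fps_exp S n : polyY_fps (S ^+ n) = polyY_fps S ^+ n.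
Proof. by rewrite /polyY_fps rmorphXn horner_exp. Qed.
Lemma polyY_fpsC (q : {poly A}) : polyY_fps q%:P = map_poly (@fps_const A) q.
Proof. by rewrite /polyY_fps map_polyC hornerC. Qed.
Lemma polyY_fpsX : polyY_fps 'X = (fps_X A)%:P.
Proof. by rewrite /polyY_fps map_polyX hornerX. Qed.

Lemma polyY_fps_monomial c a b :
  polyY_fps ((c%:P * 'X^b)%:P * 'X^a) = (fps_const c * fps_X A ^+ a)%:P * 'X^b.
Proof.
rewrite polyY_fpsM polyY_fps_exp polyY_fpsX polyY_fpsC -polyC_exp mulrC.
have -> : map_poly (@fps_const A) (c%:P * 'X^b) = (fps_const c)%:P * 'X^b.
  by rewrite rmorphM /= map_polyC map_polyXn.
by rewrite mulrA -polyCM [_ * fps_const c]mulrC.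
Qed.

Lemma coef_polyY_fps S m n : (polyY_fps S)`_m n = S`_n`_m.
Proof.
elim/bipoly_ind: S => [|S T IHS IHT|c a b].
- by rewrite /polyY_fps rmorph0 horner0 !coef0 coef_fps0.
- by rewrite polyY_fpsD !coefD coef_fpsD IHS IHT.
rewrite polyY_fps_monomial coefMXn coefC coef_bimonomial.
have [mb|mb] := ltnP m b; first by rewrite coef_fps0 [m == b]ltn_eqF ?andbF.
rewrite subn_eq0 [m == b]eqn_leq mb andbT; case: (m <= b)%N; last by rewrite coef_fps0 andbF.
by rewrite coef_fps_constM coef_fps_Xn andbT mulr_natr.
Qed.

End PolyOverFps.

Section ShearedPolynomials.
Variables (A : comNzRingType) (p : nat).
Hypothesis p_gt0 : (0 < p)%N.
Local Notation E := (fps (fps A)).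
Local Notation X := (fps_const (fps_X A) : E).
Local Notation Y := (fps_X (fps A)).
Implicit Types S T U : {poly {poly A}}.

(** This is S(XY, Y). An expansion valid for |y| > |F| becomes an ordinary power series in X and Y,
    up to a power of Y. *)
Definition shear2 S : E := shear (polyY_fps S).

Lemma shear2D S T : shear2 (S + T) = shear2 S + shear2 T.
Proof. by rewrite /shear2 polyY_fpsD shearD. Qed.
Lemma shear2M S T : shear2 (S * T) = shear2 S * shear2 T.
Proof. by rewrite /shear2 polyY_fpsM shearM. Qed.
Lemma shear2_exp S n : shear2 (S ^+ n) = shear2 S ^+ n.
Proof. by rewrite /shear2 polyY_fps_exp shear_exp. Qed.
Lemma shear2_0 : shear2 0 = 0.
Proof. by rewrite /shear2 /polyY_fps rmorph0 horner0 /shear rmorph0 horner0. Qed.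

Lemma fps_diagX : fps_diag (fps_X A) = X * Y.
Proof.
apply: fpsP => m; apply: fpsP => n; rewrite coef_fps_constM -[Y]expr1 coef_fps_Xn.
have [->|m_neq] := eqVneq m 1%N; last by rewrite mulr0 coef_fps0 /=; case: eqP => // <-; rewrite (negPf m_neq).
by rewrite mulr1 /=; case: n => [|[|n]].
Qed.

Lemma fps_diag_const (c : A) : fps_diag (fps_const c) = fps_const (fps_const c).
Proof. by apply: fpsP => -[|m]; apply: fpsP => -[|n] //=; rewrite if_same. Qed.

Lemma shear2_monomial c a b :
  shear2 ((c%:P * 'X^b)%:P * 'X^a) = fps_const (fps_const c) * X ^+ a * Y ^+ (a + b).
Proof.
rewrite /shear2 polyY_fps_monomial shearM shear_exp shearX shearC rmorphM rmorphXn /=.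
rewrite fps_diagX fps_diag_const exprMn exprD.
by move: (X ^+ a) (Y ^+ a) (Y ^+ b) (fps_const _) => *; rewrite !mulrA.
Qed.

Lemma coef_shear2_monomialM c a b (G : E) m n :
  (shear2 ((c%:P * 'X^b)%:P * 'X^a) * G) m n =
  if (a + b <= m)%N && (a <= n)%N then c * G (m - (a + b))%N (n - a)%N else 0.
Proof.
have -> : shear2 ((c%:P * 'X^b)%:P * 'X^a) * G =
    fps_const (fps_const c) * (fps_const (fps_X A ^+ a) * (Y ^+ (a + b) * G)).
  rewrite shear2_monomial rmorphXn.
  by move: (X ^+ a) (Y ^+ (a + b)) (fps_const _) => *; rewrite !mulrA.
rewrite !coef_fps_constM.
rewrite coef_fps_mulXn; have [n_lt|_] := ltnP n a; first by rewrite mulr0 andbF.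
rewrite coef_fps_mulXn; have [m_lt|_] := ltnP m; first by rewrite coef_fps0 mulr0.
by [].
Qed.

Definition fps_frob2 : E -> E := fps_frob (fps_frob idfun p_gt0 : {rmorphism _ -> _}) p_gt0.

HB.instance Definition _ := GRing.RMorphism.copy fps_frob2
  (fps_frob (fps_frob idfun p_gt0 : {rmorphism _ -> _}) p_gt0).

Lemma coef_fps_frob2 (G : E) m n :
  fps_frob2 G m n = if (p %| m)%N && (p %| n)%N then G (m %/ p)%N (n %/ p)%N else 0.
Proof. by rewrite /=; case: ifP => _ /=; rewrite ?if_same. Qed.

Lemma frobenius2_monomial c a b :
  frobenius2 p ((c%:P * 'X^b)%:P * 'X^a) = (c%:P * 'X^(p * b))%:P * 'X^(p * a) :> {poly {poly A}}.
Proof.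
rewrite /frobenius2 rmorphM /= map_polyC map_polyXn comp_polyM comp_polyC comp_poly_exp comp_polyX.
by rewrite /= comp_polyM comp_polyC comp_poly_exp comp_polyX -!exprM.
Qed.

Lemma shear2_frobenius2 S : shear2 (frobenius2 p S) = fps_frob2 (shear2 S).
Proof.
elim/bipoly_ind: S => [|S T IHS IHT|c a b].
- by rewrite /frobenius2 rmorph0 comp_poly0 shear2_0 rmorph0.
- by rewrite frobenius2D !shear2D IHS IHT -rmorphD.
rewrite frobenius2_monomial !shear2_monomial /fps_frob2 !(rmorphM, rmorphXn) /=.
rewrite fps_frobX !fps_frob_const /= ?fps_frob_const ?fps_frobX.
by rewrite rmorphXn -!exprM -mulnDr.
Qed.

(** All exponents in [fps_frob2 H] are multiples of p, so a monomial x^a y^b of U contributes only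
    if a = r and b = p - 1 modulo p. Its Y-exponent a + b explains the index p m + p - 1 + r. *)
Lemma shear2_cartier2 U (H : E) r m n : (r < p)%N ->
  (shear2 U * fps_frob2 H) (p * m + p.-1 + r)%N (p * n + r)%N =
  (shear2 (cartier2 p r p.-1 U) * H) m n.
Proof.
move=> rp; elim/bipoly_ind: U m n => [|S T IHS IHT|c a b] m n.
- have -> : cartier2 p r p.-1 (0 : {poly {poly A}}) = 0.
    by rewrite /cartier2 cartier0 map_poly0.
  by rewrite shear2_0 !mul0r !coef_fps0.
- by rewrite cartier2D // !shear2D !mulrDl !coef_fpsD IHS IHT.
rewrite coef_shear2_monomialM coef_fps_frob2.
have [/andP[/eqP a_r /eqP b_r]|ab] := boolP ((a %% p == r) && (b %% p == p.-1))%N.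
  have [a' ->] : exists a', a = (p * a' + r)%N.
    by exists (a %/ p)%N; rewrite {1}(divn_eq a p) a_r mulnC.
  have [b' ->] : exists b', b = (p * b' + p.-1)%N.
    by exists (b %/ p)%N; rewrite {1}(divn_eq b p) b_r mulnC.
  have -> : cartier2 p r p.-1 ((c%:P * 'X^(p * b' + p.-1))%:P * 'X^(p * a' + r)) =
     ((c%:P * 'X^b')%:P * 'X^a').
    apply/polyP => i; apply/polyP => j; rewrite coef_cartier2 // !coef_bimonomial.
    by rewrite !eqn_add2r !eqn_pmul2l.
  rewrite coef_shear2_monomialM.
  have -> : (p * a' + r + (p * b' + p.-1) = p * (a' + b') + p.-1 + r)%N.
    by rewrite mulnDr; lia.
  rewrite !leq_add2r !leq_pmul2l //.
  case: andP => // -[ab_le a_le].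
  have -> : (p * m + p.-1 + r - (p * (a' + b') + p.-1 + r) = p * (m - (a' + b')))%N.
    by rewrite !subnDr mulnBr.
  have -> : (p * n + r - (p * a' + r) = p * (n - a'))%N by rewrite subnDr mulnBr.
  by rewrite !dvdn_mulr // !mulKn.
have -> : cartier2 p r p.-1 ((c%:P * 'X^b)%:P * 'X^a) = 0.
  apply/polyP => i; apply/polyP => j; rewrite coef_cartier2 // coef_bimonomial !coef0.
  case: andP => // -[/eqP ia /eqP jb]; case/negP: ab.
  by rewrite -ia -jb ![(p * _)%N]mulnC !modnMDl !modn_small ?eqxx // ltn_predL.
rewrite shear2_0 mul0r !coef_fps0; case: ifP => // /andP[ab_le a_le].
case: ifP => [/andP[dvd1 dvd2]|_]; last by rewrite mulr0.
case/negP: ab.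
have a_r : (a %% p = r)%N.
  move: dvd2; rewrite -eqn_mod_dvd // [(p * n)%N]mulnC modnMDl modn_small // => /eqP.
  by move=> ->.
rewrite a_r eqxx /=; move: dvd1; rewrite -eqn_mod_dvd // -addnA [(p * m)%N]mulnC modnMDl addnC.
rewrite -(modnDml a) a_r eqn_modDl [X in X == _]modn_small ?ltn_predL //.
by rewrite eq_sym.
Qed.

End ShearedPolynomials.

Lemma coef_fpsMn (R : comNzRingType) (f : fps R) k n : (f *+ k) n = f n *+ k.
Proof. by elim: k => [|k IH]; rewrite ?mulr0n ?coef_fps0 // !mulrS coef_fpsD IH. Qed.

(** * The residue functional and Furstenberg's formula *)

Section ResidueFunctional.
Variable A : comNzRingType.
Local Notation E := (fps (fps A)).
Local Notation Y := (fps_X (fps A)).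

Lemma coef_fps2_1 m n : (1 : E) m n = ((m == 0%N) && (n == 0%N))%:R.
Proof.
by case: m n => [|m] [|n].
Qed.

(** In a sheared polynomial no X-exponent exceeds the Y-exponent, and this triangular shape passes
    to the inverse by induction on the Y-exponent. *)
Lemma shear_inv_upper (V : {poly (fps A)}) (g : E) c m n :
  V`_0 0%N * c = 1 -> shear V * g = 1 -> (m < n)%N -> g m n = 0.
Proof.
move=> Vc Vg; elim/ltn_ind: m n => m IH n mn.
have g_eq : (shear V * g) m n = shear V 0%N 0%N * g m n.
  rewrite coef_fps2M big_ord_recl [X in _ + X]big1 ?addr0 => [|j _]; last first.
    apply: big1 => k _; rewrite coef_shear; case: leqP => [kj|_]; last by rewrite mul0r.
    by rewrite IH ?mulr0 //=; have := ltn_ord j; move: kj; rewrite /= /bump /=; lia.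
  rewrite big_ord_recl [X in _ + X]big1 ?addr0 ?subn0 // => k _.
  by rewrite coef_shear /= mul0r.
have : (shear V * g) m n = 0.
  by rewrite Vg coef_fps2_1 andbC; case: (n) mn.
rewrite g_eq coef_shear leqnn subnn => eq0.
by rewrite -[g m n]mul1r -Vc mulrAC eq0 mul0r.
Qed.

(** When f(0) = 0 this is f(XY) / Y. *)
Definition offdiag (f : fps A) : E := Fps (fun m => Fps (fun n => if n == m.+1 then f n else 0)).

Lemma fps_diag_offdiag (f : fps A) : f 0%N = 0 -> fps_diag f = Y * offdiag f.
Proof.
move=> f0; apply: fpsP => m; apply: fpsP => n; rewrite coef_fps_mulX.
by case: m => [|m] /=; rewrite 1?eq_sym //; case: n => [|n]; rewrite ?f0.
Qed.

(** Here g = 1 + H + H^2 + ... with H = [offdiag f], and H^k is supported on n = m + k; only 1 and H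
    reach the range n <= m + 1. *)
Lemma offdiag_inv (f : fps A) (g : E) m n : (1 - offdiag f) * g = 1 -> (n <= m.+1)%N ->
  g m n = (if n == m.+1 then f n else 0) + ((m == 0%N) && (n == 0%N))%:R.
Proof.
move=> fg; have g_eq : g = 1 + offdiag f * g by rewrite -fg mulrBl mul1r subrK.
elim/ltn_ind: n m => n IH m n_le.
rewrite g_eq coef_fpsD addrC coef_fps2_1; congr (_ + _).
rewrite coef_fps2M.
have term (j : 'I_m.+1) (k : 'I_n.+1) : offdiag f j k * g (m - j)%N (n - k)%N =
   if (k == j.+1 :> nat) && (m == j :> nat) && (n == k :> nat) then f k else 0.
  rewrite /=; case: eqP => [kj|_] /=; last by rewrite mul0r.
  rewrite IH; [|by have := ltn_ord k; lia|by have := ltn_ord j; lia].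
  rewrite ifF ?add0r; last by apply/eqP; have := ltn_ord j; lia.
  have -> : (m - j == 0)%N = (m == j) by have := ltn_ord j; lia.
  have -> : (n - k == 0)%N = (n == k) by have := ltn_ord k; lia.
  by case: ifP => _; rewrite ?mulr1 ?mulr0.
case: eqP => [n_eq|n_neq]; last first.
  rewrite big1 // => j _; apply: big1 => k _; rewrite term ifF //.
  by apply/negP => /andP[/andP[/eqP ? /eqP ?] /eqP ?]; lia.
rewrite (bigD1 ord_max) //= [X in _ + X]big1 ?addr0; last first.
  move=> j j_neq; apply: big1 => k _; rewrite term ifF //.
  apply: contraNF j_neq => /andP[/andP[_ /eqP mj] _]; exact/eqP/val_inj.
rewrite (bigD1 ord_max) //= [X in _ + X]big1 ?addr0; last first.
  move=> k k_neq; rewrite (term ord_max) ifF //.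
  apply: contraNF k_neq => /andP[_ /eqP nk]; exact/eqP/val_inj.
by rewrite (term ord_max ord_max) /= -n_eq !eqxx.
Qed.

Lemma polyY_fps_derivY (S : {poly {poly A}}) : polyY_fps (derivY S) = (polyY_fps S)^`().
Proof.
apply/polyP => m; apply: fpsP => n; rewrite coef_polyY_fps coef_deriv.
rewrite /derivY coef_map_id0 ?deriv0 // coef_deriv -coef_polyY_fps.
by rewrite coef_fpsMn.
Qed.

Lemma fps_unit_exists (f : E) c : f 0%N 0%N * c = 1 -> exists g : E, f * g = 1.
Proof. by move=> /fps_inv_exists[g0 fg0]; exact: fps_inv_exists fg0. Qed.

Variables (p K : nat) (P : {poly {poly A}}) (F : fps A).
Hypotheses (p_gt0 : (0 < p)%N) (K_gt0 : (0 < K)%N).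

(* As P^(pK) = P(x^p, y^p)^K, this is the action on numerators of the Cartier operator
   applied to S / P^K. *)
Definition cartier_step r S := cartier2 p r p.-1 (S * P ^+ (p.-1 * K)).

(* [Phi S] is the coefficient of y^-1 in the expansion of S / P^K where |y| > |F|;
   the shear x -> XY, y -> Y turns P into Y times a unit Q of A[[X, Y]]. *)
Theorem residue_functional_exists c :
  F 0%N = 0 -> eval_fps P F = 0 -> P`_0`_1 * c = 1 ->
  P ^+ (p * K) = frobenius2 p P ^+ K ->
  exists Phi : {poly {poly A}} -> fps A,
    Phi ('X%:P * derivY P * P ^+ K.-1) = F /\
    forall S r n, (r < p)%N -> Phi S (p * n + r)%N = Phi (cartier_step r S) n.
Proof.
move=> F0 PF Pc P_frob.
(* Over A[[x]], P = V (y - F), and V(0, 0) = P_y(0, 0) is a unit. *)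
have /factor_theorem[V PV] : root (polyY_fps P) F by apply/eqP.
have V00 : V`_0 0%N * c = 1.
  rewrite -Pc -coef_polyY_fps PV.
  have -> : (V * ('X - F%:P))`_1 = V`_0 - V`_1 * F by rewrite mulrBr coefB coefMX coefMC.
  rewrite coef_fpsD coef_fpsN.
  by rewrite coef_fpsM big_ord1 F0 mulr0 subr0.
have sV00 : shear V 0%N 0%N * c = 1 by rewrite coef_shear subnn.
have [Vi VVi] := fps_unit_exists sV00.
have [G HG] : exists G : E, (1 - offdiag F) * G = 1.
  apply: (@fps_unit_exists _ 1); rewrite mulr1 coef_fpsD coef_fpsN.
  by rewrite -[LHS]/(1 - 0) subr0.
pose H := offdiag F.
have sF : fps_diag F = Y * H by exact: fps_diag_offdiag.
have sXF : shear ('X - F%:P) = Y - Y * H.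
  rewrite /shear rmorphB /= map_polyX map_polyC hornerD hornerN hornerX hornerC. by rewrite -sF.
have sP : shear2 P = Y * (shear V * (1 - H)).
  rewrite /shear2 PV shearM sXF.
  have e (R : comNzRingType) (v y z : R) : v * (y - y * z) = y * (v * (1 - z)) by ring.
  exact: e.
(* P(XY, Y) = Y Q with Q invertible. *)
set Q := shear V * (1 - H) in sP.
pose W := Vi * G.
have QW : Q * W = 1 by rewrite /Q /W mulrACA VVi HG mulr1.
(* Dividing by P^K means multiplying by Y^(-K) W^K, and x^n y^(-1) becomes X^n Y^(n-1); hence the
   index n + K - 1. *)
exists (fun S => Fps (fun n => (shear2 S * W ^+ K) (n + K.-1)%N n)); split.
  apply: fpsP => n.
  rewrite -[LHS]/((shear2 ('X%:P * derivY P * P ^+ K.-1) * W ^+ K) (n + K.-1)%N n).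
  (* y P_y / P = y V_y / V + y / (y - F). The first summand has no monomial with X-exponent above
     the Y-exponent, so the coefficient comes from G = 1 / (1 - F(XY)/Y) alone. *)
  have -> : shear2 ('X%:P * derivY P * P ^+ K.-1) * W ^+ K =
     Y ^+ K.-1 * (Y * (Y * (shear V^`() * Vi)) + Y * G).
    rewrite !shear2M shear2_exp sP {1}/shear2 polyY_fpsC map_polyX shearX.
    rewrite {1}/shear2 polyY_fps_derivY PV derivM derivB derivX derivC subr0 mulr1.
    rewrite shearD shearM sXF -[in W ^+ K](prednK K_gt0).
    have e (R : comNzRingType) (y v v' z g vi yk qk wk : R) :
        y * (v' * (y - y * z) + v) * (yk * qk) * (vi * g * wk) =
        yk * (qk * wk) * (y * (y * (v' * vi * ((1 - z) * g))) + y * (v * vi * g)) by ring.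
    rewrite exprMn [W ^+ _.+1]exprS e.
    by rewrite -exprMn QW expr1n HG VVi !mulr1 mul1r.
  rewrite coef_fps_mulXn ifF ?addnK ?coef_fpsD; last by rewrite ltnNge leq_addl.
  rewrite !coef_fps_mulX; case: n => [|n]; first by rewrite F0 !coef_fps0 addr0.
  rewrite coef_fps_mulX (offdiag_inv HG) // eqxx andbF addr0.
  case: n => [|n]; first by rewrite coef_fps0 add0r.
  rewrite coef_fps2M big1 ?add0r // => j _; apply: big1 => k _.
  rewrite coef_shear; case: leqP => [kj|_]; last by rewrite mul0r.
  by rewrite (shear_inv_upper V00 VVi) ?mulr0 //; have := ltn_ord j; lia.
move=> S r n rp.
have Yreg (f g : E) k : Y ^+ k * f = Y ^+ k * g -> f = g.
  move=> fg; apply: fpsP => m; have := congr1 (fun h : E => h (k + m)%N) fg.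
  by rewrite !coef_fps_mulXn ltnNge leq_addr /= addKn.
have W_frob : W ^+ (p * K) = fps_frob2 p_gt0 (W ^+ K).
  have Q_frob : Q ^+ (p * K) = fps_frob2 p_gt0 (Q ^+ K).
    apply: (Yreg _ _ (p * K)%N); rewrite -exprMn -sP -shear2_exp P_frob shear2_exp.
    rewrite shear2_frobenius2 sP rmorphM exprMn rmorphXn; congr (_ * _).
    by rewrite /= /fps_frob2 fps_frobX -exprM.
  have inv : fps_frob2 p_gt0 (Q ^+ K) * fps_frob2 p_gt0 (W ^+ K) = 1.
    by rewrite -rmorphM -exprMn QW expr1n rmorph1.
  have e (R : comNzRingType) (w q f : R) : w * q = 1 -> q * f = 1 -> w = f.
    by move=> wq qf; rewrite -[w]mulr1 -qf mulrA wq mul1r.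
  apply: (e _ _ (Q ^+ (p * K))); last by rewrite Q_frob.
  have WQ : W * Q = 1 by rewrite mulrC.
  by rewrite -exprMn WQ expr1n.
rewrite -[LHS]/((shear2 S * W ^+ K) (p * n + r + K.-1)%N (p * n + r)%N).
rewrite -[RHS]/((shear2 (cartier_step r S) * W ^+ K) (n + K.-1)%N n).
rewrite -(shear2_cartier2 p_gt0 _ _ _ _ rp) -W_frob shear2M shear2_exp sP.
have -> : shear2 S * (Y * Q) ^+ (p.-1 * K) * W ^+ (p * K) = Y ^+ (p.-1 * K) * (shear2 S * W ^+ K).
  have e (R : comNzRingType) (s y q w w' : R) : s * (y * q) * (w * w') = q * w * (y * (s * w')).
    by ring.
  have -> : (p * K = p.-1 * K + K)%N by rewrite addnC -mulSn prednK.
  by rewrite [W ^+ _]exprD [(Y * Q) ^+ _]exprMn e -exprMn QW expr1n mul1r.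
have idx : (p * (n + K.-1) + p.-1 + r = p.-1 * K + (p * n + r + K.-1))%N.
  case: (p) p_gt0 => // p' _; case: (K) K_gt0 => // K' _ /=; rewrite mulnDr !mulSn mulnS; lia.
by rewrite idx coef_fps_mulXn ltnNge leq_addr /= addKn.
Qed.

End ResidueFunctional.

(** * Supports of bivariate polynomials *)

Section Supports.
Variable R : comNzRingType.
Implicit Types (S T : {poly {poly R}}) (B : nat -> nat -> bool).

Definition supp_in B S := forall a b, ~~ B a b -> S`_a`_b = 0.

Lemma supp_in0 B : supp_in B 0.
Proof. by move=> a b _; rewrite !coef0. Qed.

Lemma supp_inD B S T : supp_in B S -> supp_in B T -> supp_in B (S + T).
Proof. by move=> sS sT a b nB; rewrite !coefD sS ?sT ?addr0. Qed.

Lemma supp_inN B S : supp_in B S -> supp_in B (- S).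
Proof. by move=> sS a b nB; rewrite !coefN sS ?oppr0. Qed.

Lemma supp_in_sub B B' S : (forall a b, B a b -> B' a b) -> supp_in B S -> supp_in B' S.
Proof. by move=> BB' sS a b nB'; apply: sS; apply: contra nB'; exact: BB'. Qed.

Lemma supp_inM B1 B2 B3 S T :
  (forall a b a' b', B1 a b -> B2 a' b' -> B3 (a + a')%N (b + b')%N) ->
  supp_in B1 S -> supp_in B2 T -> supp_in B3 (S * T).
Proof.
move=> B123 sS sT a b nB3; rewrite coefM coef_sum big1 // => i _.
rewrite coefM big1 // => j _.
have [B1ij|nB1] := boolP (B1 i j); last by rewrite sS ?mul0r.
rewrite [T`__`__]sT ?mulr0 //; apply: contra nB3 => B2ij.
have := B123 _ _ _ _ B1ij B2ij.
by rewrite !subnKC // -ltnS.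
Qed.

Lemma supp_inMn B S n : supp_in B S -> supp_in B (S *+ n).
Proof. by move=> sS a b nB; rewrite !coefMn sS ?mul0rn. Qed.

Definition filter2 B S : {poly {poly R}} :=
  \poly_(a < size S) \poly_(b < size S`_a) (if B a b then S`_a`_b else 0).

Lemma coef_filter2 B S a b : (filter2 B S)`_a`_b = if B a b then S`_a`_b else 0.
Proof.
rewrite coef_poly; case: ltnP => [_|sz]; last first.
  by rewrite [S`_a]nth_default // coef0 if_same.
rewrite coef_poly; case: ltnP => // sz.
by rewrite [S`_a`_b]nth_default // if_same.
Qed.

Lemma supp_in_filter2 B S : supp_in B (filter2 B S).
Proof. by move=> a b nB; rewrite coef_filter2 (negPf nB). Qed.

Variable p : nat.
Hypothesis p_gt0 : (0 < p)%N.

Lemma cartier2_0 r s : cartier2 p r s 0 = 0 :> {poly {poly R}}.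
Proof. by apply/polyP => a; apply/polyP => b; rewrite coef_cartier2 // !coef0. Qed.

Lemma cartier2_sum r s I (l : seq I) (Q : pred I) (f : I -> {poly {poly R}}) :
  cartier2 p r s (\sum_(i <- l | Q i) f i) = \sum_(i <- l | Q i) cartier2 p r s (f i).
Proof. by apply: big_morph => [S T|]; [exact: cartier2D | exact: cartier2_0]. Qed.

Lemma cartier2Mn r s S n : cartier2 p r s (S *+ n) = cartier2 p r s S *+ n.
Proof.
by elim: n => [|n IH]; rewrite ?mulr0n ?cartier2_0 // !mulrS cartier2D // IH.
Qed.

Lemma supp_in_cartier2 B B' r s S :
  (forall a b, B (p * a + r)%N (p * b + s)%N -> B' a b) ->
  supp_in B S -> supp_in B' (cartier2 p r s S).
Proof.
move=> BB' sS a b nB'; rewrite coef_cartier2 //; apply: sS; apply: contra nB'; exact: BB'.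
Qed.

Lemma coef_frobenius2 S a b : (frobenius2 p S)`_a`_b =
  if (p %| a)%N && (p %| b)%N then S`_(a %/ p)`_(b %/ p) else 0.
Proof.
rewrite /frobenius2 coef_comp_poly_Xn //; case: ifP => /= _; last by rewrite coef0.
by rewrite coef_map_id0 ?comp_poly0 // coef_comp_poly_Xn.
Qed.

End Supports.

(** * Numerators decomposed by level, and their Cartier steps *)

Section LevelModule.
Variables (p al : nat) (A : residue_ring p al) (h d : nat) (P : {poly {poly A}}).
Local Notation K := (p ^ al.-1)%N.
Implicit Types S T : {poly {poly A}}.

Let p_pr : prime p := residue_prime A.
Let p_gt0 : (0 < p)%N := prime_gt0 p_pr.
Let p_gt1 : (1 < p)%N := prime_gt1 p_pr.
Let al_gt0 : (0 < al)%N := residue_al_gt0 A.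

(** The exponents available to P^n; the condition n <= a + b records P(0, 0) = 0. *)
Definition newton_box n (a b : nat) := [&& a <= n * h, b <= n * d & n <= a + b]%N.

Hypothesis suppP : supp_in (newton_box 1) P.

Lemma newton_boxD m n a b a' b' :
  newton_box m a b -> newton_box n a' b' -> newton_box (m + n) (a + a') (b + b').
Proof.
rewrite /newton_box !mulnDl => /and3P[? ? ?] /and3P[? ? ?]; apply/and3P; split; lia.
Qed.

Lemma supp_in_newton_exp m n S : supp_in (newton_box m) S -> supp_in (newton_box (n * m)) (S ^+ n).
Proof.
move=> sS; elim: n => [|n IH].
  by move=> [|a] [|b] //= _; rewrite expr0 coef1 /= ?coef1 ?coef0.
by rewrite exprS mulSn; apply: supp_inM sS IH; exact: newton_boxD.
Qed.

Lemma supp_in_exp n : supp_in (newton_box n) (P ^+ n).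
Proof. by rewrite -[n in newton_box n]muln1; exact: supp_in_newton_exp. Qed.

Lemma bipoly_mulrn_expp S : S *+ p ^ al = 0.
Proof. by apply/polyP => a; rewrite coefMn poly_mulrn_expp coef0. Qed.

Lemma frobenius2_frob S : eqmodr p (S ^+ p) (frobenius2 p S).
Proof.
have frob1 (q : {poly A}) : eqmodr p (q ^+ p) (comp_poly 'X^p q).
  have := @frobenius_poly_frob A p idfun p_pr (@residue_frob p al A) q.
  by rewrite /frobenius_poly map_poly_id.
exact: (@frobenius_poly_frob {poly A} p (comp_poly 'X^p) p_pr frob1 S).
Qed.

Lemma frobenius2_expp S : S ^+ (p * K) = frobenius2 p S ^+ K.
Proof.
rewrite exprM; have := eqmodr_expp p_pr al.-1 (frobenius2_frob S).
by rewrite (prednK al_gt0) => -[c ->]; rewrite bipoly_mulrn_expp addr0.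
Qed.

(** A quotient by p is not unique in A, so an arbitrary one is truncated to the box. Outside the box
    P^p and P(x^p, y^p) both vanish, so p times the discarded part is 0. *)
Lemma frobenius2_remainder : exists R : {poly {poly A}}, P ^+ p = frobenius2 p P + R *+ p /\
  supp_in (newton_box p) R.
Proof.
have [c eq_c] := frobenius2_frob P.
exists (filter2 (newton_box p) c); split; last exact: supp_in_filter2.
rewrite eq_c; congr (_ + _); apply/polyP => a; apply/polyP => b.
rewrite !coefMn coef_filter2; case: ifP => // /negbT nbox.
have := congr1 (fun S : {poly {poly A}} => S`_a`_b) eq_c.
rewrite (supp_in_exp nbox) !coefD !coefMn coef_frobenius2 // mul0rn.
case: ifP => [/andP[/dvdnP[a' a_eq] /dvdnP[b' b_eq]]|_]; last by rewrite add0r => <-.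
rewrite a_eq b_eq !mulnK // suppP ?add0r => [<- //|].
apply: contra nbox; rewrite a_eq b_eq /newton_box => /and3P[? ? ?]; apply/and3P; split; nia.
Qed.

Lemma al_le_K : (al <= K)%N.
Proof. by rewrite -{1}(prednK al_gt0); exact: ltn_expl. Qed.

(* S / P^K = sum_(j < al) p^j S_j / P^(j+1), with S_j supported in the set [B j]. *)
Definition in_level (B : nat -> nat -> nat -> bool) S :=
  exists2 Sj : nat -> {poly {poly A}}, (forall j, supp_in (B j) (Sj j)) &
    S = \sum_(j < al) (Sj j * P ^+ (K - j.+1)) *+ p ^ j.

Lemma in_level0 B : in_level B 0.
Proof.
exists (fun=> 0) => [j|]; first exact: supp_in0.
by rewrite big1 // => j _; rewrite mul0r mul0rn.
Qed.

Lemma in_levelD B S T : in_level B S -> in_level B T -> in_level B (S + T).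
Proof.
case=> Sj sS -> [Tj sT ->]; exists (fun j => Sj j + Tj j) => [j|]; first exact: supp_inD.
by rewrite -big_split; apply: eq_bigr => j _; rewrite mulrDl mulrnDl.
Qed.

Lemma in_level_term B j T : (j < al)%N -> supp_in (B j) T ->
  in_level B ((T * P ^+ (K - j.+1)) *+ p ^ j).
Proof.
move=> j_lt sT; exists (fun i => if i == j then T else 0) => [i|].
  by case: eqP => [->|_] //; exact: supp_in0.
rewrite (bigD1 (Ordinal j_lt)) //= eqxx big1 ?addr0 // => i i_neq.
by rewrite ifF ?mul0r ?mul0rn //; apply: contraNF i_neq => /eqP ij; apply/eqP/val_inj.
Qed.

(* The triples (a0, mu, nu) in use are (0, 1, 1) for the states reached through a nonzero
   digit, (0, 0, 1) for the orbit under zero digits, (0, 0, 0) for the initial state and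
   (1, 1, 2) for states with vanishing borders. *)
Definition box a0 mu nu j (a b : nat) :=
  [&& a0 <= a, a + mu <= j.+1 * h, b + nu <= j.+1 * d & j <= a + b]%N.

(** Put M = K - j - 1 and P^p = P(x^p, y^p) + p R. In the expansion of P^(pM) the i-th term lands at
    level j + i with the factor P(x^p, y^p)^(M-i), which leaves the section as P^(M-i) =
    P^(K-(j+i)-1). Terms with j + i >= alpha vanish. *)
Lemma in_level_cartier_step mu nu r S : (r < p)%N -> in_level (box 0 mu nu) S ->
  in_level (box 0 (0 < r + mu) 1) (cartier_step p K P r S).
Proof.
move=> rp [Sj sS ->]; rewrite /cartier_step mulr_suml cartier2_sum //.
have [R [P_R sR]] := frobenius2_remainder.
elim/big_ind: _ => [|S1 S2|j _]; [exact: in_level0 | exact: in_levelD |].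
have j_lt := ltn_ord j; set M := (K - j.+1)%N.
have jK : (j.+1 <= K)%N by apply: leq_trans al_le_K.
have -> : Sj j * P ^+ M *+ p ^ j * P ^+ (p.-1 * K) =
   \sum_(i < M.+1) (Sj j * P ^+ (j.+1 * p.-1) * R ^+ i * frobenius2 p (P ^+ (M - i)))
      *+ 'C(M, i) *+ p ^ (j + i).
  have -> : P ^+ (p.-1 * K) = P ^+ (p.-1 * M) * P ^+ (j.+1 * p.-1).
    by rewrite -exprD [(j.+1 * _)%N]mulnC -mulnDr subnK.
  have -> : Sj j * P ^+ M *+ p ^ j * (P ^+ (p.-1 * M) * P ^+ (j.+1 * p.-1)) =
      (Sj j * P ^+ (j.+1 * p.-1) * P ^+ (p * M)) *+ p ^ j.
    rewrite mulrnAl; congr (_ *+ _).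
    have -> : (p * M = M + p.-1 * M)%N by rewrite -mulSn prednK.
    by rewrite exprD; ring.
  rewrite [P ^+ (p * M)]exprM P_R exprDn mulr_sumr -sumrMnl; apply: eq_bigr => i _.
  rewrite exprMn_n frobenius2_exp mulrnAr -!mulrnA expnD mulrnAr.
  by rewrite -mulrnA; congr (_ *+ _); [ring | lia].
rewrite cartier2_sum //.
elim/big_ind: _ => [|S1 S2|i _]; [exact: in_level0 | exact: in_levelD |].
rewrite !cartier2Mn // cartier2M ?ltn_predL //.
have [ij_lt|ij_ge] := ltnP (j + i) al; last first.
  have -> : (p ^ (j + i) = p ^ al * p ^ (j + i - al))%N by rewrite -expnD subnKC.
  by rewrite mulrnA bipoly_mulrn_expp mul0rn; exact: in_level0.
have -> : (M - i = K - (j + i).+1)%N by rewrite /M; lia.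
rewrite -mulrnAl; apply: in_level_term => //; apply: supp_inMn.
set n := (j.+1 * p.-1 + i * p)%N; set N := (j + i).+1.
have nN : (j.+1 + n = p * N)%N.
  rewrite /n /N addnA -mulnS prednK // -mulnDl mulnC; congr (_ * _)%N; lia.
have sPR : supp_in (newton_box n) (P ^+ (j.+1 * p.-1) * R ^+ i).
  apply: (@supp_inM _ (newton_box (j.+1 * p.-1)) (newton_box (i * p))).
  - move=> a b a' b'; exact: newton_boxD.
  - exact: supp_in_exp.
  - exact: supp_in_newton_exp.
rewrite -mulrA.
(* Before the section the numerator has the bounds of P^(pN), except that its lower corner is a + b
   >= pN - 1, as S_j may have order one less than P^(j+1). *)
pose B a b := [&& a + mu <= p * N * h, b + nu <= p * N * d & p * N <= (a + b).+1]%N.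
apply: (@supp_in_cartier2 _ _ p_gt0 B) => [a b|]; last first.
  apply: (supp_inM _ (sS j) sPR) => a b a' b'.
  rewrite /box /newton_box /B -nN !mulnDl => /and4P[? ? ? ?] /and3P[? ? ?].
  by apply/and3P; split; lia.
(* The exponents are p a + r and p b + p - 1. Division by p makes the bound on b strict, makes the
   one on a strict when r + mu > 0, and leaves a + b >= N - 1. *)
rewrite /B /box -!mulnA => /and3P[a_le b_le ab_ge]; apply/and4P; split=> //.
- have [rmu0|rmu] := posnP (r + mu); first by rewrite addn0 -(leq_pmul2l p_gt0); lia.
  by rewrite addn1 -(ltn_pmul2l p_gt0); lia.
- by rewrite addn1 -(ltn_pmul2l p_gt0); lia.
- rewrite -ltnS -(ltn_pmul2l p_gt0) mulnS mulnDr.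
  by move: ab_ge; rewrite /N mulnS; lia.
Qed.

Lemma in_level_init : in_level (box 0 0 0) ('X%:P * derivY P * P ^+ K.-1).
Proof.
have -> : 'X%:P * derivY P * P ^+ K.-1 = ('X%:P * derivY P * P ^+ (K - 0.+1)) *+ p ^ 0.
  by rewrite expn0 mulr1n subn1.
apply: in_level_term => // a b nB; rewrite coefCM coefXM.
case: b nB => [//|b] nB /=.
rewrite /derivY coef_map_id0 ?deriv0 // coef_deriv suppP ?mul0rn //.
apply: contra nB; rewrite /newton_box /box !mul1n => /and3P[? ? ?].
by apply/and4P; split; lia.
Qed.

End LevelModule.

(** * Counting numerators by digit expansions *)

Section DigitSpan.
Variables (V : zmodType) (p : nat).
Hypothesis p_gt1 : (1 < p)%N.
Implicit Types (x y : V) (s t : seq V).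

(** All combinations with coefficients in {0, ..., p-1}, as a list that may repeat values; its
    length bounds their number. *)
Fixpoint digit_span s : seq V :=
  if s is x :: t then [seq x *+ c + y | c <- iota 0 p, y <- digit_span t] else [:: 0].

Lemma size_digit_span s : size (digit_span s) = (p ^ size s)%N.
Proof. by elim: s => //= x s IH; rewrite size_allpairs size_iota IH expnS. Qed.

Lemma mem_digit_span0 s : 0 \in digit_span s.
Proof.
elim: s => [|x s IH]; first by rewrite mem_head.
apply/allpairsP; exists (0%N, 0) => /=; rewrite mem_iota add0n (ltnW p_gt1).
by rewrite mulr0n addr0.
Qed.

Lemma mem_digit_span_cat s t x : x \in digit_span t -> x \in digit_span (s ++ t).
Proof.
move=> x_t; elim: s => //= y s IH; apply/allpairsP; exists (0%N, x) => /=.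
by rewrite mem_iota add0n (ltnW p_gt1) mulr0n add0r.
Qed.

Lemma mem_digit_span_gen s x : x \in s -> x \in digit_span s.
Proof.
elim: s => //= y s IH; rewrite inE => /predU1P[->|/IH xs].
  apply/allpairsP; exists (1%N, 0) => /=; rewrite mem_iota add0n p_gt1 mem_digit_span0.
  by rewrite mulr1n addr0.
exact: (@mem_digit_span_cat [:: y]).
Qed.

Definition add_closed s := forall x y, x \in s -> y \in s -> x + y \in s.

Lemma add_closed_mulrn s x n : 0 \in s -> add_closed s -> x \in s -> x *+ n \in s.
Proof. by move=> s0 sD xs; elim: n => [|n IH]; rewrite ?mulr0n // mulrS; exact: sD. Qed.

(** Addition with carry: the digit is c + c' modulo p, and the carried copies of p x are absorbed by
    the span of t. *)
Lemma add_closed_digit_span_cons x t :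
  add_closed (digit_span t) -> x *+ p \in digit_span t -> add_closed (digit_span (x :: t)).
Proof.
move=> tD px u v /allpairsP[[c y] /= [c_lt y_t ->]] /allpairsP[[c' y'] /= [c'_lt y'_t ->]].
apply/allpairsP; exists (((c + c') %% p)%N, (x *+ p) *+ ((c + c') %/ p) + (y + y')) => /=.
split; first by rewrite mem_iota add0n ltn_mod (ltnW p_gt1).
  by apply: (tD); [apply: add_closed_mulrn => //; exact: mem_digit_span0 | exact: tD].
rewrite addrACA -mulrnDr {1}(divn_eq (c + c') p) mulrnDr [RHS]addrA; congr (_ + _).
by rewrite [RHS]addrC -mulrnA [(p * _)%N]mulnC.
Qed.

Lemma add_closed_digit_span_cat s t :
  add_closed (digit_span t) -> {in s, forall x, x *+ p \in digit_span t} ->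
  add_closed (digit_span (s ++ t)).
Proof.
move=> tD; elim: s => //= x s IH ps; apply: add_closed_digit_span_cons.
  by apply: IH => y ys; apply: ps; rewrite inE ys orbT.
by apply: mem_digit_span_cat; apply: ps; exact: mem_head.
Qed.

End DigitSpan.

Section LevelSpan.
Variables (p al : nat) (A : residue_ring p al) (h d : nat) (P : {poly {poly A}}).
Local Notation K := (p ^ al.-1)%N.
Implicit Types S T : {poly {poly A}}.

Let p_pr : prime p := residue_prime A.
Let p_gt1 : (1 < p)%N := prime_gt1 p_pr.

Hypothesis suppP : supp_in (newton_box h d 1) P.

Variables (B : nat -> nat -> nat -> bool) (boxes : nat -> seq (nat * nat)).
Hypothesis boxesP : forall j a b, B j a b -> (a, b) \in boxes j.
Hypothesis boxesB : forall j ab, ab \in boxes j -> B j ab.1 ab.2.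
Hypothesis boxD : forall j a b a' b', B j a b -> newton_box h d 1 a' b' -> B j.+1 (a + a') (b + b').

Let monomial (ab : nat * nat) : {poly {poly A}} := ('X^(ab.2))%:P * 'X^(ab.1).

Definition level_gens j := [seq (monomial ab * P ^+ (K - j.+1)) *+ p ^ j | ab <- boxes j].
Definition level_gens_from j := flatten [seq level_gens i | i <- iota j (al - j)].

Lemma level_gens_fromS j : (j < al)%N -> level_gens_from j = level_gens j ++ level_gens_from j.+1.
Proof. by move=> j_lt; rewrite /level_gens_from subnS -(@prednK (al - j)) ?subn_gt0. Qed.

(** The coefficients of T are classes of natural numbers, so closure under addition puts all
    multiples of the generators into the span. *)
Lemma mem_digit_span_term i j T : add_closed (digit_span p (level_gens_from i)) ->
  (i <= j < al)%N -> supp_in (B j) T ->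
  (T * P ^+ (K - j.+1)) *+ p ^ j \in digit_span p (level_gens_from i).
Proof.
move=> cl /andP[ij j_lt] sT; have span0 := mem_digit_span0 p_gt1 (level_gens_from i).
rewrite -[T]coefK poly_def mulr_suml -sumrMnl; elim/big_ind: _ => // a _.
rewrite -mul_polyC -[T`_a]coefK poly_def rmorph_sum /= !mulr_suml -sumrMnl.
elim/big_ind: _ => // b _; have [Bab|nB] := boolP (B j a b); last first.
  by rewrite sT // scale0r polyC0 !mul0r mul0rn.
have [k ->] := residue_natP T`_a`_b.
have -> : ((k%:R : A) *: 'X^b)%:P * 'X^a * P ^+ (K - j.+1) *+ p ^ j =
   (monomial (nat_of_ord a, nat_of_ord b) * P ^+ (K - j.+1)) *+ p ^ j *+ k.
  by rewrite scaler_nat rmorphMn /= !mulrnAl mulrnAC.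
apply: add_closed_mulrn => //; apply: mem_digit_span_gen => //.
apply/flattenP; exists (level_gens j); first by apply: map_f; rewrite mem_iota; lia.
by apply/mapP; exists (nat_of_ord a, nat_of_ord b) => //; exact: boxesP.
Qed.

(* A carry p * (p^j S P^(K-j-1)) = p^(j+1) (S P) P^(K-j-2) moves to the next level. *)
Lemma add_closed_level_gens i : (i <= al)%N -> add_closed (digit_span p (level_gens_from i)).
Proof.
move=> i_le; rewrite -(subKn i_le); elim: (al - i)%N (leq_subr i al) => [|k IH] k_le.
  rewrite subn0 /level_gens_from subnn /= => x y; rewrite !inE => /eqP-> /eqP->.
  by rewrite addr0.
have i'_lt : (al - k.+1 < al)%N by lia.
have eq_i : ((al - k.+1).+1 = al - k)%N by lia.
rewrite (level_gens_fromS i'_lt) eq_i; apply: add_closed_digit_span_cat => //.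
  by apply: IH; exact: ltnW.
move=> x /mapP[[a b] /boxesB /= Bab ->]; rewrite -mulrnA -expnSr eq_i.
have [k0|k_gt0] := posnP k.
  by rewrite k0 subn0 bipoly_mulrn_expp mem_digit_span0.
have -> : monomial (a, b) * P ^+ (K - (al - k)) = (monomial (a, b) * P) * P ^+ (K - (al - k).+1).
  by rewrite -mulrA -exprS -subSn //; have := al_le_K A; lia.
apply: mem_digit_span_term; [by apply: IH; exact: ltnW | by lia |].
rewrite -eq_i; apply: (@supp_inM _ (fun a' b' => (a' == a) && (b' == b)) (newton_box h d 1)) => //.
  by move=> a1 b1 a' b' /andP[/eqP-> /eqP->]; exact: boxD.
move=> a' b' nB; have := coef_bimonomial (1 : A) a b a' b'.
by rewrite polyC1 mul1r (negPf nB).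
Qed.

Lemma in_level_digit_span S : in_level P B S -> S \in digit_span p (level_gens_from 0).
Proof.
case=> Sj sS ->; have cl := add_closed_level_gens (leq0n al).
elim/big_ind: _ => // [|j _]; first exact: mem_digit_span0.
by apply: mem_digit_span_term => //=; exact: ltn_ord.
Qed.

Lemma size_level_gens : size (level_gens_from 0) = (\sum_(j < al) size (boxes j))%N.
Proof.
rewrite /level_gens_from size_flatten /shape -map_comp subn0 sumnE big_map.
rewrite -(big_mkord xpredT (fun j => size (boxes j))) /index_iota subn0.
by apply: eq_bigr => j _ /=; rewrite size_map.
Qed.

End LevelSpan.

(** * Borders of a numerator and their removal *)

Section SupportSize.
Variable R : comNzRingType.
Implicit Types (S T : {poly {poly R}}) (B : nat -> nat -> bool).

Lemma supp_in_size B S n : supp_in B S -> (forall a b, B a b -> a < n)%N -> (size S <= n)%N.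
Proof.
move=> sS Bn; apply/leq_sizeP => a na; apply/polyP => b; rewrite coef0 sS //.
by apply/negP => /Bn; rewrite ltnNge na.
Qed.

Lemma supp_in_size_coef B S n a : supp_in B S -> (forall a b, B a b -> b < n)%N ->
  (size (S`_a)%R <= n)%N.
Proof.
move=> sS Bn; apply/leq_sizeP => b nb; rewrite sS //.
by apply/negP => /Bn; rewrite ltnNge nb.
Qed.

Lemma supp_in_swapXY B S : supp_in B S -> supp_in (fun a b => B b a) (swapXY S).
Proof. by move=> sS a b nB; rewrite coef_swapXY sS. Qed.

End SupportSize.

Section Borders.
Variables (p al : nat) (A : residue_ring p al) (h d : nat) (P : {poly {poly A}}).
Local Notation K := (p ^ al.-1)%N.
Implicit Types S T : {poly {poly A}}.

Let p_pr : prime p := residue_prime A.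
Let p_gt0 : (0 < p)%N := prime_gt0 p_pr.

Hypotheses (h_gt0 : (0 < h)%N) (d_gt0 : (0 < d)%N).
Hypothesis suppP : supp_in (newton_box h d 1) P.
Hypothesis left_neq0 : map_poly (red A) P`_0 != 0.
Hypothesis right_neq0 : map_poly (red A) P`_h != 0.
Hypothesis top_neq0 : map_poly (red A) (swapXY P)`_d != 0.

(** For a numerator over P^k the borders are the columns x^0 and x^(kh) and the row y^(kd-1): after
    one Cartier step the degree in y is below kd. *)
Definition left_border S : {poly A} := S`_0.
Definition right_border k S : {poly A} := S`_(k * h).
Definition top_border k S : {poly A} := (swapXY S)`_((k * d).-1).

Let size_P n : (size (P ^+ n)%R <= (n * h).+1)%N.
Proof.
apply: (supp_in_size (supp_in_exp suppP (n := n))) => a b /and3P[a_le _ _].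
by rewrite ltnS.
Qed.

Let size_swapP n : (size (swapXY P ^+ n)%R <= (n * d).+1)%N.
Proof.
rewrite -rmorphXn; apply: (supp_in_size (supp_in_swapXY (supp_in_exp suppP (n := n)))) => a b.
by case/and3P => _ b_le _; rewrite ltnS.
Qed.

Let size_swapP1 : (size (swapXY P) <= d.+1)%N.
Proof. by have := size_swapP 1; rewrite expr1 mul1n. Qed.

Let size_P1 : (size P <= h.+1)%N.
Proof. by have := size_P 1; rewrite expr1 mul1n. Qed.

Definition half_box j := box h d 0 0 1 j.

Let half_size j S : supp_in (half_box j) S -> (size S <= (j.+1 * h).+1)%N.
Proof.
move=> sS; apply: (supp_in_size sS) => a b /and4P[_ a_le _ _].
by rewrite ltnS -[a]addn0.
Qed.

Let half_size_swap j S : supp_in (half_box j) S -> (size (swapXY S) <= (j.+1 * d).-1.+1)%N.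
Proof.
move=> sS; apply: (supp_in_size (supp_in_swapXY sS)) => b a /and4P[_ _ b_le _].
by rewrite prednK ?muln_gt0 // -addn1.
Qed.

Lemma left_borderM S n : left_border (S * P ^+ n) = left_border S * P`_0 ^+ n.
Proof. by rewrite /left_border coef0M coef0X. Qed.

Lemma right_borderM k S n : (size S <= (k * h).+1)%N ->
  right_border (k + n) (S * P ^+ n) = right_border k S * P`_h ^+ n.
Proof.
by move=> sS; rewrite /right_border mulnDl (coefM_top sS) // coefX_top.
Qed.

Lemma top_borderM k S n : (0 < k)%N -> (size (swapXY S) <= (k * d).-1.+1)%N ->
  top_border (k + n) (S * P ^+ n) = top_border k S * (swapXY P)`_d ^+ n.
Proof.
move=> k_gt0 sS; rewrite /top_border rmorphM rmorphXn /=.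
have -> : (((k + n) * d).-1 = (k * d).-1 + n * d)%N.
  by have : (0 < k * d)%N by [rewrite muln_gt0 k_gt0]; rewrite mulnDl; lia.
by rewrite (coefM_top sS) // coefX_top.
Qed.

Section Strip.
Variables (b : {poly {poly A}} -> {poly A}) (bj : nat -> {poly {poly A}} -> {poly A}) (q : {poly A}).
Hypothesis bD : forall S T, b (S + T) = b S + b T.
Hypothesis b_level : forall j T, (j < al)%N -> supp_in (half_box j) T ->
  b (T * P ^+ (K - j.+1)) = bj j T * q ^+ (K - j.+1).
Hypothesis q_neq0 : map_poly (red A) q != 0.

Let b0 : b 0 = 0.
Proof. by apply: (addrI (b 0)); rewrite -bD !addr0. Qed.

Let bMn S n : b (S *+ n) = b S *+ n.
Proof. by elim: n => [|n IH]; rewrite ?mulr0n ?b0 // !mulrS bD IH. Qed.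

Let b_sum I (l : seq I) (Q : pred I) (f : I -> {poly {poly A}}) :
  b (\sum_(i <- l | Q i) f i) = \sum_(i <- l | Q i) b (f i).
Proof. by apply: big_morph => [S T|]; [exact: bD | exact: b0]. Qed.

(** Here b stands for one of the borders and q for the matching extremal coefficient of P. Levels
    above i contribute multiples of p^(i+1); after cancelling p^i, the border of S_i times a power
    of q vanishes modulo p, and q is nonzero in the domain F_p[X]. *)
Lemma red_border_eq0 (Sj : nat -> {poly {poly A}}) i : (i < al)%N ->
  (forall j, supp_in (half_box j) (Sj j)) ->
  b (\sum_(i <= j < al) (Sj j * P ^+ (K - j.+1)) *+ p ^ j) = 0 ->
  map_poly (red A) (bj i (Sj i)) = 0.
Proof.
move=> i_lt sS; rewrite big_ltn // bD b_sum big_nat.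
rewrite (eq_bigr (fun j => (b (Sj j * P ^+ (K - j.+1)) *+ p ^ (j - i.+1)) *+ p ^ i.+1)); last first.
  by move=> j /andP[ij _]; rewrite bMn -mulrnA -expnD subnK.
rewrite sumrMnl bMn expnS mulrnA -mulrnDl b_level // => eq0.
have := poly_red_eq0_of_mulrn i_lt eq0.
rewrite rmorphD [X in _ + X = _ -> _](_ : _ = 0) ?addr0; last first.
  by apply/poly_red_eq0P; eexists; reflexivity.
rewrite rmorphM rmorphXn => /eqP; rewrite mulf_eq0 expf_eq0 (negPf q_neq0) andbF orbF.
by move/eqP.
Qed.

End Strip.
Lemma level_bounds j : (j < al)%N -> (j.+1 + (K - j.+1) = K)%N.
Proof. by move=> j_lt; rewrite subnKC // (leq_trans j_lt) // al_le_K. Qed.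

Definition same_borders S T :=
  [/\ left_border S = left_border T, right_border K S = right_border K T
    & top_border K S = top_border K T].

Let left_borderD S T : left_border (S + T) = left_border S + left_border T.
Proof. by rewrite /left_border coefD. Qed.
Let right_borderD k S T : right_border k (S + T) = right_border k S + right_border k T.
Proof. by rewrite /right_border coefD. Qed.
Let top_borderD k S T : top_border k (S + T) = top_border k S + top_border k T.
Proof. by rewrite /top_border rmorphD coefD. Qed.

Let left_level j T : (j < al)%N -> supp_in (half_box j) T ->
  left_border (T * P ^+ (K - j.+1)) = left_border T * P`_0 ^+ (K - j.+1).
Proof. by move=> _ _; exact: left_borderM. Qed.

Let right_level j T : (j < al)%N -> supp_in (half_box j) T ->
  right_border K (T * P ^+ (K - j.+1)) = right_border j.+1 T * P`_h ^+ (K - j.+1).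
Proof.
by move=> j_lt sT; rewrite -{1}(level_bounds j_lt) right_borderM //; exact: half_size.
Qed.

Let top_level j T : (j < al)%N -> supp_in (half_box j) T ->
  top_border K (T * P ^+ (K - j.+1)) = top_border j.+1 T * (swapXY P)`_d ^+ (K - j.+1).
Proof.
by move=> j_lt sT; rewrite -{1}(level_bounds j_lt) top_borderM //; exact: half_size_swap.
Qed.

Definition inner_box j := box h d 1 1 2 j.

Lemma inner_half j a b : inner_box j a b -> half_box j a b.
Proof. by rewrite /inner_box /half_box /box => /and4P[? ? ? ?]; apply/and4P; split; lia. Qed.

Lemma half_boxD j a b a' b' :
  half_box j a b -> newton_box h d 1 a' b' -> half_box j.+1 (a + a') (b + b').
Proof.
rewrite /half_box /box /newton_box => /and4P[? ? ? ?] /and3P[? ? ?].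
by apply/and4P; split; lia.
Qed.

(** Level by level: modulo p the borders of S_i vanish, so S_i = S0 + p T with S0 in the inner box,
    and p T at level i is T P at level i + 1. As S0 contributes nothing to the borders, the
    remaining levels still have zero borders. *)
Lemma strip_borders S : in_level P half_box S -> same_borders S 0 -> in_level P inner_box S.
Proof.
case=> Sj sS ->; rewrite -(big_mkord xpredT (fun j => Sj j * P ^+ (K - j.+1) *+ p ^ j)).
have [dv [dv0 dvP]] := divp_exists A.
have [n] := ubnP (al - 0); elim: n 0%N Sj sS => // n IH i Sj sS; rewrite ltnS => n_ge.
have [al_le|i_lt] := leqP al i; first by rewrite big_geq // => _; exact: in_level0.
move=> [S_left S_right S_top].
have zero0 : left_border 0 = 0 /\ right_border K 0 = 0 /\ top_border K 0 = 0.
  by rewrite /left_border /right_border /top_border rmorph0 !coef0.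
rewrite zero0.1 in S_left; rewrite zero0.2.1 in S_right; rewrite zero0.2.2 in S_top.
have red_left := red_border_eq0 left_borderD left_level left_neq0 i_lt sS S_left.
have red_right := red_border_eq0 (right_borderD K) right_level right_neq0 i_lt sS S_right.
have red_top := red_border_eq0 (top_borderD K) top_level top_neq0 i_lt sS S_top.
pose S0 := filter2 (inner_box i) (Sj i).
have sS0 : supp_in (inner_box i) S0 by exact: supp_in_filter2.
pose T : {poly {poly A}} := map_poly (map_poly dv) (Sj i - S0).
have coefT a b : T`_a`_b = dv ((Sj i)`_a`_b - S0`_a`_b).
  rewrite coef_map_id0 ?coef_map_id0 ?coefB ?coefB //.
  by apply/polyP => k; rewrite coef_map_id0 // !coef0.
have sT : supp_in (half_box i) T.
  move=> a b nB; rewrite coefT sS // sS0 ?subr0 //.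
  by apply: contra nB; exact: inner_half.
have eqS : Sj i = S0 + T *+ p.
  apply/polyP => a; apply/polyP => b; rewrite !coefD !coefMn coefT coef_filter2.
  case: ifP => [_|/negbT nB]; first by rewrite subrr dv0 mul0rn addr0.
  rewrite subr0 add0r; apply: dvP.
  have [Bab|nBab] := boolP (half_box i a b); last by rewrite sS // rmorph0.
  have [a0|a_gt0] := posnP a.
    by have := congr1 (fun f : {poly 'F_p} => f`_b) red_left; rewrite coef0 coef_map a0.
  have [a_h|a_neq] := eqVneq a (i.+1 * h)%N.
    by have := congr1 (fun f : {poly 'F_p} => f`_b) red_right; rewrite coef0 coef_map a_h.
  have b_top : b = (i.+1 * d).-1.
    move: nB Bab; rewrite /inner_box /half_box /box => nB /and4P[? ? ? ?].
    apply/eqP; apply: contraNT nB => b_neq; apply/and4P; split; lia.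
  by have := congr1 (fun f : {poly 'F_p} => f`_a) red_top; rewrite coef0 coef_map coef_swapXY b_top.
pose Sj' j := if j == i.+1 then Sj j + T * P else Sj j.
have sS' j : supp_in (half_box j) (Sj' j).
  rewrite /Sj'; case: eqP => [->|_] //; apply: supp_inD => //.
  by apply: (supp_inM _ sT suppP) => a b a' b'; exact: half_boxD.
have split_sum : \sum_(i <= j < al) Sj j * P ^+ (K - j.+1) *+ p ^ j =
   S0 * P ^+ (K - i.+1) *+ p ^ i + \sum_(i.+1 <= j < al) Sj' j * P ^+ (K - j.+1) *+ p ^ j.
  rewrite big_ltn // {1}eqS mulrDl mulrnDl -addrA; congr (_ + _).
  rewrite mulrnAl -mulrnA -expnS.
  have [al_eq|al_neq] := eqVneq i.+1 al.
    by rewrite al_eq bipoly_mulrn_expp add0r !big_geq.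
  have i1_lt : (i.+1 < al)%N by rewrite ltn_neqAle al_neq.
  rewrite big_ltn // [in RHS]big_ltn // /Sj' eqxx addrA; congr (_ + _).
    rewrite mulrDl mulrnDl addrC -mulrA -exprS -subSn //.
    by rewrite (leq_trans i1_lt) // al_le_K.
  by apply: eq_big_nat => j /andP[j_gt _]; rewrite ifF // gtn_eqF.
have inner0 : [/\ left_border S0 = 0, right_border i.+1 S0 = 0 & top_border i.+1 S0 = 0].
  split; apply/polyP => k; rewrite coef0.
  - by rewrite /left_border sS0 // /inner_box /box.
  - by rewrite /right_border sS0 // /inner_box /box; apply/negP => /and4P[_ ? _ _]; lia.
  - rewrite /top_border coef_swapXY sS0 //; apply/negP => /and4P[_ _ b_le _].
    by have : (0 < i.+1 * d)%N; [rewrite muln_gt0 | lia].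
have sS0' : supp_in (half_box i) S0 by exact: supp_in_sub (@inner_half i) sS0.
have [inner_l inner_r inner_t] := inner0.
rewrite split_sum in S_left S_right S_top *.
apply: in_levelD; first exact: in_level_term.
have borderMn k : [/\ left_border (S0 * P ^+ (K - i.+1) *+ k) = 0,
    right_border K (S0 * P ^+ (K - i.+1) *+ k) = 0 &
    top_border K (S0 * P ^+ (K - i.+1) *+ k) = 0].
  have l0 : left_border (S0 * P ^+ (K - i.+1)) = 0 by rewrite left_level // inner_l mul0r.
  have r0 : right_border K (S0 * P ^+ (K - i.+1)) = 0 by rewrite right_level // inner_r mul0r.
  have t0 : top_border K (S0 * P ^+ (K - i.+1)) = 0 by rewrite top_level // inner_t mul0r.
  elim: k => [|k [IHl IHr IHt]].
    by rewrite mulr0n zero0.1 zero0.2.1 zero0.2.2.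
  by rewrite mulrS left_borderD right_borderD top_borderD l0 r0 t0 IHl IHr IHt !addr0.
have [bl br bt] := borderMn (p ^ i)%N.
apply: IH => //; first by lia.
rewrite left_borderD bl add0r in S_left; rewrite right_borderD br add0r in S_right.
rewrite top_borderD bt add0r in S_top.
by split; rewrite ?zero0.1 ?zero0.2.1 ?zero0.2.2.
Qed.

End Borders.

Lemma iter_mul_period (T : Type) (f : T -> T) (x : T) e L k :
  (forall i, (e <= i)%N -> iter (i + L) f x = iter i f x) ->
  forall i, (e <= i)%N -> iter (i + k * L) f x = iter i f x.
Proof.
move=> per i i_ge; elim: k => [|k IH]; first by rewrite addn0.
by rewrite mulSnr addnA per ?IH // (leq_trans i_ge) ?leq_addr.
Qed.

(** * The orbit under zero digits *)

Section Orbit.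
Variables (p al : nat) (A : residue_ring p al) (h d : nat) (P : {poly {poly A}}).
Local Notation K := (p ^ al.-1)%N.
Implicit Types S T : {poly {poly A}}.

Let p_pr : prime p := residue_prime A.
Let p_gt0 : (0 < p)%N := prime_gt0 p_pr.

Hypotheses (h_gt0 : (0 < h)%N) (d_gt0 : (0 < d)%N).
Hypothesis suppP : supp_in (newton_box h d 1) P.
Hypothesis left_neq0 : map_poly (red A) P`_0 != 0.
Hypothesis right_neq0 : map_poly (red A) P`_h != 0.
Hypothesis top_neq0 : map_poly (red A) (swapXY P)`_d != 0.

Let K_gt0 : (0 < K)%N. Proof. by rewrite expn_gt0 p_gt0. Qed.

Local Notation half := (half_box h d).
Local Notation step := (cartier_step p K P 0).

Lemma in_level_half_supp S : in_level P half S ->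
  supp_in (fun a b => (a <= K * h) && (b < K * d))%N S.
Proof.
case=> Sj sS ->; elim/big_ind: _ => [|S1 S2|j _]; [exact: supp_in0 | exact: supp_inD |].
apply: supp_inMn; have jK : (j.+1 <= K)%N by apply: leq_trans (al_le_K A).
apply: (supp_inM _ (sS j) (supp_in_exp suppP (n := K - j.+1))) => a b a' b'.
rewrite -{2 3}(subnKC jK) /half_box /box /newton_box !mulnDl => /and4P[? ? ? ?] /and3P[? ? ?].
by apply/andP; split; lia.
Qed.

Lemma in_level_half_step S : in_level P half S -> in_level P half (step S).
Proof. by move=> S_in; have := @in_level_cartier_step _ _ A h d P suppP 0 1 0 S p_gt0 S_in. Qed.

(** Column 0 of the new numerator is the (p-1)-section in y of column 0 of S P^((p-1)K), which is a
    product of columns 0. *)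
Lemma left_border_step S : left_border (step S) = border_step p.-1 P`_0 (left_border S).
Proof.
by rewrite /left_border /cartier_step /border_step /cartier2 coef_map_id0 ?cartier0 //
  coef_cartier // muln0 coef0M coef0X.
Qed.

Let size_S S : in_level P half S -> (size S <= (K * h).+1)%N.
Proof.
by move=> /in_level_half_supp sS; apply: (supp_in_size sS) => a b /andP[a_le _]; rewrite ltnS.
Qed.

Let size_swapS S : in_level P half S -> (size (swapXY S) <= (K * d).-1.+1)%N.
Proof.
move=> /in_level_half_supp sS; apply: (supp_in_size (supp_in_swapXY sS)) => b a /andP[_ b_lt].
by rewrite prednK // muln_gt0 K_gt0.
Qed.

(** The column p K h = K h + (p-1) K h is the extremal one of S P^((p-1)K), hence again a
    product. *)
Lemma right_border_step S : in_level P half S ->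
  right_border h K (step S) = border_step p.-1 P`_h (right_border h K S).
Proof.
move=> S_in; rewrite /right_border /cartier_step /border_step /cartier2 coef_map_id0 ?cartier0 //.
rewrite coef_cartier // addn0.
have -> : (p * (K * h) = K * h + (p.-1 * K) * h)%N.
  by rewrite -mulnDl -mulSn prednK // mulnA.
have sP : (size P <= h.+1)%N.
  by apply: (supp_in_size suppP) => a b /and3P[a_le _ _]; rewrite ltnS -[h]mul1n.
by rewrite (coefM_top (size_S S_in)) ?coefX_top // size_exp_le.
Qed.

(** The row p (Kd - 1) + p - 1 = (Kd - 1) + (p-1) K d is extremal in S P^((p-1)K). Along a row the
    section is taken in x, whence the residue 0. *)
Lemma top_border_step S : in_level P half S ->
  top_border d K (step S) = border_step 0 (swapXY P)`_d (top_border d K S).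
Proof.
move=> S_in; rewrite /top_border /cartier_step /border_step.
set U := S * _; set t := (K * d).-1.
have Kd_gt0 : (0 < K * d)%N by rewrite muln_gt0 K_gt0.
have -> : (swapXY (cartier2 p 0 p.-1 U))`_t = cartier p 0 (swapXY U)`_(t + (p.-1 * K) * d).
  apply/polyP => a; rewrite coef_cartier // !coef_swapXY coef_cartier2 //.
  suff -> : (p * t + p.-1 = t + p.-1 * K * d)%N by [].
  rewrite -mulnA -(prednK Kd_gt0) -/t mulnS addnCA [RHS]addnC; congr (_ + _)%N.
  by rewrite -[in LHS](prednK p_gt0) mulSn addnC.
rewrite /U rmorphM rmorphXn /=.
have sP : (size (swapXY P) <= d.+1)%N.
  apply: (supp_in_size (supp_in_swapXY suppP)) => b a /and3P[_ b_le _].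
  by rewrite ltnS -[d]mul1n.
by rewrite (coefM_top (size_swapS S_in)) ?coefX_top // size_exp_le.
Qed.

Lemma in_level_half_iter S e : in_level P half S -> in_level P half (iter e step S).
Proof. by move=> S_in; elim: e => //= e; exact: in_level_half_step. Qed.

Lemma same_borders_iter S e : in_level P half S ->
  [/\ left_border (iter e step S) = iter e (border_step p.-1 P`_0) (left_border S),
      right_border h K (iter e step S) = iter e (border_step p.-1 P`_h) (right_border h K S)
    & top_border d K (iter e step S) = iter e (border_step 0 (swapXY P)`_d) (top_border d K S)].
Proof.
move=> S_in; elim: e => // e [IHl IHr IHt]; rewrite !iterS -IHl -IHr -IHt.
have e_in := in_level_half_iter e S_in.
by rewrite left_border_step right_border_step // top_border_step.
Qed.

(** L1, L2, L3 are periods of the three borders, L1 L2 L3 is a common period, and the other summands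
    of the bound on e' dominate the three preperiods. *)
Lemma border_orbit : exists l1 l2 l3 : seq nat,
  [/\ [/\ uniq l1, uniq l2 & uniq l3],
      [/\ all (leq 1) l1, all (leq 1) l2 & all (leq 1) l3],
      [/\ (\sum_(v <- l1) v <= d)%N, (\sum_(v <- l2) v <= d)%N & (\sum_(v <- l3) v <= h)%N]
    & forall S e, in_level P half S ->
      let L1 := (\prod_(v <- l1) v)%N in let L2 := (\prod_(v <- l2) v)%N in
      let L3 := (\prod_(v <- l3) v)%N in
      exists2 e', (e' < h + d + 2 * al + L1 + L2 + L3 + 2 + L1 * L2 * L3)%N &
        same_borders h d (iter e step S) (iter e' step S)].
Proof.
have sP0 a : (size (P`_a)%R <= d.+1)%N.
  by apply: (supp_in_size_coef _ suppP) => a' b /and3P[_ b_le _]; rewrite ltnS -[d]mul1n.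
have sPd : (size ((swapXY P)`_d)%R <= h.+1)%N.
  apply: (supp_in_size_coef _ (supp_in_swapXY suppP)) => b a /and3P[a_le _ _].
  by rewrite ltnS -[h]mul1n.
have [l1 [u1 pos1 sum1 per1]] := border_step_periodic left_neq0 (sP0 0%N).
have [l2 [u2 pos2 sum2 per2]] := border_step_periodic right_neq0 (sP0 h).
have [l3 [u3 pos3 sum3 per3]] := border_step_periodic top_neq0 sPd.
exists l1, l2, l3; split=> // S e S_in.
have prod_gt0 l : all (leq 1) l -> (0 < \prod_(v <- l) v)%N.
  by move=> pos; rewrite big_seq; apply: prodn_cond_gt0 => v /(allP pos).
move: (prod_gt0 _ pos1) (prod_gt0 _ pos2) (prod_gt0 _ pos3) per1 per2 per3.
move: (\prod_(v <- l1) v)%N (\prod_(v <- l2) v)%N (\prod_(v <- l3) v)%N.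
move=> L1 L2 L3 L1_gt0 L2_gt0 L3_gt0 per1 per2 per3 /=.
set e0 := (h + d + 2 * al + L1 + L2 + L3 + 2)%N; set L := (L1 * L2 * L3)%N.
have L_gt0 : (0 < L)%N by rewrite !muln_gt0 L1_gt0 L2_gt0.
have sS := in_level_half_supp S_in.
have sl a : (size (S`_a)%R <= d * K + 1)%N.
  by rewrite addn1 mulnC; apply: (supp_in_size_coef _ sS) => a' b /andP[_ /ltnW]; rewrite ltnS.
have st : (size (top_border d K S) <= h * K + 1)%N.
  rewrite addn1 mulnC; apply: (supp_in_size_coef _ (supp_in_swapXY sS)) => b a /andP[a_le _].
  by rewrite ltnS.
have [e_lt|e_ge] := ltnP e e0; first by exists e; rewrite ?(leq_trans e_lt) ?leq_addr.
exists (e0 + (e - e0) %% L)%N; first by rewrite ltn_add2l ltn_mod.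
set f := (e0 + _)%N; have f_ge : (e0 <= f)%N by rewrite leq_addr.
have e_eq : (e = f + (e - e0) %/ L * L)%N.
  by rewrite /f -addnA [(_ %% _ + _)%N]addnC -divn_eq subnKC.
have [el er et] := same_borders_iter e S_in; have [fl fr ft] := same_borders_iter f S_in.
rewrite /same_borders el er et fl fr ft e_eq; set k := (_ %/ L)%N; split.
- rewrite [(k * L)%N](_ : _ = (k * L2 * L3) * L1)%N; last by rewrite /L; ring.
  apply: (iter_mul_period (e := e0)) f_ge => i i_ge.
  by apply: per1; [right | exact: sl | move: i_ge; rewrite /e0; clear; lia].
- rewrite [(k * L)%N](_ : _ = (k * L1 * L3) * L2)%N; last by rewrite /L; ring.
  apply: (iter_mul_period (e := e0)) f_ge => i i_ge.
  by apply: per2; [right | exact: sl | move: i_ge; rewrite /e0; clear; lia].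
- rewrite [(k * L)%N](_ : _ = (k * L1 * L2) * L3)%N; last by rewrite /L; ring.
  apply: (iter_mul_period (e := e0)) f_ge => i i_ge.
  by apply: per3; [left | exact: st | move: i_ge; rewrite /e0; clear; lia].
Qed.

End Orbit.

(** * Counting the monomials of the boxes *)

Section BoxCounting.
Local Open Scope nat_scope.
Variables (h d : nat).

(** [box] listed column by column; the truncated j - a is the lower corner, which disappears once a
    >= j. *)
Definition box_list a0 mu nu j : seq (nat * nat) :=
  [seq (a, b) | a <- iota a0 ((j.+1 * h).+1 - mu - a0),
                b <- iota (j - a) ((j.+1 * d).+1 - nu - (j - a))].

Lemma mem_box_list a0 mu nu j a b :
  ((a, b) \in box_list a0 mu nu j) = box h d a0 mu nu j a b.
Proof.
apply/allpairsPdep/idP.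
  case=> a' [b' []]; rewrite !mem_iota => /andP[? ?] /andP[? ?] [-> ->].
  by rewrite /box; apply/and4P; split; lia.
case/and4P => ? ? ? ?; exists a, b; rewrite !mem_iota; split=> //; lia.
Qed.

Lemma size_box_list a0 mu nu j : size (box_list a0 mu nu j) =
  \sum_(a0 <= a < (j.+1 * h).+1 - mu) ((j.+1 * d).+1 - nu - (j - a)).
Proof.
rewrite size_allpairs_dep sumnE big_map /index_iota; apply: eq_bigr => a _.
by rewrite size_iota.
Qed.

Lemma sum_triangle j X : j <= X -> \sum_(0 <= a < X) (j - a) = 'C(j.+1, 2).
Proof.
move=> jX; rewrite (big_cat_nat (leq0n j) jX) //= [X in _ + X]big_nat_cond [X in _ + X]big1 ?addn0.
  elim: j {jX} => [|j IH]; first by rewrite big_geq.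
  rewrite big_nat_recl // subn0 [X in _ + X](eq_bigr (fun i => j - i)); last by move=> i _; rewrite subSS.
  by rewrite IH [RHS]binS bin1 addnC.
by move=> a /andP[/andP[ja _] _]; apply/eqP; rewrite subn_eq0.
Qed.

Lemma size_full_box j : 0 < h -> 0 < d ->
  size (box_list 0 1 1 j) + 'C(j.+1, 2) = j.+1 * h * (j.+1 * d).
Proof.
move=> h_gt0 d_gt0; rewrite size_box_list !subSS !subn0.
have jX : j <= j.+1 * h by apply: leq_trans (leqnSn j) (leq_pmulr _ h_gt0).
rewrite -(sum_triangle jX) -big_split /=.
rewrite (eq_bigr (fun=> j.+1 * d)) => [|a _]; first by rewrite sum_nat_const_nat subn0.
by rewrite subnK //; have := leq_pmulr j.+1 d_gt0; lia.
Qed.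

(** Column 0 has (j+1)d - j >= d monomials, and each of the (j+1)h - 1 other columns loses its top
    one. *)
Lemma size_inner_box j : 0 < h -> 0 < d ->
  size (box_list 1 1 2 j) + (h + d - 1) <= size (box_list 0 1 1 j).
Proof.
move=> h_gt0 d_gt0; rewrite !size_box_list !subSS !subn0.
have X_ge := leq_pmulr j.+1 h_gt0; have Y_ge := leq_pmulr j.+1 d_gt0.
rewrite [X in _ <= X]big_ltn; last by lia.
rewrite subn0.
have : \sum_(1 <= a < j.+1 * h) (j.+1 * d - 1 - (j - a)) + (j.+1 * h - 1) <=
    \sum_(1 <= a < j.+1 * h) (j.+1 * d - (j - a)).
  have -> : j.+1 * h - 1 = \sum_(1 <= a < j.+1 * h) 1 by rewrite sum_nat_const_nat muln1.
  rewrite -big_split /= leq_sum // => a _.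
  by lia.
have d_le : d <= j.+1 * d - j.
  by rewrite mulSn -addnBA ?leq_addr // leq_pmulr.
have h_le : h <= j.+1 * h by rewrite leq_pmull.
by rewrite subn1; lia.
Qed.

(** Induction on alpha, after multiplication by 6 to clear the quotient in [bound_exponent]. *)
Lemma sum_full_box al : 0 < h -> 0 < d ->
  \sum_(j < al) size (box_list 0 1 1 j) = bound_exponent al h d.
Proof.
move=> h_gt0 d_gt0; apply/eqP; rewrite -(eqn_pmul2l (isT : 0 < 6)) bound_exponentE //.
apply/eqP; have hd_gt0 : 0 < h * d by rewrite muln_gt0 h_gt0.
elim: al => [|al IH]; first by rewrite big_ord0 muln0 /numer_exponent !mul0n.
rewrite big_ord_recr mulnDr /= IH /numer_exponent.
have bin2_eq : al.+1 * al = 2 * 'C(al.+1, 2) by rewrite -mul_bin_diag bin1.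
have := size_full_box al h_gt0 d_gt0.
have -> : al.+1 * h * (al.+1 * d) = al.+1 * al.+1 * (h * d) by rewrite mulnACA.
rewrite -!(mulnA 2 h d); have [y ->] : exists y, h * d = y.+1 by exists (h * d).-1; rewrite prednK.
move: (size _) ('C(_, 2)) bin2_eq => s c bin2_eq s_eq.
have -> : 2 * y.+1 - 1 = 2 * y + 1 by lia.
by lia.
Qed.

Lemma sum_inner_box al : 0 < h -> 0 < d ->
  \sum_(j < al) size (box_list 1 1 2 j) + al * (h + d - 1) <=
  \sum_(j < al) size (box_list 0 1 1 j).
Proof.
move=> h_gt0 d_gt0; have -> : al * (h + d - 1) = \sum_(j < al) (h + d - 1).
  by rewrite sum_nat_const card_ord.
by rewrite -big_split /=; apply: leq_sum => j _; exact: size_inner_box.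
Qed.

End BoxCounting.

(** * Finitely many states and the p-kernel *)

Definition fps_section (R : Type) (p : nat) (f : fps R) (r : 'I_p) : fps R :=
  Fps (fun n => f (p * n + r)%N).

Section KernelStates.
Variables (p al : nat) (A : residue_ring p al) (h d : nat) (P : {poly {poly A}}) (F : fps A).
Local Notation K := (p ^ al.-1)%N.
Implicit Types S T : {poly {poly A}}.

Let p_pr : prime p := residue_prime A.
Let p_gt0 : (0 < p)%N := prime_gt0 p_pr.

Hypotheses (h_gt0 : (0 < h)%N) (d_gt0 : (0 < d)%N).
Hypothesis suppP : supp_in (newton_box h d 1) P.
Hypothesis left_neq0 : map_poly (red A) P`_0 != 0.
Hypothesis right_neq0 : map_poly (red A) P`_h != 0.
Hypothesis top_neq0 : map_poly (red A) (swapXY P)`_d != 0.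

Local Notation step r := (cartier_step p K P r).
Local Notation init := ('X%:P * derivY P * P ^+ K.-1).

Lemma box_digit_span a0 mu nu S : in_level P (box h d a0 mu nu) S ->
  S \in digit_span p (level_gens_from P (box_list h d a0 mu nu) 0).
Proof.
apply: (in_level_digit_span suppP) => [j a b|j [a b]|j a b a' b'].
- by rewrite mem_box_list.
- by rewrite mem_box_list.
rewrite /box /newton_box => /and4P[? ? ? ?] /and3P[? ? ?].
by apply/and4P; split; lia.
Qed.

Lemma in_level_half_sub S T : in_level P (half_box h d) S -> in_level P (half_box h d) T ->
  in_level P (half_box h d) (S - T).
Proof.
move=> S_in [Tj sT ->]; apply: in_levelD => //.
exists (fun j => - Tj j) => [j|]; first exact: supp_inN.
by rewrite -sumrN; apply: eq_bigr => j _; rewrite mulNr mulNrn.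
Qed.

Lemma in_level_box_step r nu S : (r < p)%N -> (0 < r)%N -> in_level P (box h d 0 0 nu) S ->
  in_level P (box h d 0 1 1) (step r S).
Proof.
move=> rp r_gt0 S_in; have := in_level_cartier_step suppP rp S_in.
by rewrite addn0 r_gt0.
Qed.

(** A word of zeros stays in the zero orbit; the first nonzero digit leads into the box (0, 1, 1),
    which all later steps preserve. A state of the zero orbit differs from one of the first e0
    states by an element with zero borders, that is, by an element of the inner box. *)
Lemma states_list : exists l1 l2 l3 : seq nat,
  [/\ [/\ uniq l1, uniq l2 & uniq l3], [/\ all (leq 1) l1, all (leq 1) l2 & all (leq 1) l3],
      [/\ (\sum_(v <- l1) v <= d)%N, (\sum_(v <- l2) v <= d)%N & (\sum_(v <- l3) v <= h)%N]
    & let L1 := (\prod_(v <- l1) v)%N in let L2 := (\prod_(v <- l2) v)%N in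
      let L3 := (\prod_(v <- l3) v)%N in
      exists2 states : seq {poly {poly A}},
        (size states <= p ^ bound_exponent al h d +
          (h + d + 2 * al + L1 + L2 + L3 + 3 + L1 * L2 * L3) *
          p ^ (\sum_(j < al) size (box_list h d 1 1 2 j)))%N &
        forall w : seq 'I_p, foldl (fun S (r : 'I_p) => step r S) init w \in states].
Proof.
have [l1 [l2 [l3 [us poss sums orbit]]]] :=
  border_orbit h_gt0 d_gt0 suppP left_neq0 right_neq0 top_neq0.
exists l1, l2, l3; split=> // L1 L2 L3.
set e0 := (h + d + 2 * al + L1 + L2 + L3 + 2 + L1 * L2 * L3)%N.
have init_in : in_level P (box h d 0 0 0) init by exact: in_level_init.
have init1_in : in_level P (half_box h d) (step 0 init).
  by have := @in_level_cartier_step _ _ A h d P suppP 0 0 0 init p_gt0 init_in.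
pose inner := digit_span p (level_gens_from P (box_list h d 1 1 2) 0).
pose full := digit_span p (level_gens_from P (box_list h d 0 1 1) 0).
(* [init] is listed apart, because y P_y may contain y^d and so leave the half box; this accounts
   for the constant 3 in place of 2. *)
exists (full ++ init :: [seq iter e (step 0) (step 0 init) + T | e <- iota 0 e0, T <- inner]).
  rewrite size_cat /= size_allpairs size_iota !size_digit_span !size_level_gens.
  rewrite sum_full_box // leq_add2l.
  have : (0 < p ^ \sum_(j < al) size (box_list h d 1 1 2 j))%N by rewrite expn_gt0 p_gt0.
  move: (p ^ _)%N => x x_gt0.
  rewrite (_ : h + d + 2 * al + L1 + L2 + L3 + 3 + L1 * L2 * L3 = e0 + 1)%N; last by rewrite /e0; lia.
  by rewrite mulnDl mul1n -addn1 leq_add2l.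
suff inv w : (exists e, foldl (fun S (r : 'I_p) => step r S) init w = iter e (step 0) init) \/
    in_level P (box h d 0 1 1) (foldl (fun S (r : 'I_p) => step r S) init w).
  move=> w; rewrite mem_cat inE; case: (inv w) => [[[|e] ->]|w_in].
  - by rewrite eqxx !orbT.
  - rewrite iterSr; have [e' e'_lt same] := orbit (step 0 init) e init1_in.
    apply/orP; right; apply/orP; right; apply/allpairsP.
    set x := iter e _ _ in same *; set x' := iter e' _ _ in same.
    exists (e', x - x') => /=; split; [by rewrite mem_iota | | by rewrite addrC subrK].
    apply/box_digit_span/(strip_borders h_gt0 d_gt0 suppP left_neq0 right_neq0 top_neq0).
      by apply: in_level_half_sub; exact: in_level_half_iter.
    case: same => sl sr st; split.
    + by rewrite /left_border coefB [x`_0]sl subrr coef0.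
    + by rewrite /right_border coefB [x`_(K * h)]sr subrr coef0.
    + apply/polyP => i; have := congr1 (fun f : {poly A} => f`_i) st.
      by rewrite /top_border !coef_swapXY !coefB !coef0 => ->; rewrite subrr.
  - by rewrite box_digit_span.
elim/last_ind: w => [|w r [[e IH]|IH]]; first by left; exists 0%N.
- rewrite -cats1 foldl_cat /= IH; have [r0|r_gt0] := posnP r.
    by left; exists e.+1; rewrite r0.
  right; case: e {IH} => [|e]; first exact: in_level_box_step init_in.
  rewrite iterSr; apply: in_level_box_step => //; exact: in_level_half_iter.
- right; rewrite -cats1 foldl_cat /=.
  by have := in_level_cartier_step suppP (ltn_ord r) IH; rewrite addn1.
Qed.

Lemma kernel_list c : F 0%N = 0 -> eval_fps P F = 0 -> P`_0`_1 * c = 1 ->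
  exists l1 l2 l3 : seq nat,
  [/\ [/\ uniq l1, uniq l2 & uniq l3], [/\ all (leq 1) l1, all (leq 1) l2 & all (leq 1) l3],
      [/\ (\sum_(v <- l1) v <= d)%N, (\sum_(v <- l2) v <= d)%N & (\sum_(v <- l3) v <= h)%N]
    & let L1 := (\prod_(v <- l1) v)%N in let L2 := (\prod_(v <- l2) v)%N in
      let L3 := (\prod_(v <- l3) v)%N in
      exists2 kernel : seq (fps A),
        (size kernel <= p ^ bound_exponent al h d +
          (h + d + 2 * al + L1 + L2 + L3 + 3 + L1 * L2 * L3) *
          p ^ (\sum_(j < al) size (box_list h d 1 1 2 j)))%N &
        forall w : seq 'I_p, foldl (@fps_section A p) F w \in kernel].
Proof.
move=> F0 PF Pc; have [l1 [l2 [l3 [us poss sums [states sz w_in]]]]] := states_list.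
have K_gt0 : (0 < K)%N by rewrite expn_gt0 p_gt0.
have [Phi [PhiF Phi_step]] :=
  residue_functional_exists p_gt0 K_gt0 F0 PF Pc (frobenius2_expp P).
exists l1, l2, l3; split=> //; exists (map Phi states) => [|w]; first by rewrite size_map.
have -> : foldl (@fps_section A p) F w = Phi (foldl (fun S (r : 'I_p) => step r S) init w).
  rewrite -PhiF; elim/last_ind: w => // w r IH; rewrite -!cats1 !foldl_cat /= IH.
  by apply: fpsP => n; exact: Phi_step.
exact: map_f.
Qed.

End KernelStates.

(** * The automaton of a finite kernel *)

Section KernelAutomaton.
Variables (p : nat) (B : Type).

Lemma coef_foldl_section (T : Type) (F : fps T) (w : seq 'I_p) n :
  foldl (@fps_section T p) F w n = F (p ^ size w * n + digits_value w)%N.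
Proof.
elim: w F n => [|r w IH] F n /=; first by rewrite mul1n addn0.
by rewrite IH /= expnS -mulnA; congr (F _); lia.
Qed.

Lemma minimal_automaton_exists (M : dfao p B) b : generates M b -> ignores_leading_zeros M ->
  exists2 M' : dfao p B, minimal_automaton M' b & (#|state M'| <= #|state M|)%N.
Proof.
move=> M_gen M_ign.
pose good n := `[< exists M' : dfao p B, [/\ generates M' b, ignores_leading_zeros M' &
  #|state M'| = n] >].
have good_M : good #|state M| by apply/asboolP; exists M.
have good_ex : exists n, good n by exists #|state M|.
have [n n_good n_min] := ex_minnP good_ex.
case/asboolP: (n_good) => M' [M'_gen M'_ign M'_card].
exists M'; last by rewrite M'_card n_min.
split=> // M'' gen'' ign''; rewrite M'_card; apply: n_min.
by apply/asboolP; exists M''.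
Qed.

Variables (R : Type) (F : fps R) (out : R -> B) (kernel : seq (fps R)).
Hypothesis kernelP : forall w : seq 'I_p, foldl (@fps_section R p) F w \in kernel.

Let reachable := [seq f <- undup kernel | `[< exists w : seq 'I_p, f = foldl (@fps_section R p) F w >]].

Let reach_section f (r : 'I_p) : f \in reachable -> fps_section f r \in reachable.
Proof.
rewrite !mem_filter => /andP[/asboolP[w ->] _].
have e : fps_section (foldl (@fps_section R p) F w) r = foldl (@fps_section R p) F (rcons w r).
  by rewrite foldl_rcons.
rewrite e mem_undup kernelP andbT; apply/asboolP; by exists (rcons w r).
Qed.

Let reach_init : F \in reachable.
Proof. by rewrite mem_filter mem_undup (kernelP [::]) andbT; apply/asboolP; exists [::]. Qed.

(** The states are the sections of F reached by some word. The output reads the constant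
    coefficient, which is the coefficient of F at the value of the word and so ignores leading
    zeros. *)
Definition kernel_automaton : dfao p B :=
  @Dfao p B (seq_sub reachable) (SeqSub reach_init)
    (fun f r => SeqSub (reach_section r (ssvalP f))) (fun f => out (ssval f 0%N)).

Lemma output_kernel_automaton w : output kernel_automaton w = out (F (digits_value w)).
Proof.
rewrite /output; set q := foldl _ _ w.
have q_val : ssval q = foldl (@fps_section R p) F w.
  by rewrite /q; elim/last_ind: w {q} => // w r IH; rewrite !foldl_rcons /= IH.
by rewrite /= q_val coef_foldl_section muln0.
Qed.

Lemma automaton_of_kernel :
  exists2 M : dfao p B, minimal_automaton M (fun n => out (F n)) &
    (#|state M| <= size kernel)%N.
Proof.
have gen : generates kernel_automaton (fun n => out (F n)).
  by move=> w n [<- _]; rewrite output_kernel_automaton.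
have ign : ignores_leading_zeros kernel_automaton.
  move=> w z z0; rewrite !output_kernel_automaton; congr (out (F _)).
  by elim: w => [|c w IH] /=; rewrite ?z0 ?IH ?muln0.
have [M M_min M_le] := minimal_automaton_exists gen ign.
exists M => //; apply: leq_trans M_le _.
rewrite [X in (X <= _)%N]card_seq_sub ?filter_uniq ?undup_uniq //.
by rewrite size_filter (leq_trans (count_size _ _)) // size_undup.
Qed.

End KernelAutomaton.

(** * Reduction of the p-adic data modulo p^alpha *)

Section Reduction.
Variables (p : nat) (p_pr : prime p) (al : nat).
Hypothesis al_gt0 : (0 < al)%N.
Local Notation Zp := (padic p_pr).
Local Notation q := (p ^ al)%N.

Let q_gt1 : (1 < q)%N.
Proof. by rewrite -[1%N](expn0 p) ltn_exp2l ?prime_gt1. Qed.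

Lemma natrFp_mod_expp k : (k %% q)%:R = k%:R :> 'F_p.
Proof.
rewrite {2}(divn_eq k q) natrD natrM natrX pchar_Fp_0 // expr0n.
by rewrite (gtn_eqF al_gt0) mulr0 add0r.
Qed.

Definition Zq_red of (0 < al)%N := fun (a : 'Z_q) => (nat_of_ord a)%:R : 'F_p.
Local Notation zred := (Zq_red al_gt0).

Let val_Zq k : nat_of_ord (k%:R : 'Z_q) = (k %% q)%N.
Proof. exact: val_Zp_nat. Qed.

Lemma Zq_red_nat k : zred k%:R = k%:R.
Proof. by rewrite /Zq_red val_Zq natrFp_mod_expp. Qed.

Fact Zq_red_is_zmod_morphism : zmod_morphism zred.
Proof.
have redD a b : zred (a + b) = zred a + zred b.
  by rewrite -[a]natr_Zp -[b]natr_Zp -natrD !Zq_red_nat natrD.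
by move=> a b; have := redD (a - b) b; rewrite subrK => ->; rewrite addrK.
Qed.

Fact Zq_red_is_monoid_morphism : monoid_morphism zred.
Proof.
split=> [|a b]; first exact: (Zq_red_nat 1).
by rewrite -[a]natr_Zp -[b]natr_Zp -natrM !Zq_red_nat natrM.
Qed.

HB.instance Definition _ := GRing.isZmodMorphism.Build 'Z_q 'F_p zred Zq_red_is_zmod_morphism.
HB.instance Definition _ := GRing.isMonoidMorphism.Build 'Z_q 'F_p zred Zq_red_is_monoid_morphism.

Lemma Zq_nat_eq0 k : (k%:R == 0 :> 'Z_q) = (q %| k)%N.
Proof. by rewrite -val_eqE /= val_Zq. Qed.

Lemma Zq_natP (a : 'Z_q) : exists k : nat, a = k%:R.
Proof. by exists a; rewrite natr_Zp. Qed.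

Definition Zq : residue_ring p al :=
  @ResidueRing p al 'Z_q zred p_pr al_gt0 Zq_natP Zq_nat_eq0.

Definition padic_Zq (u : Zp) : 'Z_q := (residue u al)%:R.

Fact padic_Zq_is_zmod_morphism : zmod_morphism padic_Zq.
Proof.
have D u v : padic_Zq (u + v) = padic_Zq u + padic_Zq v.
  by rewrite /padic_Zq /= Zp_nat_mod // natrD.
by move=> u v; have := D (u - v) v; rewrite subrK => ->; rewrite addrK.
Qed.

Fact padic_Zq_is_monoid_morphism : monoid_morphism padic_Zq.
Proof.
by split=> [|u v]; rewrite /padic_Zq /= Zp_nat_mod // natrM.
Qed.

HB.instance Definition _ := GRing.isZmodMorphism.Build Zp 'Z_q padic_Zq padic_Zq_is_zmod_morphism.
HB.instance Definition _ := GRing.isMonoidMorphism.Build Zp 'Z_q padic_Zq padic_Zq_is_monoid_morphism.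

Lemma residue_mod_exp (u : Zp) i j : (i <= j)%N -> (residue u j %% p ^ i)%N = residue u i.
Proof.
move=> /subnK <-; elim: (j - i)%N => [|k IH]; first by rewrite add0n residue_mod.
by rewrite -IH [in RHS]residue_compat modn_dvdm // dvdn_exp2l // leq_addl.
Qed.

Lemma mod_pE (u : Zp) : mod_p u = zred (padic_Zq u).
Proof.
rewrite /padic_Zq Zq_red_nat /mod_p -(@residue_mod_exp u 1 al) // expn1.
apply/eqP; rewrite -val_eqE /= !val_Fp_nat // modn_mod //.
Qed.

Lemma val_padic_Zq (u : Zp) : nat_of_ord (padic_Zq u) = residue u al.
Proof. by rewrite /padic_Zq val_Zq residue_mod. Qed.

(** A residue that is nonzero modulo p is coprime to p^k at every level k, so it cancels there. *)
Lemma padic_unit_cancel (u v : Zp) : mod_p u != 0 -> u * v = 0 -> v = 0.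
Proof.
move=> u_unit uv0; apply: padicP => -[|k]; first by rewrite residue_compat expn0 !modn1.
have := congr1 (fun w : Zp => residue w k.+1) uv0.
have : coprime (p ^ k.+1) (residue u k.+1).
  rewrite coprimeXl // prime_coprime //; apply: contra u_unit => p_dvd.
  rewrite /mod_p -(@residue_mod_exp u 1 k.+1) // expn1.
  by move: p_dvd; rewrite /dvdn => /eqP->.
rewrite /= mod0n => cop /eqP; rewrite -/(dvdn _ _) Gauss_dvdr // /dvdn residue_mod.
by move/eqP.
Qed.

Section FpsMap.
Variables (R S : comNzRingType) (f : {rmorphism R -> S}).

Definition fps_map (g : fps R) : fps S := Fps (fun n => f (g n)).

Fact fps_map_is_zmod_morphism : zmod_morphism fps_map.
Proof. by move=> g1 g2; apply: fpsP => n; rewrite /= rmorphB. Qed.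

Fact fps_map_is_monoid_morphism : monoid_morphism fps_map.
Proof.
split=> [|g1 g2]; apply: fpsP => n; first by case: n => [|n] /=; rewrite ?rmorph1 ?rmorph0.
by rewrite coef_fpsM /= rmorph_sum; apply: eq_bigr => i _; rewrite rmorphM.
Qed.

HB.instance Definition _ := GRing.isZmodMorphism.Build (fps R) (fps S) fps_map
  fps_map_is_zmod_morphism.
HB.instance Definition _ := GRing.isMonoidMorphism.Build (fps R) (fps S) fps_map
  fps_map_is_monoid_morphism.

Lemma eval_fps_map (P : {poly {poly R}}) F :
  eval_fps (map_poly (map_poly f) P) (fps_map F) = fps_map (eval_fps P F).
Proof.
rewrite /eval_fps -horner_map -[X in _ = X.[_]]horner_map /= map_polyC /=.
have -> : fps_map (fps_X R) = fps_X S.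
  by apply: fpsP => n /=; rewrite rmorph_nat.
suff -> : map_poly (map_poly (@fps_const S)) (map_poly (map_poly f) P) =
  map_poly (map_poly fps_map) (map_poly (map_poly (@fps_const R)) P) by [].
apply/polyP => a; apply/polyP => b.
rewrite !coef_map_id0 ?map_poly0 ?rmorph0 //.
by apply: fpsP => -[|n] //=; rewrite rmorph0.
Qed.

End FpsMap.

Section PadicSeries.
Variables (P : {poly {poly Zp}}) (F : fps Zp).
Hypothesis FP : furstenberg_series P F.

Let P00 : P`_0`_0 = 0.
Proof. by case: FP => + _ _ _; rewrite !horner_coef0. Qed.

Let P01_unit : mod_p P`_0`_1 != 0.
Proof.
by case: FP => _ + _ _; rewrite !horner_coef0 /derivY coef_map_id0 ?deriv0 // coef_deriv.
Qed.

Lemma furstenberg_degY_gt0 : (0 < degY P)%N.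
Proof.
rewrite lt0n; apply: contra P01_unit => /eqP dY0; rewrite mod_pE.
have sz : (sizeY P <= 1)%N by move: dY0; rewrite /degY; lia.
have -> : P`_0`_1 = 0.
  by apply: nth_default; apply: leq_trans (max_size_coefXY _ _) sz.
by rewrite !rmorph0.
Qed.

(** If P did not involve x, F would be a root of some s in Z_p[y] with s(0) = 0 and s'(0) a unit.
    Once the coefficients of F below n vanish, the n-th coefficient of s(F) is s'(0) F_n, so F =
    0. *)
Lemma furstenberg_degX_gt0 : F != 0 -> (0 < degX P)%N.
Proof.
move=> F_neq0; rewrite lt0n; apply: contra F_neq0 => /eqP dX0; apply/eqP.
have [_ _ F0 PF] := FP.
have P_const : P = (P`_0)%:P by apply: size1_polyC; move/eqP: dX0; rewrite /degX -subn1 subn_eq0.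
apply: fpsP => n; rewrite coef_fps0; elim/ltn_ind: n => n IH.
have [->|n_gt0] := posnP n; first exact: F0.
apply: (padic_unit_cancel P01_unit).
set s := map_poly (@fps_const Zp) P`_0.
have sE i : s`_i = fps_const P`_0`_i by rewrite /s coef_map_id0 // rmorph0.
have sF : s.[F] = 0 by rewrite -PF /eval_fps {1}P_const map_polyC hornerC.
have := congr1 (fun f : fps Zp => f n) sF.
rewrite horner_coef coef_fps_sum coef_fps0.
have exp_eq0 k : ((F : fps Zp) ^+ k.+2) n = 0.
  rewrite exprS coef_fpsM big1 // => i _.
  have [i_lt|i_ge] := ltnP i n; first by rewrite IH ?mul0r.
  have -> : (n - i = 0)%N by apply/eqP; rewrite subn_eq0.
  by rewrite exprS coef_fpsM big_ord1 F0 mul0r mulr0.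
have [s_le1|s_gt1] := leqP (size s) 1%N.
  move=> _; have s1 : s`_1 = 0 by rewrite nth_default.
  have := congr1 (fun f : fps Zp => f 0%N) s1; rewrite sE coef_fps_const coef_fps0 mulr1n => ->.
  by rewrite mul0r.
rewrite -(subnK s_gt1) addn2 2!big_ord_recl [X in _ + (_ + X)]big1 ?addr0; last first.
  by move=> i _; rewrite sE coef_fps_constM !lift0 exp_eq0 mulr0.
by rewrite !sE !coef_fps_constM lift0 expr0 expr1 P00 mul0r add0r.
Qed.

(** The nonvanishing of the borders of P modulo p comes from P_y(0, 0) for the column x^0, and from
    the degrees of P mod p for the column x^h and the row y^d. *)
Lemma furstenberg_automaton h d : F != 0 ->
  degX (bipoly_mod_p P) = h -> degY (bipoly_mod_p P) = d -> degX P = h -> degY P = d ->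
  exists l1 l2 l3 : seq nat,
  [/\ [/\ uniq l1, uniq l2 & uniq l3], [/\ all (leq 1) l1, all (leq 1) l2 & all (leq 1) l3],
      [/\ (\sum_(v <- l1) v <= d)%N, (\sum_(v <- l2) v <= d)%N & (\sum_(v <- l3) v <= h)%N]
    & let L1 := (\prod_(v <- l1) v)%N in let L2 := (\prod_(v <- l2) v)%N in
      let L3 := (\prod_(v <- l3) v)%N in
      exists2 M : dfao p nat, minimal_automaton M (fun n => residue (F n) al) &
        (#|state M| <= p ^ bound_exponent al h d +
          (h + d + 2 * al + L1 + L2 + L3 + 3 + L1 * L2 * L3) *
          p ^ (\sum_(j < al) size (box_list h d 1 1 2 j)))%N].
Proof.
move=> F_neq0 hX dY hX' dY'.
have h_gt0 : (0 < h)%N by rewrite -hX' furstenberg_degX_gt0.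
have d_gt0 : (0 < d)%N by rewrite -dY' furstenberg_degY_gt0.
pose PA : {poly {poly Zq}} := map_poly (map_poly padic_Zq) P.
have PAE a b : PA`_a`_b = padic_Zq P`_a`_b.
  by rewrite coef_map_id0 ?map_poly0 // coef_map_id0 // rmorph0.
have redE a b : red Zq PA`_a`_b = (bipoly_mod_p P)`_a`_b.
  have mod_p0 : mod_p (0 : Zp) = 0 by rewrite mod_pE !rmorph0.
  rewrite PAE -[LHS]/(zred _) -mod_pE.
  by rewrite coef_map_id0 ?map_poly0 // coef_map_id0.
have suppPA : supp_in (newton_box h d 1) PA.
  move=> a b nB; rewrite PAE; suff -> : P`_a`_b = 0 by exact: rmorph0.
  move: nB; rewrite /newton_box !mul1n; have [a_gt|a_le] := ltnP h a.
    move=> _; rewrite [P`_a]nth_default ?coef0 //; move: hX' a_gt; rewrite /degX.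
    by case: (size P) => // s /= ->.
  have [b_gt|b_le] := ltnP d b.
    move=> _; rewrite nth_default //; apply: leq_trans (max_size_coefXY _ _) _.
    by move: dY' b_gt; rewrite /degY; case: (sizeY P) => // s /= ->.
  by rewrite /= -ltnNge ltnS leqn0 addn_eq0 => /andP[/eqP-> /eqP->].
have left_neq0 : map_poly (red Zq) PA`_0 != 0.
  apply: contra P01_unit => /eqP /(congr1 (fun f : {poly 'F_p} => f`_1)).
  by rewrite coef0 coef_map_id0 ?rmorph0 // PAE mod_pE => h1; apply/eqP.
have right_neq0 : map_poly (red Zq) PA`_h != 0.
  have -> : map_poly (red Zq) PA`_h = (bipoly_mod_p P)`_h.
    by apply/polyP => b; rewrite coef_map_id0 ?rmorph0 // redE.
  rewrite -hX /degX -lead_coefE lead_coef_eq0.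
  by apply: contraTneq h_gt0 => P0; rewrite -hX /degX P0 size_poly0.
have top_neq0 : map_poly (red Zq) (swapXY PA)`_d != 0.
  have -> : map_poly (red Zq) (swapXY PA)`_d = (swapXY (bipoly_mod_p P))`_d.
    by apply/polyP => b; rewrite coef_map_id0 ?rmorph0 // !coef_swapXY redE.
  rewrite -dY /degY sizeYE -lead_coefE lead_coef_eq0.
  by apply: contraTneq d_gt0 => P0; rewrite -dY /degY sizeYE P0 size_poly0.
have P01_A : exists c, PA`_0`_1 * c = 1.
  have : PA`_0`_1 \is a GRing.unit.
    rewrite PAE /padic_Zq unitZpE // coprimeXl // prime_coprime //.
    apply: contra P01_unit => p_dvd; rewrite mod_pE /padic_Zq Zq_red_nat.
    by case/dvdnP: p_dvd => k ->; rewrite natrM pchar_Fp_0 // mulr0.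
  by move=> u; exists (PA`_0`_1)^-1; exact: divrr.
have [c Pc] := P01_A; have [_ _ F0 PF] := FP.
pose FA : fps Zq := fps_map padic_Zq F.
have FA0 : FA 0%N = 0 by rewrite /= F0 rmorph0.
have PFA : eval_fps PA FA = 0.
  by rewrite -[LHS]/(eval_fps (map_poly (map_poly padic_Zq) P) (fps_map padic_Zq F))
    eval_fps_map PF rmorph0.
have [l1 [l2 [l3 [us poss sums [kernel sz kernelP]]]]] :=
  kernel_list h_gt0 d_gt0 suppPA left_neq0 right_neq0 top_neq0 FA0 PFA Pc.
exists l1, l2, l3; split=> // L1 L2 L3.
have [M M_min M_le] := automaton_of_kernel (fun a : Zq => nat_of_ord (a : 'Z_q)) kernelP.
exists M; last exact: leq_trans M_le sz.
have eqF : (fun n => residue (F n) al) = (fun n => nat_of_ord (FA n : 'Z_q)).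
  by apply: funext => n; rewrite -val_padic_Zq.
by rewrite eqF.
Qed.

End PadicSeries.

End Reduction.

(** * Asymptotic comparison of the two kinds of states *)

Section Asymptotics.
Local Open Scope nat_scope.

(** The count is at most a constant times w L1 L2 L3. Twelfth powers cost 2^w for w and for each L,
    hence 2^(4w): the count grows at most like 2^(w/3). *)
Lemma transient_count_le : exists C, forall w h d al l1 l2 l3,
  0 < w -> h <= w -> d <= w -> al <= w ->
  [/\ uniq l1, uniq l2 & uniq l3] -> [/\ all (leq 1) l1, all (leq 1) l2 & all (leq 1) l3] ->
  [/\ \sum_(v <- l1) v <= d, \sum_(v <- l2) v <= d & \sum_(v <- l3) v <= h] ->
  let L1 := \prod_(v <- l1) v in let L2 := \prod_(v <- l2) v in let L3 := \prod_(v <- l3) v in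
  (h + d + 2 * al + L1 + L2 + L3 + 3 + L1 * L2 * L3) ^ 12 <= C * 2 ^ (4 * w).
Proof.
have [C0 C0P] := prod_distinct_le.
have [M M_ge] : exists M, forall w, w ^ 12 <= M * 2 ^ w.
  exists (128 ^ 12) => w; have [w_lt|w_ge] := ltnP w 128.
    apply: leq_trans (leq_pmulr _ _); last by rewrite expn_gt0.
    by rewrite leq_exp2r // ltnW.
  by apply: leq_trans (expn12_le w_ge) (leq_pmull _ _); rewrite expn_gt0.
(* 11 = 1 + 1 + 2 + 1 + 1 + 1 + 3 + 1 adds the weights of the summands, each bounded by w X; B keeps
   it symbolic in the twelfth power. *)
have [B B_eq] : exists B, B = 11 by exists 11.
exists (B ^ 12 * M * C0 ^ 3) => w h d al l1 l2 l3 w_gt0 h_le d_le al_le [u1 u2 u3] [p1 p2 p3] [s1 s2 s3].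
have prod_gt0 l : all (leq 1) l -> 0 < \prod_(v <- l) v.
  by move=> pos; rewrite big_seq; apply: prodn_cond_gt0 => v /(allP pos).
have prod_le l n : uniq l -> \sum_(v <- l) v <= n -> n <= w -> (\prod_(v <- l) v) ^ 12 <= C0 * 2 ^ w.
  move=> ul sl nw; apply: leq_trans (C0P l ul) _.
  by rewrite leq_mul2l leq_exp2l // (leq_trans sl) ?orbT.
move: (prod_gt0 _ p1) (prod_gt0 _ p2) (prod_gt0 _ p3).
move: (prod_le _ _ u1 s1 d_le) (prod_le _ _ u2 s2 d_le) (prod_le _ _ u3 s3 h_le).
move: (\prod_(v <- l1) v) (\prod_(v <- l2) v) (\prod_(v <- l3) v) => L1 L2 L3 b1 b2 b3 g1 g2 g3 /=.
set X := L1 * L2 * L3.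
have X1 : L1 <= X by rewrite /X -mulnA leq_pmulr // muln_gt0 g2.
have X2 : L2 <= X by rewrite /X [L1 * L2]mulnC -mulnA leq_pmulr // muln_gt0 g1.
have X3 : L3 <= X by rewrite /X mulnC leq_pmulr // muln_gt0 g1.
have X12 : X ^ 12 <= C0 ^ 3 * 2 ^ (3 * w).
  have -> : C0 ^ 3 * 2 ^ (3 * w) = (C0 * 2 ^ w) * (C0 * 2 ^ w) * (C0 * 2 ^ w).
    by rewrite [3 * w]mulnC expnM -expnMn mulnn -expnSr.
  by rewrite /X !expnMn; apply: leq_mul => //; exact: leq_mul.
have le11 : h + d + 2 * al + L1 + L2 + L3 + 3 + X <= B * w * X.
  have wX : w <= w * X by rewrite leq_pmulr // (leq_trans g1).
  have XX : X <= w * X by rewrite leq_pmull.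
  rewrite -mulnA B_eq; move: (w * X) => z in wX XX *; lia.
apply: (@leq_trans ((B * w * X) ^ 12)); first by rewrite leq_exp2r.
have e b m x c y : b * (m * x) * (c * y) = b * m * c * (x * y) by ring.
rewrite (_ : 2 ^ (4 * w) = 2 ^ w * 2 ^ (3 * w)); last by rewrite -expnD -mulSn.
rewrite -e (expnMn (B * w)) (expnMn B).
exact: leq_mul (leq_mul (leqnn _) (M_ge w)) X12.
Qed.

End Asymptotics.

(** One threshold serves all four limits, because p^w is at least each of p, alpha, h and d. *)
Lemma automaton_bound_large (R : realType) (eps : R) : 0 < eps ->
  exists n0 : nat, forall (p : nat) (p_pr : prime p) (al h d : nat), (0 < al)%N ->
    [|| n0 <= p, n0 <= al, n0 <= h | n0 <= d]%N -> automaton_bound (1 + eps) p_pr al h d.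
Proof.
move=> eps_gt0; have [C CP] := transient_count_le.
have q_ge0 : 0 <= C%:R / eps ^+ 12 :> R by rewrite divr_ge0 ?ler0n ?exprn_ge0 ?ltW.
exists (Num.bound (C%:R / eps ^+ 12)) => p p_pr al h d al_gt0 large P F FP F_neq0 hX dY hX' dY'.
have [l1 [l2 [l3 [us poss sums [M M_min M_le]]]]] :=
  furstenberg_automaton al_gt0 FP F_neq0 hX dY hX' dY'.
exists M => //.
have h_gt0 : (0 < h)%N by rewrite -hX' (furstenberg_degX_gt0 FP).
have d_gt0 : (0 < d)%N by rewrite -dY' (furstenberg_degY_gt0 al_gt0 FP).
have p_gt1 := prime_gt1 p_pr.
(* w is the exponent saved by passing from the full boxes to the inner ones. *)
set w := (al * (h + d - 1))%N.
have w_gt0 : (0 < w)%N by rewrite muln_gt0 al_gt0; lia.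
have h_le : (h <= w)%N by rewrite /w; nia.
have d_le : (d <= w)%N by rewrite /w; nia.
have al_le : (al <= w)%N by rewrite leq_pmulr //; lia.
have count_le := CP w h d al l1 l2 l3 w_gt0 h_le d_le al_le us poss sums.
move: count_le M_le => /=; set E := (_ + _ * _ * _)%N => count_le M_le.
have Nint_le := sum_inner_box al h_gt0 d_gt0; rewrite sum_full_box // -/w in Nint_le.
move: M_le; set Nint := (\sum_(j < al) _)%N in Nint_le * => M_le.
set N := bound_exponent al h d in Nint_le M_le *.
have p1R : 1 <= p%:R :> R by rewrite ler1n ltnW.
have p0R : 0 < p%:R :> R by rewrite ltr0n ltnW.
have pw_ge : C%:R / eps ^+ 12 <= p%:R ^+ w :> R.
  apply: le_trans (ltW (archi_boundP q_ge0)) _; rewrite -natrX ler_nat.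
  have w_lt : (w <= p ^ w)%N by rewrite ltnW // ltn_expl.
  case/or4P: large => le_n0; apply: leq_trans le_n0 _.
  - by rewrite -{1}[p]expn1 leq_exp2l.
  - exact: leq_trans w_lt.
  - exact: leq_trans w_lt.
  - exact: leq_trans w_lt.
(* E^12 <= C p^(4w) <= eps^12 p^(5w) <= eps^12 p^(12w), as C / eps^12 <= p^w. *)
have E_le : E%:R <= eps * p%:R ^+ w :> R.
  rewrite -(@ler_pXn2r R 12) ?nnegrE ?ler0n ?mulr_ge0 ?exprn_ge0 ?(ltW eps_gt0) ?ler0n //.
  rewrite -[E%:R ^+ 12]natrX; apply: (@le_trans _ _ (C%:R * p%:R ^+ (4 * w))).
    rewrite -[p%:R ^+ _]natrX -natrM ler_nat; apply: leq_trans count_le _.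
    by rewrite leq_mul2l leq_exp2r ?p_gt1 ?orbT // muln_gt0.
  rewrite exprMn -exprM -ler_pdivrMl ?exprn_gt0 // mulrA [_^-1 * _]mulrC.
  apply: (@le_trans _ _ (p%:R ^+ w * p%:R ^+ (4 * w))).
    by rewrite ler_wpM2r // exprn_ge0 // ltW.
  by rewrite -exprD -mulSn mulnC ler_weXn2l // leq_mul2l orbT.
apply: (@le_trans _ _ (p ^ N + E * p ^ Nint)%:R); first by rewrite ler_nat.
rewrite natrD natrM !natrX mulrDl mul1r lerD2l.
apply: (@le_trans _ _ (eps * p%:R ^+ w * p%:R ^+ Nint)).
  by rewrite ler_wpM2r // exprn_ge0 // ltW.
by rewrite -mulrA -exprD ler_pM2l // ler_weXn2l // addnC.
Qed.

Theorem theorem1 (R : realType) (eps : R) (eps_gt0 : 0 < eps) :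
  [/\ forall alpha h d : nat, (0 < alpha)%N ->
        exists p0 : nat, forall (p : nat) (p_pr : prime p), (p0 <= p)%N ->
          automaton_bound (1 + eps) p_pr alpha h d,
      forall (p : nat) (p_pr : prime p) (h d : nat),
        exists alpha0 : nat, forall alpha : nat, (0 < alpha)%N -> (alpha0 <= alpha)%N ->
          automaton_bound (1 + eps) p_pr alpha h d,
      forall (p : nat) (p_pr : prime p) (alpha d : nat), (0 < alpha)%N ->
        exists h0 : nat, forall h : nat, (h0 <= h)%N ->
          automaton_bound (1 + eps) p_pr alpha h d
    & forall (p : nat) (p_pr : prime p) (alpha h : nat), (0 < alpha)%N ->
        exists d0 : nat, forall d : nat, (d0 <= d)%N ->
          automaton_bound (1 + eps) p_pr alpha h d].
Proof.
have [n0 bound] := automaton_bound_large eps_gt0.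
split=> [alpha h d alpha_gt0|p p_pr h d|p p_pr alpha d alpha_gt0|p p_pr alpha h alpha_gt0];
  exists n0.
- by move=> p p_pr n0_le; apply: bound => //; rewrite n0_le.
- by move=> alpha alpha_gt0 n0_le; apply: bound => //; rewrite n0_le !orbT.
- by move=> h n0_le; apply: bound => //; rewrite n0_le !orbT.
- by move=> d n0_le; apply: bound => //; rewrite n0_le !orbT.
Qed.
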